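(* Let $A$ be a C*-algebra. The discretizations $\eta_A \colon A \to P_b(A)$ and $\eta_A \colon A \to P_u(A)$ given by bounded and unbounded profinite completion are: (1) injective if and only if $A$ is residually finite-dimensional; (2) faithful if $A$ is subhomogeneous.
   Context: All algebras and subalgebras are unital and all homomorphisms preserve units (the zero algebra is allowed). A pro-C*-algebra is a topological $*$-algebra that is a directed (inverse) limit of a system of C*-algebras in the category of topological $*$-algebras; morphisms are continuous $*$-homomorphisms. For a C*-algebra $A$, let $\mathcal{F}(A)$ be the family of closed ideals $I$ of $A$ with $A/I$ finite-dimensional; the quotients $A/I$ form an inversely directed system. Define $P_b(A) = \lim_{I \in \mathcal{F}(A)} A/I$ computed in the category of C*-algebras with $*$-homomorphisms (this is a W*-algebra), and $P_u(A) = \lim_{I \in \mathcal{F}(A)} A/I$ computed in the category of pro-C*-algebras. The maps $\eta_A$ from $A$ to $P_b(A)$ and to $P_u(A)$ are induced by the quotient maps $A \to A/I$. $A$ is residually finite-dimensional when it has a faithful (i.e. jointly injective) family of finite-dimensional representations. $A$ is subhomogeneous when there is an integer $n \geq 1$ such that every irreducible representation of $A$ has dimension at most $n$. For a set $X$, $\ell^\infty(X)$ is the W*-algebra of bounded complex functions on $X$ and $\mathbb{C}^X$ is the pro-C*-algebra of all complex functions on $X$ with the topology of pointwise convergence. The map $\eta_A \colon A \to P_b(A)$ is a W*-discretization: for each commutative C*-subalgebra $C \simeq C(X)$ of $A$ ($X$ compact Hausdorff), $\eta_A|_C$ factors through the inclusion $C(X) \to \ell^\infty(X)$ via a normal $*$-homomorphism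 $\phi_C \colon \ell^\infty(X) \to P_b(A)$. The map $\eta_A \colon A \to P_u(A)$ is an unbounded pro-C*-discretization: for each such $C$, $\eta_A|_C$ factors through the inclusion $C(X) \to \mathbb{C}^X$ via a continuous $*$-homomorphism $\phi_C \colon \mathbb{C}^X \to P_u(A)$. Such a discretization is injective when the map $\eta_A$ is injective, and faithful when $\eta_A$ is injective and all the $\phi_C$ (one for each commutative C*-subalgebra $C$ of $A$) can be chosen injective. *)

(* Defs.v *)
From HB Require Import structures.
From mathcomp Require Import all_boot all_order all_algebra.
From mathcomp Require Import all_classical all_reals all_analysis.
From mathcomp Require Import complex ring.

Set Implicit Arguments.
Unset Strict Implicit.
Unset Printing Implicit Defensive.
Import Order.TTheory GRing.Theory Num.Theory.
Import numFieldNormedType.Exports.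
Local Open Scope classical_set_scope.
Local Open Scope ring_scope.
Local Open Scope quotient_scope.

Reserved Notation "x ** y" (at level 40, left associativity).

(* The library's algType only covers nontrivial rings, whereas the zero algebra
   has to be allowed here; hence the multiplication is part of this interface. *)
HB.mixin Record isStarAlgebra (R : realType) A of GRing.Lmodule R[i] A := {
  sone : A;
  smul : A -> A -> A;
  star : A -> A;
  smulA : associative smul;
  smul1 : left_id sone smul;
  smulr1 : right_id sone smul;
  smulDl : forall x y z : A, smul (x + y) z = smul x z + smul y z;
  smulDr : forall x y z : A, smul x (y + z) = smul x y + smul x z;
  smulZl : forall (c : R[i]) (x y : A), smul (c *: x) y = c *: smul x y;
  smulZr : forall (c : R[i]) (x y : A), smul x (c *: y) = c *: smul x y;
  starK : involutive star;
  starD : {morph star : x y / x + y};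
  starZ : forall (c : R[i]) (x : A), star (c *: x) = c^* *: star x;
  starM : forall x y : A, star (smul x y) = smul (star y) (star x)
}.

#[short(type="starAlgType")]
HB.structure Definition StarAlgebra (R : realType) :=
  {A of isStarAlgebra R A & GRing.Lmodule R[i] A}.

#[short(type="starTopologicalType")]
HB.structure Definition StarTopological (R : realType) :=
  {A of StarAlgebra R A & Topological A}.

Arguments sone {R A} : rename.
Notation "x ** y" := (smul x y) : ring_scope.

(* All the norms below are valued in R[i] (and hence in its nonnegative reals),
   as the library requires of a normed module over R[i]. *)
HB.mixin Record StarAlgebra_isNormed (R : realType) A
    of StarAlgebra R A & NormedModule R[i] A := {
  norm_one_le1 : `|sone : A| <= 1;
  norm_smul : forall x y : A, `|x ** y| <= `|x| * `|y|;
  norm_star : forall x : A, `|star x| = `|x|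
}.

#[short(type="normedStarAlgType")]
HB.structure Definition NormedStarAlgebra (R : realType) :=
  {A of StarAlgebra_isNormed R A & StarAlgebra R A & NormedModule R[i] A}.

(* In a C*-algebra the axioms of StarAlgebra_isNormed other than
   submultiplicativity are redundant. *)
HB.mixin Record NormedStarAlgebra_isCStar (R : realType) A
    of NormedStarAlgebra R A := {
  cstar_identity : forall x : A, `|star x ** x| = `|x| ^+ 2
}.

#[short(type="cstarAlgType")]
HB.structure Definition CStarAlgebra (R : realType) :=
  {A of NormedStarAlgebra_isCStar R A & NormedStarAlgebra R A
      & CompleteNormedModule R[i] A}.

HB.mixin Record CompleteNormedModule_isHilbert (R : realType) H
    of CompleteNormedModule R[i] H := {
  dotp : {dot H for Num.conj};
  norm_dotp : forall x : H, `|x| ^+ 2 = dotp x x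
}.

#[short(type="hilbertType")]
HB.structure Definition Hilbert (R : realType) :=
  {H of CompleteNormedModule_isHilbert R H & CompleteNormedModule R[i] H}.

Section StarAlgebraTheory.
Context (R : realType) (A : starAlgType R).
Implicit Types x y : A.

Lemma smul0l x : 0 ** x = 0.
Proof. by rewrite -[X in X ** _](scale0r (0 : A)) smulZl scale0r. Qed.

Lemma smul0r x : x ** 0 = 0.
Proof. by rewrite -[X in _ ** X](scale0r (0 : A)) smulZr scale0r. Qed.

Lemma smulNl x y : (- x) ** y = - (x ** y).
Proof. by rewrite -scaleN1r smulZl scaleN1r. Qed.

Lemma smulNr x y : x ** (- y) = - (x ** y).
Proof. by rewrite -scaleN1r smulZr scaleN1r. Qed.

Lemma smulBl x y z : (x - y) ** z = x ** z - y ** z.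
Proof. by rewrite smulDl smulNl. Qed.

Lemma smulBr x y z : x ** (y - z) = x ** y - x ** z.
Proof. by rewrite smulDr smulNr. Qed.

Lemma star0 : star 0 = 0 :> A.
Proof. by rewrite -[X in star X](scale0r (0 : A)) starZ rmorph0 scale0r. Qed.

Lemma starN x : star (- x) = - star x.
Proof. by rewrite -scaleN1r starZ rmorphN1 scaleN1r. Qed.

Lemma starB x y : star (x - y) = star x - star y.
Proof. by rewrite starD starN. Qed.

Lemma star_one : star sone = sone :> A.
Proof. by rewrite -[LHS]smulr1 -[X in _ ** X]starK -starM smulr1 starK. Qed.

End StarAlgebraTheory.

Section Ideals.
Context (R : realType) (A : cstarAlgType R).

Record closed_ideal := ClosedIdeal {
  ideal_set :> set A;
  ideal0 : ideal_set 0;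
  idealP : forall (c : R[i]) (x y : A),
    ideal_set x -> ideal_set y -> ideal_set (c *: x + y);
  idealMl : forall a x : A, ideal_set x -> ideal_set (a ** x);
  idealMr : forall a x : A, ideal_set x -> ideal_set (x ** a);
  ideal_closed : closed ideal_set
}.

Implicit Types (x y a k r w : A).

Lemma complex_arch (C e : R[i]) :
  0 <= C -> 0 < e -> exists n : nat, C < n%:R * e.
Proof.
move=> C0 e0; have CE : C = (complex.Re C)%:C%C by rewrite RRe_real // ger0_real.
have eE : e = (complex.Re e)%:C%C by rewrite RRe_real // gtr0_real.
have e0' : 0 < complex.Re e by rewrite -ltcR -eE.
exists (Num.truncn (complex.Re C / complex.Re e)).+1.
rewrite CE eE -[_.+1%:R](rmorph_nat (real_complex R)) -rmorphM ltcR.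
by rewrite -ltr_pdivrMr // truncnS_gt.
Qed.

Lemma neumann w : `|w| <= 2^-1 ->
  exists l : A, l ** (sone - w) = sone /\ (sone - w) ** l = sone.
Proof.
move=> w2; have h0 : 0 <= 2^-1 :> R[i] by rewrite invr_ge0 ler0n.
pose p n := iter n (smul w) sone; pose s n := \sum_(k < n) p k.
have pS n : p n.+1 = w ** p n by [].
have pSr n : p n.+1 = p n ** w.
  elim: n => [|n IH]; first by rewrite pS smulr1 smul1.
  by rewrite pS {1}IH smulA.
have pn n : `|p n| <= 2^-1 ^+ n.
  elim: n => [|n IH]; first by rewrite expr0 norm_one_le1.
  by rewrite pS exprS (le_trans (norm_smul _ _)) // ler_pM.
have sS n : s n.+1 = s n + p n by rewrite /s big_ord_recr.
have sl n : s n.+1 = sone + w ** s n.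
  elim: n => [|n IH]; first by rewrite sS /s big_ord0 smul0r addrC.
  by rewrite sS {1}IH pS -addrA -smulDr -sS.
have sr n : s n.+1 = sone + s n ** w.
  elim: n => [|n IH]; first by rewrite sS /s big_ord0 smul0l addrC.
  by rewrite sS {1}IH pSr -addrA -smulDl -sS.
have sd n m : `|s (n + m)%N - s n| <= 2 * 2^-1 ^+ n * (1 - 2^-1 ^+ m).
  elim: m => [|m IH]; first by rewrite addn0 subrr normr0 expr0 subrr mulr0.
  rewrite addnS sS addrAC (le_trans (ler_normD _ _)) //.
  rewrite (le_trans (lerD IH (pn _))) // exprD exprS.
  rewrite (_ : _ + _ = 2 * 2^-1 ^+ n * (1 - 2^-1 * 2^-1 ^+ m)) //.
  by field.
have sd2 n m : (n <= m)%N -> `|s n - s m| <= 2 * 2^-1 ^+ n.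
  move=> nm; rewrite distrC -(subnKC nm) (le_trans (sd _ _)) //.
  by rewrite ler_piMr ?mulr_ge0 ?exprn_ge0 // gerBl exprn_ge0.
have n2 n : n%:R <= 2 ^+ n :> R[i] by rewrite -natrX ler_nat ltnW // ltn_expl.
have small (e : R[i]) : 0 < e -> exists N, 2 * 2^-1 ^+ N < e.
  move=> e0; have [N HN] := @complex_arch 2 e (ler0n _ _) e0.
  exists N; rewrite exprVn ltr_pdivrMr ?exprn_gt0 // mulrC.
  by rewrite (lt_le_trans HN) // ler_pM2r.
have cs : cvg (s @ \oo).
  apply/cauchy_cvgP/cauchy_exP => e e0; have [N HN] := small _ e0.
  exists (s N); exists N => // m /= Nm.
  by rewrite -ball_normE /= (le_lt_trans (sd2 _ _ Nm)).
have [l sll] := (cvg_ex _).1 cs; exists l.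
have lim0 (f : A -> A) : (forall x y, `|f x - f y| <= `|x - y|) ->
    (forall n, s n.+1 = sone + f (s n)) -> l - f l = sone.
  move=> fL fs; apply/eqP; rewrite -subr_eq0; apply: contraT => nz.
  have d0 : 0 < `|l - f l - sone| / 2 by rewrite divr_gt0 ?normr_gt0.
  have /cvgrPdist_lt/(_ _ d0)[N _ HN] := sll.
  have : `|l - f l - sone| < `|l - f l - sone|; last by rewrite ltxx.
  rewrite {1}(_ : _ - _ = (l - s N.+1) + (f (s N) - f l)); last first.
    by rewrite fs opprD !addrA subrK addrAC.
  rewrite (le_lt_trans (ler_normD _ _)) // [ltRHS]splitr ltrD //.
    exact/HN/leqnSn.
  by rewrite (le_lt_trans (fL _ _)) // distrC; apply: HN => /=.
have w1 : `|w| <= 1.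
  by rewrite (le_trans w2) // invf_le1 ?ler1n.
rewrite smulBl smulBr smulr1 smul1; split.
  apply: (lim0 (smul^~ w)) => // x y.
  by rewrite -smulBl (le_trans (norm_smul _ _)) // ler_piMr.
apply: (lim0 (smul w)) => // x y.
by rewrite -smulBr (le_trans (norm_smul _ _)) // ler_piMl.
Qed.

Lemma resolvent j : star j = - j -> `|j| <= 2^-1 -> forall m : nat,
  exists r, [/\ `|r| <= 1, r ** (sone + m%:R *: j) = sone
               & (sone + m%:R *: j) ** r = sone].
Proof.
move=> js j2; elim=> [|m [r [r1 rl rr]]].
  by exists sone; rewrite scale0r addr0 smul1 norm_one_le1.
have [l [ll lr]] : exists l, l ** (sone - - (r ** j)) = sone /\
    (sone - - (r ** j)) ** l = sone.
  apply: neumann; rewrite normrN (le_trans (norm_smul _ _)) //.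
  by rewrite (le_trans _ j2) // ler_piMl.
rewrite opprK in ll lr.
set b := sone + m%:R *: j in rl rr.
have aE : sone + m.+1%:R *: j = b ** (sone + r ** j).
  rewrite smulDr smulr1 smulA rr smul1 /b -addrA.
  by rewrite -natr1 scalerDl scale1r.
pose a := sone + m.+1%:R *: j; pose q := l ** r.
have ql : q ** a = sone by rewrite /a aE /q -smulA (smulA r) rl smul1 ll.
have qr : a ** q = sone.
  by rewrite /a aE /q -smulA (smulA _ l) lr smul1 rr.
exists q; split=> //.
have as_ : star a = sone - m.+1%:R *: j.
  by rewrite starD star_one starZ rmorph_nat js scalerN.
have aC : star a ** a = a ** star a.
  rewrite as_ /a; set y := _ *: j.
  rewrite smulBl smulDr smulDl !smulBr !smul1 !smulr1 smulDr smulr1.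
  by rewrite opprD !addrA addrK subrK.
pose u := star a ** q.
have u1 : `|u| <= 1.
  rewrite -(expr_le1 (n := 2)) // -cstar_identity /u starM starK.
  rewrite smulA -(smulA _ a) -aC smulA -starM qr star_one smul1 qr.
  exact: norm_one_le1.
have -> : q = 2^-1 *: (sone + u).
  rewrite -qr /u -smulDl as_ /a addrACA subrr addr0 -mulr2n -[sone *+ 2]scaler_nat.
  by rewrite smulZl smul1 scalerA mulVf ?pnatr_eq0 // scale1r.
rewrite normrZ ger0_norm ?invr_ge0 // ler_pdivrMl // mulr1.
by rewrite (le_trans (ler_normD _ _)) // lerD // norm_one_le1.
Qed.

(* With k = a^* a in I, the resolvents r_m = (1 + i m s k)^-1 are contractions,
   1 - r_m is in I and r_m a^* tends to 0. *)
Lemma ideal_star (I : closed_ideal) a : ideal_set I a -> ideal_set I (star a).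
Proof.
move=> Ia; pose k := star a ** a; pose s : R[i] := (2 * (`|k| + 1))^-1.
have IZ (c : R[i]) x : ideal_set I x -> ideal_set I (c *: x).
  by move=> Ix; rewrite -[_ *: _]addr0; apply: idealP => //; exact: ideal0.
have Ik : ideal_set I k by exact: idealMl.
have k1 : 0 < `|k| + 1 by rewrite ltr_wpDl.
have s0 : 0 < s by rewrite invr_gt0 mulr_gt0.
pose j := ('i * s) *: k.
have sj : star j = - j.
  rewrite starZ rmorphM /= conjCi (CrealP (gtr0_real s0)) mulNr scaleNr.
  by rewrite starM starK.
have j2 : `|j| <= 2^-1.
  rewrite normrZ normrM normCi mul1r gtr0_norm // /s invfM -mulrA.
  by rewrite ler_piMr ?invr_ge0 // ler_pdivrMl // mulr1 lerDl.
apply: (@ideal_closed I) => B /nbhs_ballP[e /= e0 eB].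
have [m Hm] : exists m : nat, 2 < m%:R * (s * e ^+ 2).
  by apply: complex_arch; rewrite ?ler0n // mulr_gt0 // exprn_gt0.
have [r [r1 rl rr]] := resolvent sj j2 m.
have {}rl : sone - r = m%:R *: (r ** j).
  by rewrite -rl smulDr smulr1 smulZr addrC addKr.
have Ir : ideal_set I (sone - r).
  by rewrite rl; apply: (IZ); rewrite smulZr; apply/IZ/idealMl.
exists ((sone - r) ** star a); split; first exact: idealMr.
apply: eB; rewrite -ball_normE /= smulBl smul1 opprB addrC subrK.
set y := r ** star a.
have ry : m%:R * s * `|y| ^+ 2 <= 2.
  rewrite -(norm_star y) -cstar_identity starK /y starM starK.
  rewrite smulA -(smulA r) -/k.
  have : `|sone - r| <= 2.
    by rewrite (le_trans (ler_normB _ _)) // lerD // norm_one_le1.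
  apply: le_trans; rewrite rl smulZr !normrZ normrM normCi mul1r normr_nat.
  rewrite (gtr0_norm s0) mulrA ler_wpM2l ?mulr_ge0 ?ler0n ?(ltW s0) //.
  by rewrite (le_trans (norm_smul _ _)) // ler_piMr // norm_star.
have m0 : 0 < m%:R :> R[i].
  by rewrite ltr0n; case: m Hm {rl rr ry} => [|//]; rewrite mul0r le_gtF ?ler0n.
have := le_lt_trans ry Hm; rewrite mulrA ltr_pM2l ?mulr_gt0 //.
by rewrite ltr_pXn2r // nnegrE // ltW.
Qed.
End Ideals.

Section Quotient.
Context (R : realType) (A : cstarAlgType R) (I : closed_ideal A).
Implicit Types a b : A.

Definition ideal_pred : {pred A} := mem (ideal_set I).

Lemma ideal_zmod_closed : zmod_closed ideal_pred.
Proof.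
split=> [|x y]; rewrite !inE; first exact: ideal0.
by move=> Ix Iy; rewrite addrC -scaleN1r; apply: idealP.
Qed.

HB.instance Definition _ := GRing.isZmodClosed.Build A ideal_pred ideal_zmod_closed.

Definition quot : Type := Quotient.quot ideal_pred.

HB.instance Definition _ := GRing.Zmodule.on quot.
HB.instance Definition _ := Quotient.on quot.

Definition qproj (a : A) : quot := \pi_quot a.

Lemma qprojP (x y : A) : qproj x = qproj y <-> ideal_set I (x - y).
Proof.
have -> : ideal_set I (x - y) = ((x - y) \in ideal_pred) :> Prop.
  by rewrite unfold_in /= in_setE.
by rewrite Quotient.idealrBE; split => /eqP.
Qed.

Lemma quotP (P : quot -> Prop) : (forall a, P (qproj a)) -> forall x, P x.
Proof. by move=> H x; rewrite -[x]reprK; exact: H. Qed.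

Lemma qprojD : {morph qproj : x y / x + y}.
Proof. exact: Quotient.pi_add. Qed.

Definition quot_scale (c : R[i]) (x : quot) := qproj (c *: repr x).
Definition quot_mul (x y : quot) := qproj (repr x ** repr y).
Definition quot_star (x : quot) := qproj (star (repr x)).

Lemma ideal_repr a : ideal_set I (repr (qproj a) - a).
Proof. by apply/qprojP; rewrite /qproj reprK. Qed.

Lemma quot_scaleE c a : quot_scale c (qproj a) = qproj (c *: a).
Proof.
apply/qprojP; rewrite -scalerBr -[X in ideal_set I X]addr0; apply: idealP.
  exact: ideal_repr.
exact: ideal0.
Qed.

Lemma quot_mulE a b : quot_mul (qproj a) (qproj b) = qproj (a ** b).
Proof.
apply/qprojP; set a' := repr _; set b' := repr _.
have -> : a' ** b' - a ** b = 1 *: ((a' - a) ** b') + a ** (b' - b).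
  by rewrite scale1r smulBl smulBr addrA subrK.
by apply: idealP; [apply/idealMr/ideal_repr|apply/idealMl/ideal_repr].
Qed.

Lemma quot_starE a : quot_star (qproj a) = qproj (star a).
Proof. by apply/qprojP; rewrite -starB; apply/ideal_star/ideal_repr. Qed.

#[local] Obligation Tactic := idtac.

Program Definition quot_lmodMixin := @GRing.Zmodule_isLmodule.Build R[i] quot
  quot_scale _ _ _ _.
Next Obligation.
by move=> c d; elim/quotP=> a; rewrite !quot_scaleE scalerA.
Qed.
Next Obligation. by elim/quotP=> a; rewrite quot_scaleE scale1r. Qed.
Next Obligation.
move=> c; elim/quotP=> a; elim/quotP=> b.
by rewrite -qprojD !quot_scaleE scalerDr qprojD.
Qed.
Next Obligation.
by elim/quotP=> a c d; rewrite !quot_scaleE scalerDl qprojD.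
Qed.
HB.instance Definition _ := quot_lmodMixin.

Lemma qprojZ c a : qproj (c *: a) = c *: qproj a.
Proof. by rewrite -quot_scaleE. Qed.

Lemma qproj0 : qproj 0 = 0.
Proof. by rewrite -(scale0r (0 : A)) qprojZ scale0r. Qed.

Program Definition quot_starMixin := @isStarAlgebra.Build R quot
  (qproj sone) quot_mul quot_star _ _ _ _ _ _ _ _ _ _ _.
Next Obligation.
by elim/quotP=> a; elim/quotP=> b; elim/quotP=> c; rewrite !quot_mulE smulA.
Qed.
Next Obligation. by elim/quotP=> a; rewrite quot_mulE smul1. Qed.
Next Obligation. by elim/quotP=> a; rewrite quot_mulE smulr1. Qed.
Next Obligation.
elim/quotP=> a; elim/quotP=> b; elim/quotP=> c.
by rewrite -qprojD !quot_mulE smulDl qprojD.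
Qed.
Next Obligation.
elim/quotP=> a; elim/quotP=> b; elim/quotP=> c.
by rewrite -qprojD !quot_mulE smulDr qprojD.
Qed.
Next Obligation.
move=> c; elim/quotP=> a; elim/quotP=> b.
by rewrite -qprojZ !quot_mulE smulZl qprojZ.
Qed.
Next Obligation.
move=> c; elim/quotP=> a; elim/quotP=> b.
by rewrite -qprojZ !quot_mulE smulZr qprojZ.
Qed.
Next Obligation. by elim/quotP=> a; rewrite !quot_starE starK. Qed.
Next Obligation.
by elim/quotP=> a; elim/quotP=> b; rewrite -qprojD !quot_starE starD qprojD.
Qed.
Next Obligation.
by move=> c; elim/quotP=> a; rewrite -qprojZ !quot_starE starZ qprojZ.
Qed.
Next Obligation.
elim/quotP=> a; elim/quotP=> b.
by rewrite quot_mulE !quot_starE quot_mulE starM.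
Qed.
HB.instance Definition _ := quot_starMixin.

(* The distance from a representative to I, i.e. the quotient norm. *)
Definition quot_rnorm (x : quot) : R :=
  inf [set complex.Re `|a| | a in [set a | qproj a = x]].

Definition quot_norm (x : quot) : R[i] := (quot_rnorm x)%:C%C.

Lemma normRe a : `|a| = (complex.Re `|a|)%:C%C.
Proof. by rewrite RRe_real // ger0_real. Qed.

Lemma quot_has_inf (x : quot) :
  has_inf [set complex.Re `|a| | a in [set a | qproj a = x]].
Proof.
split; first by elim/quotP: x => a; exists (complex.Re `|a|), a.
exists 0 => _ [a _ <-]; rewrite -lecR -normRe; exact: normr_ge0.
Qed.

Lemma quot_norm_le a : quot_norm (qproj a) <= `|a|.
Proof.
rewrite [leRHS]normRe lecR; apply: ge_inf; last by exists a.
exact: (quot_has_inf (qproj a)).2.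
Qed.

Lemma quot_norm_ge0 (x : quot) : 0 <= quot_norm x.
Proof.
rewrite lecR; apply: lb_le_inf; first exact: (quot_has_inf x).1.
move=> _ [a _ <-]; rewrite -lecR -normRe; exact: normr_ge0.
Qed.

Lemma quot_norm_lt (x : quot) (e : R[i]) : quot_norm x < e ->
  exists2 a, qproj a = x & `|a| < e.
Proof.
move=> xe; have eE : e = (complex.Re e)%:C%C.
  by rewrite RRe_real // gtr0_real // (le_lt_trans (quot_norm_ge0 x)).
move: xe; rewrite eE ltcR => /(inf_lt (quot_has_inf x).1) [_ [a ax <-] ae].
by exists a => //; rewrite normRe ltcR.
Qed.

Lemma quot_normD (x y : quot) : quot_norm (x + y) <= quot_norm x + quot_norm y.
Proof.
apply/ler_addgt0Pl => e e0.
have e2 : 0 < e / 2 by rewrite divr_gt0.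
have [|a <- ha] := @quot_norm_lt x (e / 2 + quot_norm x).
  by rewrite ltrDr.
have [|b <- hb] := @quot_norm_lt y (e / 2 + quot_norm y).
  by rewrite ltrDr.
rewrite -qprojD (le_trans (quot_norm_le _)) // (le_trans (ler_normD _ _)) //.
by rewrite (le_trans (lerD (ltW ha) (ltW hb))) // addrACA -splitr.
Qed.

Lemma quot_normM (x y : quot) : quot_norm (x ** y) <= quot_norm x * quot_norm y.
Proof.
have x0 := quot_norm_ge0 x; have y0 := quot_norm_ge0 y.
apply/ler_addgt0Pr => e e0; set p := quot_norm x; set q := quot_norm y.
have s0 : 0 < p + q + 1 + e by rewrite ltr_wpDl ?addr_ge0.
pose d := e / (p + q + 1 + e).
have d0 : 0 < d by rewrite divr_gt0.
have d1 : d <= 1 by rewrite ler_pdivrMr // mul1r lerDr !addr_ge0.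
have [|a <- ha] := @quot_norm_lt x (p + d); first by rewrite ltrDl.
have [|b <- hb] := @quot_norm_lt y (q + d); first by rewrite ltrDl.
rewrite [_ ** _]quot_mulE (le_trans (quot_norm_le _)) //.
rewrite (le_trans (norm_smul _ _)) // (le_trans (ler_pM _ _ (ltW ha) (ltW hb))) //.
rewrite (_ : (p + d) * (q + d) = p * q + d * (p + q + d)); last by ring.
rewrite lerD2l (le_trans (_ : _ <= d * (p + q + 1 + e))) //.
  rewrite ler_pM2l // (@le_trans _ _ (p + q + 1)) ?lerD2l //.
  by rewrite lerDl ltW.
by rewrite /d divfK // gt_eqF.
Qed.

Lemma quot_normZ_le c (x : quot) : quot_norm (c *: x) <= `|c| * quot_norm x.
Proof.
apply/ler_addgt0Pr => e e0.
have c0 : 0 < `|c| + 1 by rewrite ltr_wpDl.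
have [|a <- ha] := @quot_norm_lt x (quot_norm x + e / (`|c| + 1)).
  by rewrite ltrDl divr_gt0.
rewrite -qprojZ (le_trans (quot_norm_le _)) // normrZ.
rewrite (le_trans (ler_wpM2l _ (ltW ha))) // mulrDr lerD2l.
by rewrite mulrCA ler_piMr ?(ltW e0) // ler_pdivrMr // mul1r lerDl.
Qed.

Lemma quot_normZ c (x : quot) : quot_norm (c *: x) = `|c| * quot_norm x.
Proof.
apply/eqP; rewrite eq_le quot_normZ_le /=; have [->|c0] := eqVneq c 0.
  by rewrite normr0 mul0r quot_norm_ge0.
rewrite -ler_pdivlMl ?normr_gt0 // -normfV.
by rewrite -{1}[x](scalerK c0) quot_normZ_le.
Qed.

Lemma quot_norm0_eq0 (x : quot) : quot_norm x = 0 -> x = 0.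
Proof.
elim/quotP: x => a a0; rewrite -qproj0; apply/qprojP; rewrite subr0.
apply: (@ideal_closed _ _ I) => B /nbhs_ballP[e /= e0 eB].
have [|b ba be] := @quot_norm_lt (qproj a) e; first by rewrite a0.
exists (a - b); split; first exact/qprojP.
by apply: eB; rewrite -ball_normE /= opprB addrC subrK.
Qed.

Lemma quot_norm_star_le (x : quot) : quot_norm (star x) <= quot_norm x.
Proof.
apply/ler_addgt0Pr => e e0.
have [|a <- ha] := @quot_norm_lt x (quot_norm x + e); first by rewrite ltrDl.
rewrite [star _]quot_starE (le_trans (quot_norm_le _)) // norm_star.
exact: ltW.
Qed.

HB.instance Definition _ := @Lmodule_isNormed.Build R[i] quot quot_norm
  quot_normD quot_normZ quot_norm0_eq0.

Lemma quot_norm_one : `|sone : quot| <= 1.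
Proof. exact: le_trans (quot_norm_le _) (@norm_one_le1 R A). Qed.

Lemma quot_norm_star (x : quot) : `|star x| = `|x|.
Proof.
apply/eqP; rewrite eq_le [_ <= _]quot_norm_star_le /=.
by rewrite -{1}[x]starK [_ <= _]quot_norm_star_le.
Qed.

HB.instance Definition _ := @StarAlgebra_isNormed.Build R quot
  quot_norm_one quot_normM quot_norm_star.

End Quotient.

Section ComplexStarAlgebra.
Context (R : realType).
Local Notation C := (R[i]^o).

HB.instance Definition _ := @isStarAlgebra.Build R C 1 *%R Num.conj
  (@mulrA _) (@mul1r _) (@mulr1 _) (@mulrDl _) (@mulrDr _)
  (fun c x y => esym (mulrA c x y)) (fun c x y => mulrCA x c y)
  (@conjCK _) (rmorphD _) (rmorphM _)
  (fun x y => etrans (rmorphM _ x y) (mulrC _ _)).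

Let norm1 : `|sone : C| <= 1. Proof. by rewrite normr1. Qed.
Let normM (x y : C) : `|x ** y| <= `|x| * `|y|. Proof. by rewrite normrM. Qed.
Let normS (x : C) : `|star x| = `|x|. Proof. exact: norm_conjC. Qed.

HB.instance Definition _ := @StarAlgebra_isNormed.Build R C norm1 normM normS.

End ComplexStarAlgebra.

Section ProductStarAlgebra.
Context (R : realType) (I : Type) (Q : I -> starAlgType R).
Local Notation P := (prod_topology Q).
Implicit Types x y z : P.
#[local] Obligation Tactic := idtac.

Let ext x y : (forall i, x i = y i) -> x = y.
Proof. exact: functional_extensionality_dep. Qed.

HB.instance Definition _ := Choice.copy P (forall i, Q i).

Program Definition prod_zmodMixin := @GRing.isZmodule.Build P
  (fun=> 0) (fun x i => - x i) (fun x y i => x i + y i) _ _ _ _.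
Next Obligation. by move=> x y z; apply: ext => i; rewrite addrA. Qed.
Next Obligation. by move=> x y; apply: ext => i; rewrite addrC. Qed.
Next Obligation. by move=> x; apply: ext => i; rewrite add0r. Qed.
Next Obligation. by move=> x; apply: ext => i; rewrite addNr. Qed.
HB.instance Definition _ := prod_zmodMixin.

Program Definition prod_lmodMixin := @GRing.Zmodule_isLmodule.Build R[i] P
  (fun c x i => c *: x i) _ _ _ _.
Next Obligation. by move=> c d x; apply: ext => i; rewrite scalerA. Qed.
Next Obligation. by move=> x; apply: ext => i; rewrite scale1r. Qed.
Next Obligation. by move=> c x y; apply: ext => i; rewrite scalerDr. Qed.
Next Obligation. by move=> x c d; apply: ext => i; rewrite scalerDl. Qed.
HB.instance Definition _ := prod_lmodMixin.

Program Definition prod_starMixin := @isStarAlgebra.Build R P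
  (fun=> sone) (fun x y i => x i ** y i) (fun x i => star (x i))
  _ _ _ _ _ _ _ _ _ _ _.
Next Obligation. by move=> x y z; apply: ext => i; rewrite smulA. Qed.
Next Obligation. by move=> x; apply: ext => i; rewrite smul1. Qed.
Next Obligation. by move=> x; apply: ext => i; rewrite smulr1. Qed.
Next Obligation. by move=> x y z; apply: ext => i; apply: smulDl. Qed.
Next Obligation. by move=> x y z; apply: ext => i; apply: smulDr. Qed.
Next Obligation. by move=> c x y; apply: ext => i; apply: smulZl. Qed.
Next Obligation. by move=> c x y; apply: ext => i; apply: smulZr. Qed.
Next Obligation. by move=> x; apply: ext => i; apply: starK. Qed.
Next Obligation. by move=> x y; apply: ext => i; apply: starD. Qed.
Next Obligation. by move=> c x; apply: ext => i; apply: starZ. Qed.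
Next Obligation. by move=> x y; apply: ext => i; apply: starM. Qed.
HB.instance Definition _ := prod_starMixin.

End ProductStarAlgebra.

Section SubStarAlgebra.
Context (R : realType) (B : starAlgType R).

Record star_subalgebra := StarSubalgebra {
  subalg_set :> set B;
  subalg_one : subalg_set sone;
  subalg_lin : forall (c : R[i]) (x y : B),
    subalg_set x -> subalg_set y -> subalg_set (c *: x + y);
  subalg_mul : forall x y : B,
    subalg_set x -> subalg_set y -> subalg_set (x ** y);
  subalg_star : forall x : B, subalg_set x -> subalg_set (star x)
}.

Context (S : star_subalgebra).

Definition subalg : Type := set_type S.
Definition subalg_pred : {pred B} := mem (subalg_set S).

Lemma subalg_pred_submod : submod_closed subalg_pred.
Proof.
split=> [|c x y]; rewrite !inE; last exact: subalg_lin.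
by rewrite -(addNr sone) -scaleN1r; apply: subalg_lin; exact: subalg_one.
Qed.

HB.instance Definition _ := SubChoice.copy subalg (set_type S).
HB.instance Definition _ := @GRing.SubChoice_isSubLmodule.Build R[i] B
  subalg_pred subalg subalg_pred_submod.

Lemma subalgP (x : subalg) : subalg_set S (val x).
Proof. exact/set_mem/(valP x). Qed.

Definition subalg_in (x : B) (Sx : subalg_set S x) : subalg := SigSub (mem_set Sx).

Definition subalg_one_in : subalg := subalg_in (subalg_one S).
Definition subalg_mul_in (x y : subalg) : subalg :=
  subalg_in (subalg_mul (subalgP x) (subalgP y)).
Definition subalg_star_in (x : subalg) : subalg :=
  subalg_in (subalg_star (subalgP x)).

#[local] Obligation Tactic := idtac.
Program Definition subalg_starMixin := @isStarAlgebra.Build R subalg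
  subalg_one_in subalg_mul_in subalg_star_in _ _ _ _ _ _ _ _ _ _ _.
Next Obligation. by move=> x y z; apply: val_inj; apply: smulA. Qed.
Next Obligation. by move=> x; apply: val_inj; apply: smul1. Qed.
Next Obligation. by move=> x; apply: val_inj; apply: smulr1. Qed.
Next Obligation. by move=> x y z; apply: val_inj; apply: smulDl. Qed.
Next Obligation. by move=> x y z; apply: val_inj; apply: smulDr. Qed.
Next Obligation. by move=> c x y; apply: val_inj; apply: smulZl. Qed.
Next Obligation. by move=> c x y; apply: val_inj; apply: smulZr. Qed.
Next Obligation. by move=> x; apply: val_inj; apply: starK. Qed.
Next Obligation. by move=> x y; apply: val_inj; apply: starD. Qed.
Next Obligation. by move=> c x; apply: val_inj; apply: starZ. Qed.
Next Obligation. by move=> x y; apply: val_inj; apply: starM. Qed.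
HB.instance Definition _ := subalg_starMixin.

End SubStarAlgebra.

Definition star_hom (R : realType) (A B : starAlgType R) (f : A -> B) : Prop :=
  [/\ linear f, f sone = sone, {morph f : x y / x ** y}
    & {morph f : x / star x}].

Section BoundedFamilies.
Context (R : realType) (I : Type) (Q : I -> normedStarAlgType R).
Local Notation P := (prod_topology Q).

Definition bounded_family : set P :=
  [set x | exists M : R[i], forall i, `|x i| <= M].

#[local] Obligation Tactic := idtac.
Program Definition bounded_subalgebra : star_subalgebra P :=
  @StarSubalgebra R P bounded_family _ _ _ _.
Next Obligation. exists 1 => i; exact: (@norm_one_le1 R (Q i)). Qed.
Next Obligation.
move=> c x y [M HM] [N HN]; exists (`|c| * M + N) => i.
rewrite (le_trans (ler_normD (c *: x i) (y i))) //; apply: lerD; last exact: HN.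
by rewrite normrZ; apply: ler_wpM2l; last exact: HM.
Qed.
Next Obligation.
move=> x y [M HM] [N HN]; exists (M * N) => i.
apply: (le_trans (norm_smul (x i) (y i))).
by apply: ler_pM; [exact: normr_ge0|exact: normr_ge0|exact: HM|exact: HN].
Qed.
Next Obligation.
by move=> x [M HM]; exists M => i; rewrite [leLHS]norm_star; exact: HM.
Qed.

End BoundedFamilies.

Section FunctionAlgebras.
Context (R : realType).
Local Notation C := (R[i]^o).

Definition linfty (X : Type) : Type :=
  subalg (bounded_subalgebra (fun _ : X => C)).

Definition contfun_set (X : topologicalType) : set {ptws X -> C} :=
  [set f | continuous (f : X -> C)].

#[local] Obligation Tactic := idtac.
Program Definition contfun_subalgebra (X : topologicalType) :
    star_subalgebra {ptws X -> C} :=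
  @StarSubalgebra R {ptws X -> C} (@contfun_set X) _ _ _ _.
Next Obligation. by move=> X x; apply: cvg_cst. Qed.
Next Obligation.
move=> X c f g cf cg x; apply: (@cvgD _ C); last exact: cg.
by apply: cvgZr; exact: cf.
Qed.
Next Obligation.
by move=> X f g cf cg x; apply: cvgM; [exact: cf|exact: cg].
Qed.
Next Obligation.
move=> X f cf x; apply/cvgrPdist_lt => e e0.
have /cvgrPdist_lt/(_ _ e0) := cf x.
by apply: filterS => y; rewrite -norm_conjC rmorphB.
Qed.

Definition contfun (X : topologicalType) : Type := subalg (contfun_subalgebra X).
HB.instance Definition _ (X : topologicalType) := StarAlgebra.on (contfun X).
HB.instance Definition _ (X : Type) := StarAlgebra.on (linfty X).

Lemma contfun_bounded (X : topologicalType) (cX : compact [set: X])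
  (f : contfun X) : bounded_family (val f).
Proof.
have cf : continuous (val f : X -> C) by exact: (subalgP f).
pose g (x : X) : R := complex.Re `|(val f : X -> C) x|.
have cg : continuous g.
  move=> x; apply/cvgrPdist_lt => e e0.
  have eC : 0 < e%:C%C by rewrite ltcR.
  have /cvgrPdist_lt/(_ _ eC) := cf x; apply: filterS => y xy.
  rewrite -ltcR (le_lt_trans _ xy) //.
  have -> : `|g x - g y|%:C%C = `|(g x)%:C%C - (g y)%:C%C|.
    by rewrite -rmorphB normc_def /= expr0n addr0 sqrtr_sqr.
  by rewrite !RRe_real ?ger0_real // ler_dist_dist.
have : compact (g @` [set: X]).
  by apply: continuous_compact => //; exact: continuous_subspaceT.
move=> /compact_bounded [M [_ HM]].
exists ((M + 1)%:C%C) => x.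
rewrite (_ : `|_| = (g x)%:C%C); last by rewrite RRe_real // ger0_real.
rewrite lecR (le_trans (ler_norm _)) //; apply: (HM (M + 1)).
  by rewrite ltrDl.
by exists x.
Qed.

Definition contfun_linfty (X : topologicalType) (cX : compact [set: X])
    (f : contfun X) : linfty X :=
  @subalg_in R _ (bounded_subalgebra (fun _ : X => C)) (val f)
    (contfun_bounded cX f).

End FunctionAlgebras.

Definition dim_le (K : pzRingType) (V : lmodType K) (n : nat) : Prop :=
  exists e : 'I_n -> V, forall x, exists c : 'I_n -> K, x = \sum_i c i *: e i.

Definition finite_dim (K : pzRingType) (V : lmodType K) : Prop :=
  exists n, dim_le V n.

Section ProfiniteCompletion.
Context (R : realType) (A : cstarAlgType R).

Record fd_ideal := FdIdeal {
  fd_ideal_ideal :> closed_ideal A;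
  fd_ideal_finite : finite_dim (quot fd_ideal_ideal)
}.

(* The canonical map A/I -> A/J, for I contained in J. *)
Definition quot_trans (I J : fd_ideal) (x : quot I) : quot J := qproj J (repr x).

Lemma quot_transE (I J : fd_ideal) : ideal_set I `<=` ideal_set J ->
  forall a, quot_trans J (qproj I a) = qproj J a.
Proof. by move=> IJ a; apply/qprojP/IJ/ideal_repr. Qed.

Local Notation P := (prod_topology (fun I : fd_ideal => quot I)).

Definition compatible_family : set P :=
  [set x | forall I J : fd_ideal, ideal_set I `<=` ideal_set J ->
    quot_trans J (x I) = x J].

Lemma compatible_repr (x : P) : compatible_family x ->
  forall I J : fd_ideal, ideal_set I `<=` ideal_set J ->
  exists2 a, x I = qproj I a & x J = qproj J a.
Proof.
move=> Hx I J IJ; exists (repr (x I)); first by rewrite /qproj reprK.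
by rewrite -(Hx _ _ IJ).
Qed.

#[local] Obligation Tactic := idtac.
Program Definition compatible_subalgebra : star_subalgebra P :=
  @StarSubalgebra R P compatible_family _ _ _ _.
Next Obligation. by move=> I J IJ; exact: quot_transE. Qed.
Next Obligation.
move=> c x y /compatible_repr Hx /compatible_repr Hy I J IJ.
have [a aI aJ] := Hx _ _ IJ; have [b bI bJ] := Hy _ _ IJ.
rewrite -[LHS]/(quot_trans J (c *: x I + y I)) -[RHS]/(c *: x J + y J).
by rewrite aI aJ bI bJ -!qprojZ -!qprojD quot_transE.
Qed.
Next Obligation.
move=> x y /compatible_repr Hx /compatible_repr Hy I J IJ.
have [a aI aJ] := Hx _ _ IJ; have [b bI bJ] := Hy _ _ IJ.
rewrite -[LHS]/(quot_trans J (quot_mul (x I) (y I))).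
by rewrite -[RHS]/(quot_mul (x J) (y J)) aI aJ bI bJ !quot_mulE quot_transE.
Qed.
Next Obligation.
move=> x /compatible_repr Hx I J IJ; have [a aI aJ] := Hx _ _ IJ.
rewrite -[LHS]/(quot_trans J (quot_star (x I))) -[RHS]/(quot_star (x J)).
by rewrite aI aJ !quot_starE quot_transE.
Qed.

(* The limit of the A/I in topological *-algebras: the compatible families, with
   the topology induced by the product of the norm topologies. *)
Definition Pu : Type := subalg compatible_subalgebra.
HB.instance Definition _ := StarAlgebra.on Pu.
HB.instance Definition _ := Topological.copy Pu
  (initial_topology (fun x : Pu => (val x : P))).

Program Definition bounded_compatible_subalgebra : star_subalgebra Pu :=
  @StarSubalgebra R Pu [set x | bounded_family (val x)] _ _ _ _.
Next Obligation. exact: (subalg_one (bounded_subalgebra (fun I : fd_ideal => quot I))). Qed.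
Next Obligation. by move=> c x y; exact: (@subalg_lin _ _ (bounded_subalgebra (fun I : fd_ideal => quot I))). Qed.
Next Obligation. by move=> x y; exact: (@subalg_mul _ _ (bounded_subalgebra (fun I : fd_ideal => quot I))). Qed.
Next Obligation. by move=> x; exact: (@subalg_star _ _ (bounded_subalgebra (fun I : fd_ideal => quot I))). Qed.

(* The limit of the A/I in C*-algebras: since *-homomorphisms of C*-algebras are
   contractive, it consists of the norm-bounded compatible families. *)
Definition Pb : Type := subalg bounded_compatible_subalgebra.
HB.instance Definition _ := StarAlgebra.on Pb.

Lemma eta_compatible (a : A) : compatible_family (fun I : fd_ideal => qproj I a).
Proof. by move=> I J IJ; exact: quot_transE. Qed.

Definition eta_u (a : A) : Pu :=
  @subalg_in R _ compatible_subalgebra _ (eta_compatible a).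

Lemma eta_bounded (a : A) : bounded_family (val (eta_u a)).
Proof. by exists `|a| => I; exact: quot_norm_le. Qed.

Definition eta_b (a : A) : Pb :=
  @subalg_in R _ bounded_compatible_subalgebra _ (eta_bounded a).

End ProfiniteCompletion.

Section Representations.
Context (R : realType) (A : cstarAlgType R).

(* A unital *-homomorphism from A to the algebra of bounded operators on H. *)
Definition representation (H : hilbertType R) (pi : A -> H -> H) : Prop :=
  [/\ forall a, linear (pi a) /\ continuous (pi a),
      forall (c : R[i]) a b v, pi (c *: a + b) v = c *: pi a v + pi b v,
      forall v, pi sone v = v,
      forall a b v, pi (a ** b) v = pi a (pi b v)
    & forall a v w, dotp (pi a v) w = dotp v (pi (star a) w)].

Definition irreducible (H : hilbertType R) (pi : A -> H -> H) : Prop :=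
  (exists v : H, v != 0) /\
  forall W : set H, closed W -> W 0 ->
    (forall (c : R[i]) v w, W v -> W w -> W (c *: v + w)) ->
    (forall a v, W v -> W (pi a v)) ->
    W = [set 0] \/ W = setT.

Definition residually_finite_dimensional : Prop :=
  exists (T : Type) (H : T -> hilbertType R) (pi : forall t, A -> H t -> H t),
    (forall t, representation (pi t) /\ finite_dim (H t)) /\
    (forall a b, (forall t, pi t a = pi t b) -> a = b).

Definition subhomogeneous : Prop :=
  exists n : nat, (1 <= n)%N /\
    forall (H : hilbertType R) (pi : A -> H -> H),
      representation pi -> irreducible pi -> dim_le H n.

End Representations.

Section Normal.
Context (R : realType).

(* In the C*-algebras Pb A and linfty R X this is the usual order. *)
Definition star_le (A : starAlgType R) (x y : A) : Prop :=
  exists z, y - x = star z ** z.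

Definition is_star_sup (A : starAlgType R) (S : set A) (s : A) : Prop :=
  (forall x, S x -> star_le x s) /\
  (forall u, (forall x, S x -> star_le x u) -> star_le s u).

(* Preservation of the suprema of (bounded) increasing nets of self-adjoint
   elements; a net is replaced by the directed set of its values. *)
Definition normal_map (M N : starAlgType R) (f : M -> N) : Prop :=
  forall (S : set M) (s : M),
    S !=set0 -> (forall x, S x -> star x = x) ->
    (forall x y, S x -> S y -> exists z, [/\ S z, star_le x z & star_le y z]) ->
    is_star_sup S s -> is_star_sup (f @` S) (f s).

End Normal.

Section Discretizations.
Context (R : realType) (A : cstarAlgType R).

Definition commutative_cstar_subalgebra (C : star_subalgebra A) : Prop :=
  closed (subalg_set C) /\
  forall x y, subalg_set C x -> subalg_set C y -> x ** y = y ** x.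

Definition star_iso (A1 A2 : starAlgType R) (f : A1 -> A2) : Prop :=
  star_hom f /\ bijective f.

(* C ~ C(X) is encoded by an arbitrary compact Hausdorff X with an arbitrary
   *-isomorphism gamma : C(X) -> C; eta is meant for a W*-algebra M. *)
Definition faithful_wstar_discretization
    (M : starAlgType R) (eta : A -> M) : Prop :=
  [/\ star_hom eta, injective eta &
    forall (C : star_subalgebra A) (X : topologicalType)
      (cX : compact [set: X]) (gamma : contfun R X -> subalg C),
      hausdorff_space X -> commutative_cstar_subalgebra C -> star_iso gamma ->
      exists phi : linfty R X -> M,
        [/\ star_hom phi, normal_map phi, injective phi &
          forall f : contfun R X, phi (contfun_linfty cX f) = eta (val (gamma f))]].

Definition faithful_procstar_discretization
    (N : starTopologicalType R) (eta : A -> N) : Prop :=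
  [/\ star_hom eta, injective eta &
    forall (C : star_subalgebra A) (X : topologicalType)
      (gamma : contfun R X -> subalg C),
      compact [set: X] -> hausdorff_space X ->
      commutative_cstar_subalgebra C -> star_iso gamma ->
      exists phi : {ptws X -> R[i]^o} -> N,
        [/\ star_hom phi, continuous phi, injective phi &
          forall f : contfun R X, phi (val f) = eta (val (gamma f))]].

End Discretizations.

(* Main.v *)
(* A nonzero element a of A is detected by an extremal state F with F(a^* a) > 0,
   whose GNS representation is irreducible. Extremal states are produced without
   the Krein-Milman theorem, by a Hahn-Banach extension that takes at each step
   the largest admissible value. If A is subhomogeneous, the GNS representation
   is finite-dimensional, so A is residually finite-dimensional; conversely, a
   finite-dimensional quotient A/I is a C*-algebra, faithfully represented on the
   finite-dimensional GNS spaces of its states.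

   For C = C(X) in A and A/I finite-dimensional, the kernel of C(X) -> A/I is the
   ideal of functions vanishing on a finite set, the hull of I, and interpolation
   on it extends C(X) -> A/I to all functions on X. If A is subhomogeneous, the
   hulls cover X: evaluation at x extends to an extremal state of A, and the
   kernel of its GNS representation is an ideal whose hull contains x. This gives
   injectivity. For normality, order in P_b(A) is tested in the quotients A/I,
   where only the values on the finite hull of I matter. *)

(* Neither spectra nor Gelfand duality are invoked: positivity is the norm condition [|t - h| <= t],
   square roots are limits of an explicit iteration, and the inverses used for the positivity of
   [star a ** a] come from resolvents of skew-adjoint elements. A square root of [h] lies in every
   closed real subspace that contains [1] and [h] and is stable under squaring; commutation,
   self-adjointness and membership in a subalgebra are all read off from this. A functional is a
   state as soon as its real part is dominated by the norm of the self-adjoint part and takes the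
   value 1 at the unit, which is how Hahn-Banach yields states. The largest admissible value
   preserves extremality because dominated functionals cannot exceed it: when an average of two
   reaches it, both do. A character of a star subalgebra is an extremal starting point by the
   Cauchy-Schwarz inequality. Interpolants are arbitrary away from the finite hull and their norms
   are uncontrolled. Bounds and order for the extended maps are therefore obtained inside A/I, from
   pointwise square roots of functions. Assembling roots in the quotients into one element of the
   limit requires that positive roots be unique. *)
Require Import Defs.
From HB Require Import structures.
From mathcomp Require Import all_boot all_order all_algebra.
From mathcomp Require Import all_classical all_reals all_analysis.
From mathcomp Require Import complex ring lra.

Set Implicit Arguments.
Unset Strict Implicit.
Unset Printing Implicit Defensive.
Import Order.TTheory GRing.Theory Num.Theory.
Import numFieldNormedType.Exports.
Local Open Scope classical_set_scope.
Local Open Scope ring_scope.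

(** * Square roots and positivity *)

(* In the square-zero extension K (+) V, the module identities of V become ring
   identities, which the tactic ring decides. *)
Section SquareZero.
Context (K : comNzRingType) (V : lmodType K).

Definition sqz : Type := (K * V)%type.
HB.instance Definition _ := GRing.Zmodule.on sqz.
Definition sqz_mul (x y : sqz) : sqz := (x.1 * y.1, x.1 *: y.2 + y.1 *: x.2).
Definition sqs (c : K) : sqz := (c, 0).
Definition sqv (v : V) : sqz := (0, v).

#[local] Obligation Tactic := idtac.
Program Definition sqz_ringMixin :=
  @GRing.Zmodule_isComNzRing.Build sqz (1, 0) sqz_mul _ _ _ _ _.
Next Obligation.
move=> [a x] [b y] [c z]; rewrite /sqz_mul /= mulrA !scalerDr !scalerA addrA.
by rewrite [a * c]mulrC [c * b]mulrC.
Qed.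
Next Obligation. by move=> [a x] [b y]; rewrite /sqz_mul /= mulrC addrC. Qed.
Next Obligation. by move=> [a x]; rewrite /sqz_mul /= mul1r scale1r scaler0 addr0. Qed.
Next Obligation.
move=> [a x] [b y] [c z]; rewrite /sqz_mul /= mulrDl scalerDl scalerDr.
by congr (_, _); rewrite addrACA.
Qed.
Next Obligation. by rewrite xpair_eqE negb_and oner_eq0. Qed.
HB.instance Definition _ := sqz_ringMixin.

Lemma sqs_zmod : zmod_morphism sqs.
Proof. by move=> x y; rewrite /sqs; congr (_, _); rewrite subr0. Qed.
HB.instance Definition _ := GRing.isZmodMorphism.Build K sqz sqs sqs_zmod.
Lemma sqs_monoid : monoid_morphism sqs.
Proof.
by split=> // x y; rewrite /sqs; congr (_, _); rewrite /= !scaler0 addr0.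
Qed.
HB.instance Definition _ := GRing.isMonoidMorphism.Build K sqz sqs sqs_monoid.

Lemma sqv_zmod : zmod_morphism sqv.
Proof. by move=> x y; rewrite /sqv; congr (_, _); rewrite subr0. Qed.
HB.instance Definition _ := GRing.isZmodMorphism.Build V sqz sqv sqv_zmod.
Lemma sqvZ c v : sqv (c *: v) = sqs c * sqv v.
Proof. by rewrite /sqv /sqs; congr (_, _); rewrite /= ?mulr0 // scale0r addr0. Qed.
Lemma sqvI : injective sqv. Proof. by move=> x y []. Qed.
End SquareZero.

Ltac lmod := apply: sqvI; rewrite ?raddfD ?raddfN ?raddfB /= ?sqvZ /=; ring.
Ltac calg := rewrite ?(smulDl, smulDr, smulNl, smulNr, smulBl, smulBr, smulZl,
  smulZr, smul1, smulr1, smul0l, smul0r, smulA); lmod.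

Lemma closed_normP (K : numFieldType) (V : normedModType K) (S : set V) :
  closed S <->
  forall x, (forall e : K, 0 < e -> exists2 y, S y & `|x - y| < e) -> S x.
Proof.
split=> [cS x Hx|HS x Sx].
  apply: cS => B /nbhs_ballP[e /= e0 eB]; have [y Sy xy] := Hx _ e0.
  by exists y; split=> //; apply: eB; rewrite -ball_normE.
apply: HS => e e0; have [y [Sy]] := Sx _ (nbhsx_ballx x e e0).
by rewrite -ball_normE; exists y.
Qed.

Lemma closed_kernel (K : numFieldType) (V W : normedModType K) (f : V -> W)
    (M : K) : 0 <= M -> (forall x y, f (x - y) = f x - f y) ->
  (forall x, `|f x| <= M * `|x|) -> closed [set x | f x = 0].
Proof.
move=> M0 fB fM; apply/closed_normP => x Hx /=; apply/eqP; apply: contraT => nz.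
have M1 : 0 < M + 1 by rewrite ltr_wpDl.
have [|y /= fy xy] := Hx (`|f x| / (M + 1)); first by rewrite divr_gt0 ?normr_gt0.
have : `|f x| < `|f x|; last by rewrite ltxx.
rewrite -{1}[f x]subr0 -fy -fB (le_lt_trans (fM _)) //.
rewrite (le_lt_trans (_ : _ <= (M + 1) * `|x - y|)) ?ler_wpM2r ?lerDl //.
by rewrite -ltr_pdivlMl // mulrC.
Qed.

Lemma ReC (R : realType) (x : R[i]) : x \is Num.real -> x = (complex.Re x)%:C%C.
Proof. by move=> xr; rewrite RRe_real. Qed.

Section SquareRoot.
Context (R : realType) (A : cstarAlgType R).
Implicit Types (x y a b c h k q : A) (S : set A).
Local Notation C := R[i].

(** A fixed point of [x = (k + x ** x) / 2] satisfies [(1 - x)^2 = 1 - k]; for [k = 1 - h], the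
    element [1 - x] is thus a square root of [h]. *)
Definition sqrt_iter k n := iter n (fun x => 2^-1 *: (k + x ** x)) 0.

(** The same iteration for the scalar [k = 1]. It majorises the iterations with [|k| <= 1], and its
    boundedness is what makes them converge. *)
Definition sqrt_bound n : R := iter n (fun x : R => (1 + x ^+ 2) / 2) 0.
Local Notation xi := sqrt_bound.

Lemma sqrt_bound01 n : 0 <= xi n <= 1.
Proof.
by elim: n => [|n]; rewrite /= ?lexx ?ler01 // -/(xi n); move: (xi n) => x; nra.
Qed.

Lemma sqrt_iter_le1 k n : `|k| <= 1 -> `|sqrt_iter k n| <= 1.
Proof.
move=> k1; elim: n => [|n IH] /=; first by rewrite normr0 ler01.
rewrite normrZ ger0_norm ?invr_ge0 // ler_pdivrMl // mulr1.
rewrite (le_trans (ler_normD _ _)) // lerD // (le_trans (norm_smul _ _)) //.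
by rewrite mulr_ile1.
Qed.

Lemma sqrt_iter_xi k n : `|k| <= 1 -> `|sqrt_iter k n| <= (xi n)%:C%C.
Proof.
move=> k1; elim: n => [|n IH] /=; first by rewrite normr0.
rewrite normrZ ger0_norm ?invr_ge0 // ler_pdivrMl //.
rewrite (_ : 2 * _ = 1 + (xi n)%:C%C * (xi n)%:C%C); last first.
  rewrite -!(rmorphM, rmorphD, rmorph1 (real_complex R)) -(rmorph_nat (real_complex R)).
  by rewrite -rmorphM -/(xi n); congr (_%:C%C); field.
rewrite (le_trans (ler_normD _ _)) // lerD // (le_trans (norm_smul _ _)) //.
by rewrite ler_pM.
Qed.

Lemma sqrt_iter_comm k y n : y ** k = k ** y ->
  y ** sqrt_iter k n = sqrt_iter k n ** y.
Proof.
move=> yk; elim: n => [|n IH] /=; first by rewrite smul0l smul0r.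
rewrite smulZl smulZr smulDl smulDr yk smulA IH -smulA.
by rewrite -/(sqrt_iter k n) IH smulA.
Qed.

(** Iterates commute, so [a^2 - b^2 = (a - b)(a + b)]; the scalar iteration obeys the same identity,
    and the bound propagates by induction. *)
Lemma sqrt_iter_dist k n m : `|k| <= 1 ->
  `|sqrt_iter k (n + m) - sqrt_iter k n| <= (xi (n + m) - xi n)%:C%C.
Proof.
move=> k1; elim: n => [|n IH].
  by rewrite add0n !subr0 (le_trans (sqrt_iter_xi m k1)) // lexx.
rewrite addSn /=; set a := sqrt_iter k (n + m) in IH *.
set b := sqrt_iter k n in IH *.
have ab : a ** b = b ** a.
  by apply: sqrt_iter_comm; apply/esym/sqrt_iter_comm.
rewrite (_ : _ - _ = 2^-1 *: ((a - b) ** (a + b))); last first.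
  by rewrite -[in RHS]/(a - b) smulDr !smulBl ab; lmod.
rewrite normrZ ger0_norm ?invr_ge0 // ler_pdivrMl // -/(xi _) -/(xi n).
rewrite (le_trans (norm_smul _ _)) //.
rewrite (_ : 2 * _ = (xi (n + m) - xi n)%:C%C * (xi (n + m) + xi n)%:C%C).
  apply: ler_pM => //; rewrite (le_trans (ler_normD _ _)) // rmorphD /=.
  by rewrite lerD // sqrt_iter_xi.
rewrite -(rmorph_nat (real_complex R)) -!rmorphM /=; congr (_%:C%C).
by field.
Qed.

Lemma sqrt_iter_cvg k : `|k| <= 1 -> cvg (sqrt_iter k @ \oo).
Proof.
move=> k1; apply/cauchy_cvgP/cauchy_exP => e e0.
have eE : e = (complex.Re e)%:C%C by apply/ReC/gtr0_real.
have e0' : 0 < complex.Re e by rewrite -ltcR -eE.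
have sup_xi : has_sup (range xi).
  split; first by exists (xi 0%N), 0%N.
  by exists 1 => _ [n _ <-]; case/andP: (sqrt_bound01 n).
(* Since [xi N] is within [e] of the supremum, all increments after [N] are below [e]. *)
have [_ [N _ <-] HN] := sup_adherent e0' sup_xi.
exists (sqrt_iter k N); exists N => // m /= Nm.
rewrite -ball_normE /= distrC -(subnKC Nm) (le_lt_trans (sqrt_iter_dist _ _ k1)) //.
have : xi (N + (m - N)) <= sup (range xi).
  by apply: sup_upper_bound => //; exists (N + (m - N))%N.
by rewrite [ltRHS]eE ltcR; lra.
Qed.

Lemma lim_sqrt_iterP k (S : set A) : `|k| <= 1 -> closed S ->
  (forall n, S (sqrt_iter k n)) -> S (lim (sqrt_iter k @ \oo)).
Proof.
move=> k1 cS HS; have := sqrt_iter_cvg k1.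
by apply: (closed_cvg S) => //; apply: nearW.
Qed.

Lemma closed_le_norm (r : C) : closed [set x : A | `|x| <= r].
Proof.
apply/closed_normP => x Hx /=; apply/ler_addgt0Pr => e /Hx[y /= yr xy].
by rewrite -[x](subrK y) (le_trans (ler_normD _ _)) // addrC lerD // ltW.
Qed.

Lemma lim_sqrt_iterE k : `|k| <= 1 -> let x := lim (sqrt_iter k @ \oo) in
  x = 2^-1 *: (k + x ** x).
Proof.
move=> k1 x; have x1 : `|x| <= 1.
  apply: (lim_sqrt_iterP (S := [set y | `|y| <= 1])) => //.
    exact: closed_le_norm.
  by move=> n; exact: sqrt_iter_le1.
have small e : 0 < e -> exists n, `|x - sqrt_iter k n| < e /\
    `|x - sqrt_iter k n.+1| < e.
  move=> e0; have /cvgrPdist_lt/(_ _ e0)[N _ HN] := sqrt_iter_cvg k1.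
  by exists N; split; apply: HN => //=.
apply/eqP; rewrite -subr_eq0 -normr_le0; apply/ler_addgt0Pr => e e0.
have [|n [n1 n2]] := small (e / 2); first by rewrite divr_gt0.
rewrite add0r; have y1 := sqrt_iter_le1 n k1; move: n2 => /=.
move: (sqrt_iter k n) y1 n1 => y y1 n1 n2.
rewrite (_ : _ - _ = (x - 2^-1 *: (k + y ** y)) +
   2^-1 *: ((y - x) ** y + x ** (y - x))); last first.
  by rewrite smulBl smulBr; lmod.
rewrite (le_trans (ler_normD _ _)) // [leRHS]splitr lerD ?(ltW n2) //.
rewrite normrZ ger0_norm ?invr_ge0 // ler_pdivrMl // [leRHS]mulr_natl mulr2n.
rewrite (le_trans (ler_normD _ _)) // lerD // (le_trans (norm_smul _ _)) //.
  by rewrite (le_trans _ (ltW n1)) // distrC ler_piMr.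
by rewrite (le_trans _ (ltW n1)) // (distrC x) ler_piMl.
Qed.

(* The closed real subspaces of A that contain 1 and are stable under squaring:
   self-adjoint elements, commutants, closed star subalgebras. *)
Definition square_closed S := [/\ closed S, S sone,
  forall (r : R) x y, S x -> S y -> S (r%:C%C *: x + y) &
  forall x, S x -> S (x ** x)].

Lemma square_closedB S x y : square_closed S -> S x -> S y -> S (x - y).
Proof.
case=> _ _ lS _ Sx Sy; rewrite addrC -scaleN1r.
by have := lS (-1) _ _ Sy Sx; rewrite rmorphN1.
Qed.

Lemma square_closed0 S : square_closed S -> S 0.
Proof. by move=> HS; rewrite -(subrr sone); apply: square_closedB => //; case: HS. Qed.

Lemma square_closedZ S (r : C) x : r \is Num.real -> square_closed S ->
  S x -> S (r *: x).
Proof.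
move=> rr HS Sx; rewrite -[_ *: _]addr0 (ReC rr); have S0 := square_closed0 HS.
by case: HS => _ _ lS _; apply: lS.
Qed.

Lemma square_closedD S x y : square_closed S -> S x -> S y -> S (x + y).
Proof.
move=> HS Sx Sy; rewrite -[y]opprK; apply: square_closedB => //.
by rewrite -[- y]add0r; apply: square_closedB => //; apply: square_closed0.
Qed.

Lemma square_closed_star : square_closed [set x | star x = x].
Proof.
split=> /=; last 3 first.
- exact: star_one.
- by move=> r x y xs ys; rewrite starD starZ xs ys; congr (_ *: _ + _); exact: conjc_real.
- by move=> x xs; rewrite starM xs.
rewrite (_ : mkset _ = [set x | star x - x = 0]); last first.
  by apply/seteqP; split=> x /=; [move=> ->; rewrite subrr | move/subr0_eq].
apply: (closed_kernel (M := 2)) => // x => [y|]; first by rewrite starB; lmod.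
by rewrite (le_trans (ler_normB _ _)) // norm_star mulr_natl.
Qed.

Lemma square_closed_comm y : square_closed [set x | y ** x = x ** y].
Proof.
split=> /=; last 3 first.
- by rewrite smul1 smulr1.
- by move=> r x z xs ys; rewrite smulDl smulDr smulZl smulZr xs ys.
- by move=> x xs; rewrite smulA xs -smulA xs smulA.
rewrite (_ : mkset _ = [set x | y ** x - x ** y = 0]); last first.
  by apply/seteqP; split=> x /=; [move=> ->; rewrite subrr | move/subr0_eq].
apply: (closed_kernel (M := `|y| + `|y|)) => [|x z|x]; rewrite ?addr_ge0 //.
  by calg.
rewrite (le_trans (ler_normB _ _)) // mulrDl lerD ?norm_smul //.
by rewrite mulrC norm_smul.
Qed.

Lemma square_closed_subalg (B : star_subalgebra A) :
  closed (subalg_set B) -> square_closed B.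
Proof.
move=> cB; split=> //; first exact: subalg_one.
  by move=> r x y; apply: subalg_lin.
by move=> x Bx; apply: subalg_mul.
Qed.

(** The last clause plays the role of membership in the closed algebra generated by [h]; with a
    commutant, the self-adjoint part or a closed subalgebra for [S], it transfers the property from
    [h] to its root. *)
Lemma sqrt_unit h : star h = h -> `|sone - h| <= 1 -> exists c,
  [/\ star c = c, `|sone - c| <= 1, c ** c = h &
      forall S, square_closed S -> S h -> S c].
Proof.
move=> hs h1; set x := lim (sqrt_iter (sone - h) @ \oo).
have HS S : square_closed S -> S h -> S (sone - x).
  move=> HS Sh; apply: square_closedB => //; first by case: HS.
  apply: lim_sqrt_iterP => //; first by case: HS.
  elim=> [|n IH] /=; first exact: square_closed0.
  apply: square_closedZ => //.
  apply: square_closedD => //; last by case: HS => _ _ _; apply.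
  by apply: square_closedB => //; case: HS.
exists (sone - x); split=> //.
- by apply: (HS [set x | star x = x]) => //; exact: square_closed_star.
- rewrite opprB addrC subrK.
  apply: (lim_sqrt_iterP (S := [set y | `|y| <= 1])) => //.
    exact: closed_le_norm.
  by move=> n; exact: sqrt_iter_le1.
have xE : 2 *: x = sone - h + x ** x.
  have /= := lim_sqrt_iterE h1; rewrite -/x => {1}->.
  by rewrite scalerA divff ?scale1r // pnatr_eq0.
have -> : (sone - x) ** (sone - x) = sone - 2 *: x + x ** x by calg.
by rewrite xE; lmod.
Qed.

End SquareRoot.

(** * Positive elements, up to the positivity of [star a ** a] *)

Section Positivity.
Context (R : realType) (A : cstarAlgType R).
Implicit Types (x y a b c h k q : A) (S : set A).
Local Notation C := R[i].

(** A norm form of having spectrum in the nonnegative reals: it makes sums immediate. The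
    existential [t] is upgraded to every [t >= |h|] in [pos_norm]. *)
Definition pos h := star h = h /\ exists2 t : C, 0 <= t & `|t *: sone - h| <= t.

Lemma star_scale (t : C) h : t \is Num.real -> star h = h ->
  star (t *: h) = t *: h.
Proof. by move=> /CrealP tr hs; rewrite starZ hs tr. Qed.

Lemma pos_star h : pos h -> star h = h. Proof. by case. Qed.

Lemma posD h k : pos h -> pos k -> pos (h + k).
Proof.
move=> [hs [t t0 ht]] [ks [s s0 ks']]; split; first by rewrite starD hs ks.
exists (t + s); first exact: addr_ge0.
rewrite (_ : _ - _ = (t *: sone - h) + (s *: sone - k)); last by lmod.
by rewrite (le_trans (ler_normD _ _)) ?lerD.
Qed.

Lemma posZ (t : C) h : 0 <= t -> pos h -> pos (t *: h).
Proof.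
move=> t0 [hs [s s0 hs']]; split; first by rewrite star_scale // ger0_real.
exists (t * s); first exact: mulr_ge0.
by rewrite -scalerA -scalerBr normrZ ger0_norm // ler_wpM2l.
Qed.

Lemma pos_bound (t : C) h : star h = h -> `|h| <= t -> pos (t *: sone - h).
Proof.
move=> hs ht; have t0 : 0 <= t by exact: le_trans ht.
split; last by exists t => //; rewrite opprB addrC subrK.
by rewrite starB hs star_scale ?star_one // ger0_real.
Qed.

Lemma pos0 : pos 0.
Proof. by split; [exact: star0 | exists 0; rewrite // scale0r subrr normr0]. Qed.

Lemma pos_scalar (t : C) : 0 <= t -> pos (t *: sone).
Proof.
by move=> t0; rewrite -[_ *: _]subr0; apply: pos_bound; rewrite ?star0 ?normr0.
Qed.

Lemma norm_sq_sa a : star a = a -> `|a ** a| = `|a| ^+ 2.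
Proof. by move=> {1}<-; rewrite cstar_identity. Qed.

Lemma star_mul_eq0 a : star a ** a = 0 -> a = 0.
Proof.
move=> a0; apply/eqP; rewrite -normr_eq0 -sqrf_eq0 -cstar_identity a0.
by rewrite normr0.
Qed.

Lemma pos_sqrt h : pos h -> exists c, [/\ star c = c, pos c, c ** c = h &
  forall S, square_closed S -> S h -> S c].
Proof.
move=> [hs [t]]; rewrite le_eqVlt => /predU1P[<-|t0 ht].
  rewrite scale0r add0r normrN normr_le0 => /eqP ->; exists 0.
  by split; rewrite ?star0 ?smul0l //; exact: pos0.
have s0 : 0 < sqrtC t by rewrite sqrtC_gt0.
have tr : t \is Num.real by exact: gtr0_real.
have tn : t != 0 by rewrite gt_eqF.
have [||c [cs c1 cc HS]] := @sqrt_unit R A (t^-1 *: h).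
- by rewrite star_scale // rpredV.
- rewrite (_ : _ - _ = t^-1 *: (t *: sone - h)); last first.
    by rewrite scalerBr scalerA mulVf // scale1r.
  by rewrite normrZ ger0_norm ?invr_ge0 ?(ltW t0) // ler_pdivrMl // mulr1.
exists (sqrtC t *: c); split.
- by rewrite star_scale // gtr0_real.
- apply: posZ; first exact: ltW.
  by split=> //; exists 1; rewrite ?scale1r.
- by rewrite smulZl smulZr cc !scalerA -expr2 sqrtCK divff // scale1r.
move=> S cS Sh; apply: square_closedZ; rewrite ?gtr0_real //.
by apply: HS => //; apply: square_closedZ => //; rewrite rpredV.
Qed.

(* u = a + i b is unitary and a is its real part. *)
Lemma norm_cos_le1 a b : star a = a -> star b = b -> a ** b = b ** a ->
  a ** a + b ** b = sone -> `|a| <= 1.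
Proof.
move=> as_ bs ab ab1; pose u := a + 'i *: b.
have us : star u = a - 'i *: b.
  by rewrite starD starZ as_ bs conjCi scaleNr.
have uu : star u ** u = sone.
  rewrite us -ab1 /u (_ : _ ** _ = a ** a + (- ('i * 'i)) *: (b ** b)).
    by rewrite -expr2 sqrCi opprK scale1r.
  by rewrite smulDr !smulBl !smulZr !smulZl ab; lmod.
have u1 : `|u| <= 1.
  rewrite -(expr_le1 (n := 2)) // -cstar_identity uu; exact: norm_one_le1.
have -> : a = 2^-1 *: (u + star u).
  rewrite us /u addrACA subrr addr0 -mulr2n -[a *+ 2]scaler_nat scalerA.
  by rewrite mulVf ?scale1r // pnatr_eq0.
rewrite normrZ ger0_norm ?invr_ge0 // ler_pdivrMl // mulr1.
by rewrite (le_trans (ler_normD _ _)) // norm_star lerD.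
Qed.

(** With [k = a / t] as a sine, [b = sqrt (1 - k^2)] is the matching cosine; [norm_cos_le1] bounds
    it by 1, and [t^2 - a^2 = t^2 b^2]. *)
Lemma pos_sq_norm a (t : C) : star a = a -> 0 < t -> `|a| <= t ->
  `|t ^+ 2 *: sone - a ** a| <= t ^+ 2.
Proof.
move=> as_ t0 at_; pose k := t^-1 *: a.
have ks : star k = k by rewrite star_scale // rpredV gtr0_real.
have k1 : `|k| <= 1.
  by rewrite normrZ gtr0_norm ?invr_gt0 // ler_pdivrMl // mulr1.
have kk1 : `|k ** k| <= 1 by rewrite norm_sq_sa // expr_le1.
have kks : star (k ** k) = k ** k by rewrite starM ks.
have [||b [bs _ bb HS]] := @sqrt_unit R A (sone - k ** k).
- by rewrite starB star_one kks.
- by rewrite opprB addrC subrK.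
have kb : k ** b = b ** k.
  apply: (HS [set x | k ** x = x ** k]); first exact: square_closed_comm.
  by rewrite /= smulBr smulBl smulA smul1 smulr1.
have b1 : `|b| <= 1.
  by apply: (norm_cos_le1 bs ks) => //; rewrite bb subrK.
have -> : t ^+ 2 *: sone - a ** a = t ^+ 2 *: (b ** b).
  rewrite bb scalerBr smulZl smulZr !scalerA -mulrA -invfM -expr2.
  by rewrite mulrA -expr2 divff ?scale1r // expf_neq0 // gt_eqF.
by rewrite normrZ normrX gtr0_norm // ler_piMr ?exprn_ge0 ?(ltW t0) // norm_sq_sa // expr_le1.
Qed.

Lemma pos_sq a : star a = a -> pos (a ** a).
Proof.
move=> as_; split; first by rewrite starM as_.
exists ((`|a| + 1) ^+ 2); first by rewrite exprn_ge0 // addr_ge0.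
by apply: pos_sq_norm => //; rewrite ?lerDl // ltr_wpDl.
Qed.

(** Apply [pos_sq_norm] to the square root of [h] and to [sqrtC t]. A bound on the norm of [h] now
    suffices as witness, which is what passing to limits requires. *)
Lemma pos_norm h (t : C) : pos h -> `|h| <= t -> `|t *: sone - h| <= t.
Proof.
move=> ph; have := ph; move=> /pos_sqrt[c [cs _ cc _]] ht.
have : 0 <= t by exact: le_trans ht.
rewrite le_eqVlt => /predU1P[t0|t0].
  by rewrite -t0 scale0r add0r normrN t0.
have s0 : 0 < sqrtC t by rewrite sqrtC_gt0.
rewrite -[t]sqrtCK -cc; apply: pos_sq_norm => //.
by rewrite -(ler_pXn2r (n := 2)) ?nnegrE ?(ltW s0) // sqrtCK -norm_sq_sa // cc.
Qed.

Lemma pos_closed : closed pos.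
Proof.
apply/closed_normP => h Hh; split.
  have [cS _ _ _] := @square_closed_star R A.
  apply: ((closed_normP [set x : A | star x = x]).1 cS) => e /Hh[y [ys _] hy].
  by exists y.
exists (`|h| + 1); first by rewrite addr_ge0.
(* This [d] is below both 1 and [e]: the first keeps [|y|] under [|h| + 1], the second absorbs the
   error. *)
apply/ler_addgt0Pl => e e0; pose d := e / (1 + e).
have e1 : 0 < 1 + e by rewrite ltr_pwDl // ltW.
have d0 : 0 < d by rewrite divr_gt0.
have d1 : d <= 1 by rewrite ler_pdivrMr // mul1r lerDr.
have de : d <= e by rewrite ler_pdivrMr // ler_peMr ?lerDl // ltW.
have [y py hy] := Hh _ d0.
rewrite (_ : _ - _ = ((`|h| + 1) *: sone - y) + (y - h)); last by lmod.
rewrite (le_trans (ler_normD _ _)) // addrC lerD //.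
  by rewrite distrC (le_trans (ltW hy)).
apply: pos_norm => //; rewrite -[y](subrK h) addrC.
rewrite (le_trans (ler_normD _ _)) // lerD // distrC.
by rewrite (le_trans (ltW hy)).
Qed.

(** The commuting square roots of [h] and [t - h], divided by [sqrtC t], are a cosine and a sine, so
    [norm_cos_le1] applies. The case [t = 0] is reached by adding a small scalar. *)
Lemma pos_le_norm h (t : C) : 0 <= t -> pos h -> pos (t *: sone - h) ->
  `|h| <= t.
Proof.
move=> t0 ph; wlog t1 : t t0 / 0 < t.
  move=> H pth; apply/ler_addgt0Pl => e e0; apply: H.
  - by rewrite addr_ge0 // ltW.
  - by rewrite ltr_pwDl.
  by rewrite scalerDl -addrA; apply: posD => //; apply/pos_scalar/ltW.
have [c [cs pc cc Hc]] := pos_sqrt ph.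
move=> /pos_sqrt[d [ds pd dd Hd]].
have ch : h ** c = c ** h by apply: (Hc [set x | h ** x = x ** h]) => //; exact: square_closed_comm.
have cd : c ** d = d ** c.
  apply: (Hd [set x | c ** x = x ** c]) => /=; first exact: square_closed_comm.
  by rewrite smulBr smulBl -ch; calg.
have s0 : 0 < sqrtC t by rewrite sqrtC_gt0.
have sr : (sqrtC t)^-1 \is Num.real by rewrite rpredV gtr0_real.
have tE : (sqrtC t)^-1 * (sqrtC t)^-1 = t^-1 by rewrite -expr2 exprVn sqrtCK.
have := @norm_cos_le1 ((sqrtC t)^-1 *: c) ((sqrtC t)^-1 *: d).
rewrite !star_scale // !smulZl !smulZr !scalerA tE cd -scalerDr cc dd.
rewrite [h + _]addrC subrK scalerA mulVf ?gt_eqF // scale1r.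
move=> /(_ erefl erefl erefl erefl).
rewrite normrZ gtr0_norm ?invr_gt0 // ler_pdivrMl // mulr1 => cle.
rewrite -cc norm_sq_sa // -[leRHS]sqrtCK ler_pXn2r ?nnegrE //; exact: ltW.
Qed.

Lemma pos_anti h : pos h -> pos (- h) -> h = 0.
Proof.
move=> ph pNh; apply/eqP; rewrite -normr_le0; apply: pos_le_norm => //.
by rewrite scale0r add0r.
Qed.

(** The square roots of [h] and [k] commute as well, so their product is self-adjoint, and its
    square is [h ** k]. *)
Lemma posM h k : pos h -> pos k -> h ** k = k ** h -> pos (h ** k).
Proof.
move=> /pos_sqrt[c [cs _ <- Hc]] /pos_sqrt[d [ds _ <- Hd]] hk.
have ck : (d ** d) ** c = c ** (d ** d).
  by apply: (Hc [set x | (d ** d) ** x = x ** (d ** d)]) => //; exact: square_closed_comm.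
have cd : c ** d = d ** c.
  by apply: (Hd [set x | c ** x = x ** c]) => //; exact: square_closed_comm.
have -> : (c ** c) ** (d ** d) = (c ** d) ** (c ** d).
  by rewrite !smulA -(smulA c d c) -cd !smulA.
by apply: pos_sq; rewrite starM cs ds cd.
Qed.

(** Factor [1 + x^2 = (1 + i x)(1 - i x)]; each factor is inverted by [resolvent], with [m > 2 |x|]
    so that [i x / m] has norm at most one half. *)
Lemma inv_1Dsq x : star x = x -> exists r,
  r ** (sone + x ** x) = sone /\ (sone + x ** x) ** r = sone.
Proof.
move=> xs; have [m] := @complex_arch R (`|x| * 2) 1 (mulr_ge0 (normr_ge0 _) (ler0n _ 2)) ltr01.
rewrite mulr1 => xm.
have m0 : 0 < m%:R :> C by rewrite (le_lt_trans _ xm) // mulr_ge0.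
have key (z : C) : `|z| = 1 -> z^* = - z -> exists r,
    r ** (sone + z *: x) = sone /\ (sone + z *: x) ** r = sone.
  move=> z1 zs; pose j := (z / m%:R) *: x.
  have js : star j = - j.
    by rewrite starZ xs rmorphM /= fmorphV rmorph_nat zs mulNr scaleNr.
  have j2 : `|j| <= 2^-1.
    rewrite normrZ normrM z1 mul1r normfV normr_nat ler_pdivrMl //.
    by rewrite ler_pdivlMr // ltW.
  have [r [_ r1 r2]] := resolvent js j2 m; exists r.
  by move: r1 r2; rewrite /j scalerA mulrCA divff ?mulr1 // gt_eqF.
have [r1 [r1l r1r]] := key 'i (normCi _) (conjCi _).
have [||r2 [r2l r2r]] := key (- 'i).
- by rewrite normrN normCi.
- by rewrite rmorphN /= conjCi.
have E : sone + x ** x = (sone + 'i *: x) ** (sone + - 'i *: x).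
  rewrite (_ : _ ** (_ + _) = sone + (- ('i * 'i)) *: (x ** x)); last by calg.
  by rewrite -expr2 sqrCi opprK scale1r.
exists (r2 ** r1); rewrite E; split.
  by rewrite smulA -(smulA r2) r1l smulr1 r2l.
by rewrite smulA -(smulA _ _ r2) r2r smulr1 r1r.
Qed.

Lemma inv_pos (t : C) h : 0 < t -> pos h -> exists r,
  r ** (t *: sone + h) = sone /\ (t *: sone + h) ** r = sone.
Proof.
move=> t0 /pos_sqrt[c [cs _ <- _]].
have s0 : 0 < sqrtC t by rewrite sqrtC_gt0.
pose x := (sqrtC t)^-1 *: c.
have [|r [rl rr]] := @inv_1Dsq x.
  by rewrite star_scale // rpredV gtr0_real.
have E : t *: sone + c ** c = t *: (sone + x ** x).
  rewrite smulZl smulZr scalerA scalerDr -expr2 exprVn sqrtCK scalerA.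
  by rewrite divff ?gt_eqF // scale1r.
move: x rl rr E => x rl rr E.
exists (t^-1 *: r); rewrite E !smulZl !smulZr !scalerA rl rr.
by rewrite divff ?mulVf ?gt_eqF // scale1r.
Qed.

(** A negative multiple of the unit is positive only in the zero algebra; this settles that
    degenerate case wherever the sign of a scalar is in doubt. *)
Lemma pos_not_scalar_neg (t : C) h : t < 0 -> pos h -> pos (t *: sone - h) ->
  h = 0.
Proof.
move=> t0 ph pth; have p1 : pos (t *: sone) by rewrite -[_ *: _](subrK h); apply: posD.
have t1 : t *: sone = 0 :> A.
  by apply: pos_anti => //; rewrite -scaleNr; apply: pos_scalar; rewrite oppr_ge0 ltW.
have s0 : sone = 0 :> A.
  by apply/eqP; move/eqP: t1; rewrite scaler_eq0 lt_eqF.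
by rewrite -[h]smul1 s0 smul0l.
Qed.

(** The norm of a nonzero positive [q] lies in its spectrum. If [d = |q| - q] had an inverse [r],
    then [r] would be positive and below some [M], so [d (M - r) >= 0]; this reads [q <= |q| - 1/M]
    and contradicts the value of the norm. *)
Lemma pos_norm_spectrum q r : pos q -> r ** (`|q| *: sone - q) = sone ->
  (`|q| *: sone - q) ** r = sone -> q = 0.
Proof.
move=> pq; set d := _ - q => rd dr; apply/eqP; apply: contraT => q0.
have T0 : 0 < `|q| by rewrite normr_gt0.
have qs := pos_star pq.
have pd : pos d by apply: pos_bound.
have ds := pos_star pd.
have rs : star r = r.
  by rewrite -[LHS]smulr1 -dr smulA -[in X in (_ ** X) ** _]ds -starM dr star_one smul1.
have [e [es _ ee He]] := pos_sqrt pd.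
have er : r ** e = e ** r.
  by apply: (He [set x | r ** x = x ** r]) => /=; [exact: square_closed_comm|rewrite rd].
have pr : pos r.
  have -> : r = (e ** r) ** (e ** r).
    by rewrite smulA -(smulA e r e) er !smulA ee dr smul1.
  by apply: pos_sq; rewrite starM es rs.
pose M := `|r| + 1; have M0 : 0 < M by rewrite ltr_wpDl.
have pMr : pos (M *: sone - r) by apply: pos_bound => //; rewrite lerDl.
have := posM pd pMr; rewrite smulBr (smulBl (M *: sone)) (smulZr M) (smulZl M) smul1 smulr1 dr rd.
move=> /(_ erefl)/(posZ (_ : 0 <= M^-1)); rewrite invr_ge0 => /(_ (ltW M0)).
rewrite (_ : _ *: _ = (`|q| - M^-1) *: sone - q); last first.
  rewrite scalerBr scalerA mulVf ?gt_eqF // scale1r /d; lmod.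
have tr : `|q| - M^-1 \is Num.real by rewrite rpredB ?rpredV ?gtr0_real.
have [tn|tp] := real_ltP tr (rpred0 _) => ptq.
  by rewrite (pos_not_scalar_neg tn pq ptq) eqxx in q0.
have := pos_le_norm tp pq ptq.
by rewrite lerDl oppr_ge0 invr_le0 lt_geF.
Qed.

(* With m = |a* a| and g = m - a* a, the element y = a g satisfies
   - y* y = m g^2 >= 0, hence y y* >= 0 too; so y* y = 0 as the spectra of y* y
   and y y* agree outside 0. *)
Theorem pos_starM a : pos (star a ** a).
Proof.
set h := star a ** a; have hs : star h = h by rewrite starM starK.
have [m [ms pm mm Hm]] := pos_sqrt (pos_sq hs).
have hm : h ** m = m ** h.
  apply: (Hm [set x | h ** x = x ** h]) => /=; last by rewrite smulA.
  exact: square_closed_comm.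
pose g := m - h; have gs : star g = g by rewrite starB ms hs.
have mg : m ** g = - (h ** g) by rewrite !smulBr mm hm; lmod.
have gm : g ** m = m ** g by rewrite smulBl smulBr hm.
have gh : g ** h = h ** g by rewrite smulBl smulBr hm.
have gg : g ** g = 2 *: (m ** g).
  by rewrite {1}/g smulBl -gh gh mg; lmod.
have [n [ns _ nn Hn]] := pos_sqrt pm.
have gn : g ** n = n ** g.
  apply: (Hn [set x | g ** x = x ** g]) => //; exact: square_closed_comm.
pose k := n ** g; have ks : star k = k by rewrite starM ns gs gn.
pose y := a ** g.
have yy : star y ** y = - (k ** k).
  rewrite starM gs /y /k smulA -(smulA g) -/h gh.
  have -> : (n ** g) ** (n ** g) = m ** (g ** g).
    by rewrite smulA -(smulA n g n) gn smulA nn smulA.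
  by rewrite smulA mg smulNl opprK.
(* Twice the real part and, up to sign, twice the imaginary part of [y]: then [p^2 + q^2] is twice
   the sum of [y ** star y] and [star y ** y]. *)
pose p := y + star y; pose q := 'i *: (y - star y).
have ps : star p = p by rewrite starD starK addrC.
have qs : star q = q by rewrite starZ starB starK conjCi /q; lmod.
have pyy : pos (y ** star y).
  have -> : y ** star y = 2^-1 *: (p ** p + q ** q) + k ** k.
    rewrite -[k ** k]opprK -yy.
    have -> : q ** q = (- 1) *: ((y - star y) ** (y - star y)).
      by rewrite smulZl smulZr scalerA -expr2 sqrCi.
    have -> : p ** p + (- 1) *: ((y - star y) ** (y - star y)) =
        2 *: (y ** star y + star y ** y) by calg.
    by rewrite scalerA mulVf ?pnatr_eq0 // scale1r addrK.
  apply: posD; last exact: pos_sq.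
  by apply: posZ; rewrite ?invr_ge0 //; apply: posD; apply: pos_sq.
have kk0 : k ** k = 0.
  have [->//|kk0] := eqVneq (k ** k) 0.
  have T0 : 0 < `|k ** k| by rewrite normr_gt0.
  have [r [rl rr]] := inv_pos T0 pyy; set T := `|k ** k| in T0 rl rr *.
  have TE : T *: sone - k ** k = T *: sone + star y ** y by rewrite yy.
  have yT : y ** (T *: sone + star y ** y) = (T *: sone + y ** star y) ** y.
    by calg.
  have Ty : (T *: sone + star y ** y) ** star y =
      star y ** (T *: sone + y ** star y) by calg.
  (* The witness is the usual transfer of an inverse from [T + y ** star y] to [T + star y ** y],
     the latter being [T - k ** k]. *)
  apply: (@pos_norm_spectrum _ (T^-1 *: (sone - star y ** (r ** y)))).
  - exact: pos_sq.
  - rewrite -/T TE smulZl smulBl smul1 -smulA -(smulA r) yT (smulA r) rl smul1.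
    by rewrite addrK scalerA mulVf ?scale1r // gt_eqF.
  rewrite -/T TE smulZr smulBr smulr1 smulA Ty -smulA (smulA _ r) rr smul1.
  by rewrite addrK scalerA mulVf ?scale1r // gt_eqF.
(* From here [h g = 0], hence [m g = 0] and [g^2 = 2 m g = 0]; so [g = 0], that is [h = m], which is
   positive. *)
have y0 : y = 0 by apply: star_mul_eq0; rewrite yy kk0 oppr0.
have hg : h ** g = 0 by rewrite -smulA -/y y0 smul0r.
have g0 : g = 0.
  by apply: star_mul_eq0; rewrite gs gg mg hg oppr0 scaler0.
by have/subr0_eq <- : m - h = 0.
Qed.

End Positivity.

(** * Quotients of C*-algebras *)

Section FastSequences.
Context (R : realType).
Local Notation C := R[i].

Lemma exp_half_small (M e : C) : 0 <= M -> 0 < e ->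
  exists N, forall n, (N <= n)%N -> M * 2^-1 ^+ n < e.
Proof.
move=> M0 e0; have [N HN] := complex_arch M0 e0; exists N => n Nn.
rewrite exprVn ltr_pdivrMr ?exprn_gt0 // mulrC (lt_le_trans HN) // ler_pM2r //.
by rewrite -natrX ler_nat (leq_trans Nn) // ltnW // ltn_expl.
Qed.

Lemma fast_dist (X : normedModType C) (u : nat -> X) (M : C) : 0 <= M ->
  (forall n, `|u n.+1 - u n| <= M * 2^-1 ^+ n) ->
  forall n m, (n <= m)%N -> `|u m - u n| <= M * 2 * 2^-1 ^+ n.
Proof.
move=> M0 uM n m nm; rewrite -(subnKC nm).
have H k : `|u (n + k)%N - u n| <= M * 2 * 2^-1 ^+ n * (1 - 2^-1 ^+ k).
  elim: k => [|k IH]; first by rewrite addn0 subrr normr0 expr0 subrr mulr0.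
  rewrite addnS (_ : _ - _ = (u (n + k).+1 - u (n + k)%N) + (u (n + k)%N - u n)); last by lmod.
  rewrite (le_trans (ler_normD _ _)) // (le_trans (lerD (uM _) IH)) //.
  rewrite exprD exprS.
  rewrite (_ : _ + _ = M * 2 * 2^-1 ^+ n * (1 - 2^-1 * 2^-1 ^+ k)) //.
  by field.
rewrite (le_trans (H _)) // ler_piMr ?gerBl ?exprn_ge0 ?invr_ge0 //.
by rewrite !mulr_ge0 ?exprn_ge0 ?invr_ge0.
Qed.

Lemma fast_cvg (X : completeNormedModType C) (u : nat -> X) (M : C) : 0 <= M ->
  (forall n, `|u n.+1 - u n| <= M * 2^-1 ^+ n) -> cvg (u @ \oo).
Proof.
move=> M0 uM; apply/cauchy_cvgP/cauchy_exP => e e0.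
have [|N HN] := @exp_half_small (M * 2) e _ e0; first by rewrite mulr_ge0.
exists (u N), N => // m /= Nm; rewrite -ball_normE /= distrC.
by rewrite (le_lt_trans (fast_dist M0 uM Nm)) // HN.
Qed.

(* A normed space is complete as soon as the sequences u with
   |u_(n+1) - u_n| <= 2^-n converge. *)
Lemma fast_complete (X : normedModType C) :
  (forall u : nat -> X, (forall n, `|u n.+1 - u n| <= 2^-1 ^+ n) ->
    exists l, forall e : C, 0 < e -> exists n0, forall n, (n0 <= n)%N ->
      `|u n - l| < e) ->
  forall F : set_system X, ProperFilter F -> cauchy F -> cvg F.
Proof.
move=> H F FF /cauchyP cF.
have r0 n : 0 < 2^-1 ^+ n / 2 :> C by rewrite divr_gt0 // exprn_gt0.
have /choice[u Hu] : forall n, exists x : X, F (ball x (2^-1 ^+ n / 2 : C)).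
  by move=> n; have [x] := cF _ (r0 n); exists x.
have [|l Hl] := H u.
  move=> n; have [y [yn yS]] := filter_ex (filterI (Hu n) (Hu n.+1)).
  move: yn yS; rewrite -!ball_normE /= => yn yS.
  rewrite (_ : _ - _ = (u n.+1 - y) + (y - u n)); last by lmod.
  rewrite (le_trans (ler_normD _ _)) // (distrC y).
  rewrite (le_trans (lerD (ltW yS) (ltW yn))) // exprS.
  rewrite (_ : _ + _ = 2^-1 ^+ n - 2^-1 ^+ n / 4); last by field.
  by rewrite gerBl divr_ge0 // exprn_ge0 // invr_ge0.
apply/cvg_ex; exists l => B /nbhs_ballP[e /= e0 eB].
have e2 : 0 < e / 2 by rewrite divr_gt0.
have [n0 Hn0] := Hl _ e2.
have [|N HN] := @exp_half_small 1 (e / 2) _ e2; first exact: ler01.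
pose m := maxn n0 N; apply: filterS (Hu m) => y.
rewrite -ball_normE => /= uy; apply: eB; rewrite -ball_normE /=.
rewrite (_ : l - y = (l - u m) + (u m - y)); last by lmod.
rewrite (le_lt_trans (ler_normD _ _)) // [ltRHS]splitr ltrD //.
  by rewrite distrC Hn0 // leq_maxl.
rewrite (lt_trans uy) // (le_lt_trans _ (HN m (leq_maxr _ _))) // mul1r.
by rewrite ler_pdivrMr // ler_peMr ?exprn_ge0 ?invr_ge0 // ler1n.
Qed.
End FastSequences.

Section ApproximateUnit.
Context (R : realType) (A : cstarAlgType R) (I : closed_ideal A).
Implicit Types a j k r : A.
Local Notation C := R[i].

(** Take [r = (1 + i m s k)^-1] with [k = j ** star j], where [s] keeps the norm in the range of
    [resolvent]. Then [1 - r] is a multiple of [r k], hence in the ideal, and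
    [m s |r j|^2 <= m s |r k| = |1 - r| <= 2]; a large [m] finishes. *)
Lemma approximate_unit j (e : C) : ideal_set I j -> 0 < e -> exists r,
  [/\ `|r| <= 1, ideal_set I (sone - r) & `|r ** j| < e].
Proof.
move=> Ij e0; pose k := j ** star j; pose s : C := (2 * (`|k| + 1))^-1.
have k1 : 0 < `|k| + 1 by rewrite ltr_wpDl.
have s0 : 0 < s by rewrite invr_gt0 mulr_gt0.
pose x := ('i * s) *: k.
have xs : star x = - x.
  rewrite starZ rmorphM /= conjCi (CrealP (gtr0_real s0)) mulNr scaleNr.
  by rewrite starM starK.
have is1 : `|'i * s| = s by rewrite normrM normCi mul1r gtr0_norm.
have x2 : `|x| <= 2^-1.
  rewrite normrZ is1 /s invfM -mulrA.
  by rewrite ler_piMr ?invr_ge0 // ler_pdivrMl // mulr1 lerDl.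
have [m Hm] : exists m : nat, 2 < m%:R * (s * e ^+ 2).
  by apply: complex_arch; rewrite ?ler0n // mulr_gt0 // exprn_gt0.
have [r [r1 rl rr]] := resolvent xs x2 m.
have rE : sone - r = (m%:R * ('i * s)) *: (r ** k).
  by rewrite -rl smulDr smulr1 smulZr /x smulZr scalerA addrC addKr.
have IZ (c : C) y : ideal_set I y -> ideal_set I (c *: y).
  by move=> Iy; rewrite -[_ *: _]addr0; apply: idealP => //; exact: ideal0.
exists r; split=> //.
  by rewrite rE; apply: IZ; apply: idealMl; apply: Defs.idealMr.
have m0 : 0 < m%:R :> C.
  by rewrite ltr0n; case: m Hm {rl rr rE} => [|//]; rewrite mul0r le_gtF ?ler0n.
rewrite -(ltr_pXn2r (n := 2)) ?nnegrE ?(ltW e0) //.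
rewrite -(norm_star (r ** j)) -cstar_identity starK starM.
rewrite smulA -(smulA r) -/k.
rewrite -(ltr_pM2l (mulr_gt0 m0 s0)) -[ltRHS]mulrA (le_lt_trans _ Hm) //.
have : `|sone - r| <= 2.
  by rewrite (le_trans (ler_normB _ _)) // lerD // norm_one_le1.
apply: le_trans; rewrite rE normrZ normrM is1 normr_nat.
rewrite ler_wpM2l ?mulr_ge0 ?(ltW m0) ?(ltW s0) //.
by rewrite (le_trans (norm_smul _ _)) // ler_piMr // norm_star.
Qed.

(** The inequality [|x|^2 <= |star x ** x|] is the substantial one. Take [b] nearly minimal in the
    class of [star a ** a], and [r] from [approximate_unit] for their difference: [a ** star r] is
    still a representative of [x], and [r] makes the difference negligible. *)
Lemma quot_cstar (x : quot I) : `|star x ** x| = `|x| ^+ 2.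
Proof.
apply/eqP; rewrite eq_le; apply/andP; split.
  by rewrite expr2 (le_trans (norm_smul _ _)) // norm_star.
elim/Defs.quotP: x => a; apply/ler_addgt0Pl => e e0.
have e2 : 0 < e / 2 by rewrite divr_gt0.
have aE : star (qproj I a) ** qproj I a = qproj I (star a ** a).
  by rewrite [star _]quot_starE [_ ** _]quot_mulE.
rewrite aE.
have [|b /qprojP Hb be] := @quot_norm_lt _ _ I (qproj I (star a ** a))
  (e / 2 + `|qproj I (star a ** a)|); first by rewrite ltrDr.
have [r [r1 Ir rj]] := approximate_unit Hb e2.
have -> : qproj I a = qproj I (a ** star r).
  apply/qprojP; rewrite -{1}[a]smulr1 -smulBr; apply: idealMl.
  by rewrite -star_one -starB; apply: ideal_star.
rewrite (le_trans (_ : _ <= `|a ** star r| ^+ 2)) //.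
  by rewrite lerXn2r ?nnegrE // quot_norm_le.
rewrite -cstar_identity starM starK.
have -> : (r ** star a) ** (a ** star r) =
    r ** b ** star r - (r ** (b - star a ** a)) ** star r by calg.
rewrite (le_trans (ler_normB _ _)) //.
rewrite [e]splitr -addrA [leRHS]addrC; apply: lerD.
  apply: le_trans (ltW be); rewrite (le_trans (norm_smul _ _)) //.
  by rewrite norm_star (le_trans (ler_piMr _ r1)) // (le_trans (norm_smul _ _)) // ler_piMl.
apply: le_trans (ltW rj); rewrite (le_trans (norm_smul _ _)) //.
by rewrite norm_star ler_piMr.
Qed.

(** Lift the successive differences of a fast sequence, doubling the bound to get a strict
    inequality over the quotient norm, and sum the lifts in [A]. *)
Lemma quot_complete (F : set_system (quot I)) :
  ProperFilter F -> cauchy F -> cvg F.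
Proof.
apply: fast_complete => u Hu.
have /choice[a Ha] : forall n, exists a, qproj I a = u n.+1 - u n /\
    `|a| <= 2 * 2^-1 ^+ n.
  move=> n; have p0 : 0 < 2^-1 ^+ n :> C by rewrite exprn_gt0.
  have [|a aE an] := @quot_norm_lt _ _ I (u n.+1 - u n) (2 * 2^-1 ^+ n).
    by rewrite (le_lt_trans (Hu n)) // ltr_pMl // ltr1n.
  by exists a; split=> //; exact: ltW.
pose s n := repr (u 0%N) + \sum_(i < n) a i.
have sS n : s n.+1 - s n = a n by rewrite /s big_ord_recr /=; lmod.
have qs n : qproj I (s n) = u n.
  elim: n => [|n IH]; first by rewrite /s big_ord0 addr0 /qproj reprK.
  by rewrite -[s n.+1](subrK (s n)) sS qprojD IH (Ha n).1 subrK.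
have /cvg_ex[l sl] : cvg (s @ \oo).
  by apply: (fast_cvg (M := 2)) => // n; rewrite sS; exact: (Ha n).2.
exists (qproj I l) => e e0.
have /cvgrPdist_lt/(_ _ e0)[N _ HN] := sl.
exists N => n Nn; rewrite -qs -scaleN1r -qprojZ -qprojD scaleN1r.
by rewrite (le_lt_trans (quot_norm_le _ _)) // distrC; apply: HN.
Qed.
HB.instance Definition _ := Uniform_isComplete.Build (quot I) quot_complete.
HB.instance Definition _ := NormedStarAlgebra_isCStar.Build R (quot I) quot_cstar.
End ApproximateUnit.

(** * Extremal states *)

Section ExtremalHahnBanach.
Context (R : realType) (V : lmodType R[i]) (p : V -> R).
Hypothesis pD : forall x y, p (x + y) <= p x + p y.
Hypothesis pZ : forall (r : R) x, 0 <= r -> p (r%:C%C *: x) = r * p x.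
Implicit Types (D : set V) (f F G H : V -> R) (x y v w : V) (r t : R).

Definition real_linear G := forall r x y, G (r%:C%C *: x + y) = r * G x + G y.

(** The competitors [G] and [H] are defined and dominated on the whole space, while the identity and
    the conclusion concern [D] alone: the one-step extension can evaluate them at the new vector,
    and the property passes to unions of chains. *)
Definition extremal_on D f := forall G H t, real_linear G -> real_linear H ->
  (forall x, G x <= p x) -> (forall x, H x <= p x) -> 0 < t < 1 ->
  (forall x, D x -> f x = t * G x + (1 - t) * H x) -> forall x, D x -> G x = f x.

Definition partial_extremal D f := [/\ D 0,
  forall r x y, D x -> D y ->
    D (r%:C%C *: x + y) /\ f (r%:C%C *: x + y) = r * f x + f y,
  forall x, D x -> f x <= p x & extremal_on D f].

Lemma real_linearD G x y : real_linear G -> G (x + y) = G x + G y.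
Proof. by move=> lG; rewrite -{1}[x]scale1r (lG 1) mul1r. Qed.

Lemma real_linear0 G : real_linear G -> G 0 = 0.
Proof. by move=> lG; have := real_linearD 0 0 lG; rewrite addr0; lra. Qed.

Lemma real_linearZ G r x : real_linear G -> G (r%:C%C *: x) = r * G x.
Proof. by move=> lG; rewrite -[_ *: _]addr0 lG real_linear0 // addr0. Qed.

Lemma real_linearN G x : real_linear G -> G (- x) = - G x.
Proof.
by move=> lG; have := real_linearD x (- x) lG; rewrite subrr real_linear0 //; lra.
Qed.

Section PartialTheory.
Context (D : set V) (f : V -> R) (Df : partial_extremal D f).

Lemma partialD x y : D x -> D y -> D (x + y) /\ f (x + y) = f x + f y.
Proof.
case: Df => _ lD _ _ Dx Dy; have := lD 1 x y Dx Dy.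
by rewrite scale1r mul1r.
Qed.

Lemma partial0 : f 0 = 0.
Proof.
by case: Df => D0 _ _ _; have [_] := partialD D0 D0; rewrite addr0; lra.
Qed.

Lemma partialZ r x : D x -> D (r%:C%C *: x) /\ f (r%:C%C *: x) = r * f x.
Proof.
case: Df => D0 lD _ _ Dx; have := lD r x 0 Dx D0.
by rewrite !addr0 partial0 addr0.
Qed.

Lemma partialN x : D x -> D (- x) /\ f (- x) = - f x.
Proof.
by move=> /(partialZ (-1)); rewrite rmorphN1 scaleN1r mulN1r.
Qed.

End PartialTheory.

(* One step of the Hahn-Banach construction; taking the largest admissible value
   at v is what preserves extremality. *)
Lemma extend_extremal D f v : partial_extremal D f -> exists D' f',
  [/\ partial_extremal D' f', D `<=` D', forall x, D x -> f' x = f x, D' v &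
   forall c, (forall w, D w -> c <= p (v + w) - f w) -> c <= f' v].
Proof.
move=> Df; have [D0 lD fp ext] := Df.
have [Dv|nDv] := pselect (D v).
  exists D, f; split=> // c /(_ (- v)); have [DN ->] := partialN Df Dv.
  move=> /(_ DN); rewrite subrr.
  by have := pZ 0 (lexx 0); rewrite scale0r mul0r => ->; lra.
(* A value at [v] is admissible for the vectors [v + w] when it is a lower bound of [E], and
   positive multiples follow by homogeneity. The lower bounds of [E] in [Elb] take care of the
   negative multiples of [v]. *)
pose E := [set p (v + w) - f w | w in D].
have Elb w' s : 0 < s -> D w' -> forall w, D w ->
    (f w' - p (w' - s%:C%C *: v)) / s <= p (v + w) - f w.
  move=> s0 Dw' w Dw; rewrite ler_pdivrMr // mulrBl mulrC -pZ ?(ltW s0) //.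
  have [Dsw fsw] := partialZ Df s Dw.
  have [Dww fww] := partialD Df Dw' Dsw.
  have := fp _ Dww; rewrite fww fsw.
  have := pD (w' - s%:C%C *: v) (s%:C%C *: (v + w)).
  rewrite (_ : _ + _ = w' + s%:C%C *: w); last by lmod.
  by move=> h1 h2; rewrite (mulrC (f w)); lra.
have hE : has_inf E.
  split; first by exists (p (v + 0) - f 0), 0.
  exists ((f 0 - p (0 - 1%:C%C *: v)) / 1) => _ [w Dw <-]; exact: Elb.
pose m := inf E.
have mE w : D w -> m <= p (v + w) - f w.
  by move=> Dw; apply: ge_inf; [case: hE | exists w].
have mlb c : (forall w, D w -> c <= p (v + w) - f w) -> c <= m.
  by move=> Hc; apply: lb_le_inf; [case: hE | move=> _ [w Dw <-]; exact: Hc].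
(* As [v] is outside [D], the decomposition [w + r v] is unique, so [g] does not depend on the
   choice made. *)
pose rep x (q : V * R) := D q.1 /\ x = q.1 + (q.2)%:C%C *: v.
have rep_uniq x q q' : rep x q -> rep x q' -> q = q'.
  case: q q' => [w r] [w' r'] [/= Dw ->] [/= Dw' e].
  have rr : r = r'.
    apply/eqP; rewrite -subr_eq0; apply: contra_notT nDv => rr.
    have [DN _] := partialN Df Dw; have [DB _] := partialD Df Dw' DN.
    have [DZ _] := partialZ Df (r - r')^-1 DB; move: DZ.
    rewrite (_ : w' - w = (r - r')%:C%C *: v).
      by rewrite scalerA -rmorphM mulVf // rmorph1 scale1r.
    rewrite rmorphB scalerBl; apply/eqP.
    rewrite subr_eq addrAC -subr_eq opprK; apply/eqP.
    by rewrite addrC -e addrC.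
  by move: e; rewrite rr => /addIr ->.
pose g x : R := if pselect (exists q, rep x q) is left e
  then f (projT1 (cid e)).1 + (projT1 (cid e)).2 * m else 0.
have gE w r : D w -> g (w + r%:C%C *: v) = f w + r * m.
  move=> Dw; rewrite /g; case: pselect => [e|]; last by case; exists (w, r).
  by case: cid => q /= rq; rewrite (rep_uniq _ q (w, r) rq).
have gD w : D w -> g w = f w.
  by move=> Dw; have := gE w 0 Dw; rewrite rmorph0 scale0r addr0 mul0r addr0.
exists [set x | exists q, rep x q], g; split.
- split.
  + by exists (0, 0); split; rewrite //= rmorph0 scale0r addr0.
  + move=> r _ _ [[w s] [/= Dw ->]] [[w' s'] [/= Dw' ->]].
    have [DZ fZ] := lD r _ _ Dw Dw'.
    have e : r%:C%C *: (w + s%:C%C *: v) + (w' + s'%:C%C *: v) =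
       (r%:C%C *: w + w') + (r * s + s')%:C%C *: v.
      by rewrite rmorphD rmorphM /=; lmod.
    split; first by exists (r%:C%C *: w + w', r * s + s').
    by rewrite e !gE // fZ; ring.
  + move=> _ [[w r] [/= Dw ->]]; rewrite gE //.
    have [r0|r0|->] := ltgtP r 0; last by rewrite rmorph0 scale0r addr0 mul0r addr0 fp.
      have s0 : 0 < - r by rewrite oppr_gt0.
      have := mlb _ (Elb w _ s0 Dw); rewrite ler_pdivrMr //.
      by rewrite rmorphN scaleNr opprK; lra.
    have [DZ fZ] := partialZ Df r^-1 Dw.
    have e : r%:C%C *: (v + (r^-1)%:C%C *: w) = w + r%:C%C *: v.
      rewrite scalerDr scalerA -(rmorphM (real_complex R)) divff ?gt_eqF //.
      by rewrite (rmorph1 (real_complex R)) scale1r addrC.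
    have := mE _ DZ; rewrite fZ -(ler_pM2l r0) mulrBr -pZ ?(ltW r0) // e.
    by rewrite mulrA divff ?gt_eqF // mul1r; lra.
  + move=> G H t lG lH Gp Hp t01 fGH.
    have fGH' x : D x -> f x = t * G x + (1 - t) * H x.
      by move=> Dx; rewrite -gD // fGH //; exists (x, 0); split; rewrite //= rmorph0 scale0r addr0.
    have GD := ext G H t lG lH Gp Hp t01 fGH'.
    have HD x : D x -> H x = f x.
      move=> Dx; have := fGH' _ Dx; rewrite (GD _ Dx) => e.
      have /eqP : (1 - t) * (H x - f x) = 0 by lra.
      by rewrite mulf_eq0 => /orP[/eqP|/eqP]; case/andP: t01; lra.
    (* [G] and [H] agree with [f] on [D], so their values at [v] are admissible and at most [m]; a
       proper average of them equals [m], hence both do. *)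
    have Gm : G v <= m.
      apply: mlb => w Dw; rewrite -(GD _ Dw).
      by have := Gp (v + w); rewrite real_linearD //; lra.
    have Hm : H v <= m.
      apply: mlb => w Dw; rewrite -(HD _ Dw).
      by have := Hp (v + w); rewrite real_linearD //; lra.
    have gv : g v = m.
      by have := gE 0 1 D0; rewrite rmorph1 scale1r add0r mul1r (partial0 Df) add0r.
    have Gv : G v = m.
      have := fGH v; rewrite gv => /(_ _)/wrap[].
        by exists (0, 1); split; rewrite //= rmorph1 scale1r add0r.
      by case/andP: t01 => t0 t1 e; nra.
    move=> _ [[w r] [/= Dw ->]].
    by rewrite gE // real_linearD // real_linearZ // Gv GD.
- by move=> x Dx; exists (x, 0); split; rewrite //= rmorph0 scale0r addr0.
- exact: gD.
- by exists (0, 1); split; rewrite //= rmorph1 scale1r add0r.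
move=> c /mlb; have := gE 0 1 D0.
by rewrite rmorph1 scale1r add0r mul1r (partial0 Df) add0r => ->.
Qed.

Theorem extremal_hahn_banach D f : partial_extremal D f -> exists F,
  [/\ real_linear F, forall x, F x <= p x, forall x, D x -> F x = f x &
      extremal_on setT F].
Proof.
move=> Df; pose le (d e : set V * (V -> R)) :=
  d.1 `<=` e.1 /\ forall x, d.1 x -> e.2 x = d.2 x.
pose T := {d : set V * (V -> R) | partial_extremal d.1 d.2 /\ le (D, f) d}.
have lexx' d : le d d by split.
have letr d1 d2 d3 : le d1 d2 -> le d2 d3 -> le d1 d3.
  move=> [s1 e1] [s2 e2]; split; first exact: subset_trans s2.
  by move=> x d1x; rewrite e2 ?e1 //; exact: s1.
pose t0 : T := exist _ (D, f) (conj Df (lexx' _)).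
have [|||t tmax] := @ZL_preorder T t0 (fun a b : T => `[< le (proj1_sig a) (proj1_sig b) >]).
- by move=> s; apply/asboolP.
- by move=> r s t /asboolP rs /asboolP st; apply/asboolP; exact: letr st.
(* The empty chain is bounded by the initial pair. For a nonempty chain, extremality at a point of
   the union is tested in a member of the chain that contains it. *)
- move=> A Atot; have [[a Aa]|A0] := pselect (exists a, A a); last first.
    by exists t0 => s As; case: A0; exists s.
  pose E := [set x | exists2 s, A s & (proj1_sig s).1 x].
  pose g x : R := if pselect (exists2 s, A s & (proj1_sig s).1 x) is left e
    then (proj1_sig (projT1 (cid2 e))).2 x else 0.
  have gE s x : A s -> (proj1_sig s).1 x -> g x = (proj1_sig s).2 x.
    move=> As sx; rewrite /g; case: pselect => [e|]; last by case; exists s.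
    case: cid2 => s' As' sx' /=.
    by have [/asboolP[_ h]|/asboolP[_ h]] := Atot _ _ As As'; rewrite h.
  have Esub s : A s -> le (proj1_sig s) (E, g).
    by move=> As; split => [x sx|x sx /=]; [exists s | exact: gE].
  have pE : partial_extremal E g.
    split.
    + by exists a => //; case: (proj2_sig a) => -[].
    + move=> r x y [s As sx] [s' As' sy].
      wlog [s1 e1] : / exists2 u, A u & (proj1_sig u).1 x /\ (proj1_sig u).1 y.
        apply; have [/asboolP[ss _]|/asboolP[ss _]] := Atot _ _ As As'.
          by exists s' => //; split=> //; apply: ss.
        by exists s => //; split=> //; apply: ss.
      move=> [s1x s1y]; case: (proj2_sig s1) => -[_ lin _ _] _.
      have [d1 e2] := lin r _ _ s1x s1y; split; first by exists s1.
      by rewrite !(gE s1).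
    + move=> x [s As sx]; rewrite (gE s) //.
      by case: (proj2_sig s) => -[_ _ sp _] _; exact: sp.
    + move=> G H t lG lH Gp Hp t01 gGH x [s As sx]; rewrite (gE s) //.
      case: (proj2_sig s) => -[_ _ _ sext] _.
      apply: (sext G H t) => // y sy; rewrite -(gE s) // gGH //; by exists s.
  have leE : le (D, f) (E, g).
    by apply: letr (Esub _ Aa); case: (proj2_sig a).
  exists (exist _ (E, g) (conj pE leE)) => s As; apply/asboolP; exact: Esub.
case: t tmax => -[E g] [/= pE leE] tmax.
have ET x : E x.
  have [E' [g' [pE' EE' gg' E'x _]]] := extend_extremal x pE.
  have le' : le (D, f) (E', g') by apply: (letr _ _ _ leE); split.
  have := tmax (exist _ (E', g') (conj pE' le')).
  have H1 : `[< le (E, g) (E', g') >] by apply/asboolP; split.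
  by move=> /(_ H1)/asboolP[/= + _]; apply.
have [E0 lE gp ext] := pE; exists g; split.
- by move=> r x y; case: (lE r x y (ET _) (ET _)).
- by move=> x; exact: gp.
- by move=> x Dx; exact: leE.2.
move=> G H t lG lH Gp Hp t01 fGH x _; apply: (ext G H t) => // y _; exact: fGH.
Qed.

End ExtremalHahnBanach.

(** * States and the existence of extremal ones *)

Section States.
Context (R : realType) (A : cstarAlgType R).
Implicit Types (a b c h v x y : A) (F G H : A -> R[i]).
Local Notation C := R[i].

Definition state F := [/\ forall (c : C) x y, F (c *: x + y) = c * F x + F y,
  F sone = 1 & forall a, 0 <= F (star a ** a)].

Definition extremal_state F := state F /\ forall G H (t : R), state G -> state H ->
  0 < t < 1 -> (forall a, F a = t%:C%C * G a + (1 - t)%:C%C * H a) -> G = F.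

Section StateTheory.
Context (F : A -> C) (SF : state F).

Lemma stateD x y : F (x + y) = F x + F y.
Proof. by case: SF => lF _ _; rewrite -{1}[x]scale1r lF mul1r. Qed.

Lemma state0 : F 0 = 0.
Proof. by apply: (addrI (F 0)); rewrite -stateD !addr0. Qed.

Lemma stateZ (c : C) x : F (c *: x) = c * F x.
Proof. by case: SF => lF _ _; rewrite -[c *: x]addr0 lF state0 addr0. Qed.

Lemma stateN x : F (- x) = - F x.
Proof. by rewrite -scaleN1r stateZ mulN1r. Qed.

Lemma stateB x y : F (x - y) = F x - F y.
Proof. by rewrite stateD stateN. Qed.

Lemma state1 : F sone = 1. Proof. by case: SF. Qed.

Lemma state_ge0 a : 0 <= F (star a ** a). Proof. by case: SF. Qed.

Lemma state_pos h : pos h -> 0 <= F h.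
Proof. by move=> /pos_sqrt[c [cs _ <- _]]; rewrite -{1}cs state_ge0. Qed.

(** Polarisation with the unit: expanding the real number [F (star (a + z) ** (a + z))] at [z = 1]
    and [z = 'i] determines the real and imaginary parts. *)
Lemma state_star a : F (star a) = (F a)^*.
Proof.
have key (z : C) : `|z| = 1 -> F a * z^* + F (star a) * z \is Num.real.
  move=> z1; have : F (star (a + z *: sone) ** (a + z *: sone)) \is Num.real.
    by rewrite ger0_real // state_ge0.
  have -> : star (a + z *: sone) ** (a + z *: sone) =
      star a ** a + z *: star a + z^* *: a + (z^* * z) *: sone.
    by rewrite starD starZ star_one; calg.
  rewrite !stateD !stateZ state1 mulr1 [z^* * z]mulrC -normCK z1 expr1n.
  rewrite (rpredDr _ (rpred1 _)) => fr.
  rewrite -(rpredDl _ (ger0_real (state_ge0 a))).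
  by rewrite [F a * _]mulrC [F (star a) * z]mulrC [z^* * _ + _]addrC addrA.
have h1 := key 1 (normr1 _); rewrite rmorph1 !mulr1 in h1.
have hi := key 'i (normCi _); rewrite conjCi in hi.
move/CrealP: h1; rewrite rmorphD /= => h1.
move/CrealP: hi; rewrite rmorphD !rmorphM rmorphN /= conjCi => hi.
apply: (mulfI (_ : 2 != 0 :> C)); first by rewrite pnatr_eq0.
have ii : 'i != 0 :> C by rewrite neq0Ci.
have {}hi : (F a)^* - (F (star a))^* = F (star a) - F a.
  by apply: (mulIf ii); rewrite mulrBl mulrBl; move: hi; rewrite opprK !mulrN => ->; ring.
rewrite !mulr_natl !mulr2n.
have -> : F (star a) + F (star a) = (F a + F (star a)) + (F (star a) - F a) by ring.
by rewrite -h1 -hi; ring.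
Qed.

(** This is the nonnegativity of the variance, [F] applied to [star d ** d] for [d = a - F a]. *)
Lemma state_cauchy_schwarz a : `|F a| ^+ 2 <= F (star a ** a).
Proof.
rewrite normCK; have := state_ge0 (a - F a *: sone).
rewrite starB starZ star_one.
have -> : (star a - (F a)^* *: sone) ** (a - F a *: sone) =
   star a ** a - F a *: star a - (F a)^* *: a + ((F a)^* * F a) *: sone by calg.
rewrite stateD !stateB !stateZ state1 state_star mulr1.
by rewrite [(F a)^* * F a]mulrC subrK subr_ge0.
Qed.

Lemma state_le_norm h : star h = h -> F h <= `|h|.
Proof.
move=> hs; rewrite -subr_ge0; have -> : `|h| - F h = F (`|h| *: sone - h).
  by rewrite stateB stateZ state1 mulr1.
by apply: state_pos; apply: pos_bound.
Qed.

End StateTheory.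

(** The norm of the self-adjoint part, the sublinear bound for Hahn-Banach: the real functionals
    that it dominates and that are 1 at the unit are the real parts of states ([state_Re],
    [complexify_state]). *)
Definition sym_norm a : R := complex.Re `|2^-1 *: (a + star a)|.

Lemma sym_normE a : (sym_norm a)%:C%C = `|2^-1 *: (a + star a)|.
Proof. by rewrite -normRe. Qed.

Lemma sym_normD x y : sym_norm (x + y) <= sym_norm x + sym_norm y.
Proof.
rewrite -lecR rmorphD /= !sym_normE.
by rewrite starD addrACA scalerDr ler_normD.
Qed.

Lemma sym_normZ (r : R) x : 0 <= r -> sym_norm (r%:C%C *: x) = r * sym_norm x.
Proof.
move=> r0; apply: (@complexI R); rewrite rmorphM /= !sym_normE.
have r0' : 0 <= r%:C%C :> C by rewrite lecR.
rewrite starZ (CrealP (ger0_real r0')) -scalerDr scalerA mulrC -scalerA.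
by rewrite normrZ ger0_norm.
Qed.

Lemma sym_norm_sa h : star h = h -> (sym_norm h)%:C%C = `|h|.
Proof.
move=> hs; rewrite sym_normE hs -mulr2n -[h *+ 2]scaler_nat scalerA.
by rewrite mulVf ?scale1r // pnatr_eq0.
Qed.

Lemma sym_norm_one : sym_norm sone <= 1.
Proof. by rewrite -lecR sym_norm_sa ?star_one // norm_one_le1. Qed.

Lemma Re_realM (r : R) (z : C) : complex.Re (r%:C%C * z) = r * complex.Re z.
Proof. by case: z => u w /=; ring. Qed.

Lemma state_Re F : state F -> real_linear (fun a => complex.Re (F a)) /\
  forall a, complex.Re (F a) <= sym_norm a.
Proof.
move=> SF; split=> [r x y|a].
  by rewrite stateD // stateZ //= -Re_realM; case: (_ * F x) (F y) => ? ? [].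
have hs : star (2^-1 *: (a + star a)) = 2^-1 *: (a + star a).
  by rewrite star_scale ?rpredV ?rpred_nat // starD starK addrC.
rewrite -lecR sym_normE (le_trans _ (state_le_norm SF hs)) //.
rewrite stateZ // stateD // state_star // ReJ_add mulrC; exact: lexx.
Qed.

Definition complexify (f : A -> R) a : C := Complex (f a) (- f ('i%C *: a)).

Lemma scale_complexE (c : C) x :
  c *: x = (complex.Re c)%:C%C *: x + (complex.Im c)%:C%C *: ('i%C *: x).
Proof. by rewrite {1}[c]complexE scalerDl scalerA [_ * 'i%C]mulrC. Qed.

Lemma complexify_linear f : real_linear f -> forall (c : C) x y,
  complexify f (c *: x + y) = c * complexify f x + complexify f y.
Proof.
move=> lf c x y; rewrite /complexify.
have -> : 'i%C *: (c *: x + y) = (complex.Re c)%:C%C *: ('i%C *: x) +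
    (- (complex.Im c)%:C%C *: x + 'i%C *: y).
  rewrite (scale_complexE c x) !scalerDr !scalerA.
  have -> : 'i%C * (complex.Im c)%:C%C * 'i%C = - (complex.Im c)%:C%C :> C.
    by rewrite -mulrA mulrCA -expr2 sqr_i mulrN1.
  by lmod.
rewrite -rmorphN !lf (scale_complexE c x) -addrA !lf.
case: c => c1 c2; apply/eqP; rewrite eq_complex /=.
by apply/andP; split; apply/eqP; ring.
Qed.

(** As [sym_norm] vanishes on skew-adjoint elements, so does [f], and [complexify f] is real on
    self-adjoint ones. For positive [h], [pos_norm] gives [f (|h| - h) <= |h|], which [f sone = 1]
    turns into [f h >= 0]. *)
Lemma complexify_state f : real_linear f -> (forall a, f a <= sym_norm a) ->
  f sone = 1 -> state (complexify f).
Proof.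
move=> lf fp f1; have flin := complexify_linear lf.
have fi h : star h = h -> f ('i%C *: h) = 0.
  move=> hs; have key (z : C) : z^* = - z -> f (z *: h) <= 0.
    move=> zs; rewrite (le_trans (fp _)) // -lecR sym_normE starZ hs zs.
    by rewrite scaleNr subrr scaler0 normr0.
  have i1 := key 'i%C (conjCi _).
  have i2 := key (- 'i%C); rewrite scaleNr real_linearN // in i2.
  have : - f ('i%C *: h) <= 0.
    by apply: i2; rewrite rmorphN; congr (- _); exact: conjCi.
  by rewrite oppr_le0 => i3; apply/eqP; rewrite eq_le i1.
split=> //.
  by rewrite /complexify f1 fi ?star_one // oppr0.
move=> a; have hs : star (star a ** a) = star a ** a by rewrite starM starK.
rewrite /complexify fi // oppr0 complexr0 ler0c.
have := pos_norm (pos_starM a) (lexx _); set h := star a ** a => hT.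
have hE := normRe h; set T := complex.Re _ in hE.
have Ts : star (`|h| *: sone - h) = `|h| *: sone - h.
  by rewrite starB star_scale ?star_one ?hs.
have := fp (`|h| *: sone - h); rewrite -lecR sym_norm_sa //.
move=> /le_trans/(_ hT); rewrite {2}hE lecR.
by rewrite hE lf // f1 real_linearN //; lra.
Qed.

Lemma state_complexify F : state F -> F = complexify (fun a => complex.Re (F a)).
Proof.
move=> SF; apply/funext => a; rewrite /complexify stateZ //.
by case: (F a) => u w /=; congr Complex; ring.
Qed.

Lemma complexify_extremal f : real_linear f -> (forall a, f a <= sym_norm a) ->
  f sone = 1 -> extremal_on sym_norm setT f -> extremal_state (complexify f).
Proof.
move=> lf fp f1 ext; split; first exact: complexify_state.
move=> G H t SG SH t01 E; have [lG Gp] := state_Re SG; have [lH Hp] := state_Re SH.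
have GE := ext _ _ t lG lH Gp Hp t01.
rewrite (state_complexify SG); congr complexify; apply/funext => a; apply: GE => //.
move=> x _; have := congr1 (@complex.Re R) (E x); rewrite /= => ->.
by rewrite -!Re_realM; case: (_ * G x) (_ * H x) => ? ? [].
Qed.

(** Covers two starting points: the scalars, for detecting a given element, and a commutative
    subalgebra evaluated at a point of its spectrum. *)
Definition partial_character (D : set A) (chi : A -> C) := [/\
  D sone /\ chi sone = 1,
  forall (c : C) x y, D x -> D y ->
    D (c *: x + y) /\ chi (c *: x + y) = c * chi x + chi y,
  forall x y, D x -> D y -> D (x ** y) /\ chi (x ** y) = chi x * chi y,
  forall x, D x -> D (star x) /\ chi (star x) = (chi x)^* &
  forall x, D x -> star x = x -> chi x <= `|x|].

Lemma real_state_combination (G H : A -> R) (t : R) : 0 < t < 1 ->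
  (forall x, G x <= sym_norm x) -> (forall x, H x <= sym_norm x) ->
  t * G sone + (1 - t) * H sone = 1 -> G sone = 1 /\ H sone = 1.
Proof.
move=> /andP[t0 t1] Gp Hp.
have := le_trans (Gp sone) sym_norm_one; have := le_trans (Hp sone) sym_norm_one.
by move: (G sone) (H sone) => g h h1 g1 e; split; nra.
Qed.

(** For [d = x - chi x] one has [chi (star d ** d) = 0]. If [chi] is an average of two states, both
    vanish on this positive element, and then on [d] by Cauchy-Schwarz, so both take the value
    [chi x] at [x]. *)
Lemma character_extremal (D : set A) chi : partial_character D chi ->
  partial_extremal sym_norm D (fun a => complex.Re (chi a)).
Proof.
move=> [[D1 chi1] lin mul st bnd].
have D0 : D 0 by have [] := lin (-1) _ _ D1 D1; rewrite scaleN1r addNr.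
have DZ (c : C) x : D x -> D (c *: x) /\ chi (c *: x) = c * chi x.
  move=> Dx; have [] := lin c _ _ Dx D0; have [_] := lin 1 _ _ D0 D0.
  rewrite scale1r !addr0 mul1r => /eqP; rewrite addrC -subr_eq subrr eq_sym.
  by move=> /eqP ->; rewrite addr0.
have DD x y : D x -> D y -> D (x + y) /\ chi (x + y) = chi x + chi y.
  by move=> Dx /(lin 1 _ _ Dx); rewrite scale1r mul1r.
split=> //.
- move=> r x y Dx Dy; have [? ->] := lin r%:C%C _ _ Dx Dy; split=> //.
  by rewrite -Re_realM; case: (_ * chi x) (chi y) => ? ? [].
- move=> x Dx; have [Dsx sx] := st _ Dx; have [Dxx xx] := DD _ _ Dx Dsx.
  have [DZx Zx] := DZ 2^-1 _ Dxx.
  have hs : star (2^-1 *: (x + star x)) = 2^-1 *: (x + star x).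
    by rewrite star_scale ?rpredV ?rpred_nat // starD starK addrC.
  rewrite -lecR sym_normE (le_trans _ (bnd _ DZx hs)) //.
  by rewrite Zx xx sx ReJ_add mulrC; exact: lexx.
move=> G H t lG lH Gp Hp t01 E x Dx.
have [G1 H1] : G sone = 1 /\ H sone = 1.
  by apply: real_state_combination t01 Gp Hp _; rewrite -E // chi1.
have SG := complexify_state lG Gp G1; have SH := complexify_state lH Hp H1.
suff : complexify G x = chi x by move=> <-.
pose d := x - chi x *: sone.
have [Dd d0] : D d /\ chi d = 0.
  have [DZ1 Z1] := DZ (- chi x) _ D1; have [] := DD _ _ Dx DZ1.
  by rewrite Z1 chi1 mulr1 subrr scaleNr.
have [Dsd sd] := st _ Dd; have [Ddd dd] := mul _ _ Dsd Dd.
have := E _ Ddd; rewrite dd d0 mulr0 /= => e0.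
have gp := state_ge0 SG d; have hp := state_ge0 SH d.
have gr : G (star d ** d) = 0.
  move: gp hp; rewrite !lecE /= => /andP[_ gp] /andP[_ hp].
  by case/andP: t01 => t0 t1; nra.
have g0 : complexify G (star d ** d) = 0.
  move: gp; rewrite lecE => /andP[/eqP im _]; move: im.
  by rewrite /complexify gr /= => ->.
have := state_cauchy_schwarz SG d; rewrite g0.
move=> le0; have : `|complexify G d| ^+ 2 == 0 by rewrite eq_le le0 exprn_ge0.
rewrite sqrf_eq0 normr_eq0 => /eqP.
by rewrite stateB // stateZ // state1 // mulr1 => /subr0_eq.
Qed.

Theorem character_extremal_state (D : set A) chi : partial_character D chi ->
  exists2 F, extremal_state F & forall x, D x -> F x = chi x.
Proof.
move=> pc; have [[D1 chi1] lin _ _ _] := pc.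
have [f [lf fp fD fext]] := extremal_hahn_banach sym_normD sym_normZ (character_extremal pc).
have f1 : f sone = 1 by rewrite fD // chi1.
exists (complexify f); first exact: complexify_extremal.
move=> x Dx; have D0 : D 0 by have [] := lin (-1) _ _ D1 D1; rewrite scaleN1r addNr.
have chi0 : chi 0 = 0.
  have [_] := lin 1 _ _ D0 D0; rewrite scale1r !addr0 mul1r => /eqP.
  by rewrite addrC -subr_eq subrr eq_sym => /eqP.
have [Dix ix] := lin 'i%C _ _ Dx D0; rewrite !addr0 chi0 addr0 in Dix ix.
rewrite /complexify !fD // ix; case: (chi x) => u w /=.
by congr Complex; ring.
Qed.

Lemma norm_one : sone != 0 :> A -> `|sone : A| = 1.
Proof.
move=> s0; have := cstar_identity (sone : A); rewrite star_one smul1 expr2.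
move/eqP; rewrite -[X in X == _]mulr1 (inj_eq (mulfI _)) ?normr_eq0 // eq_sym.
by move/eqP.
Qed.

(** The direction [v] is added to the scalars before any other, with the largest admissible value.
    That value is at least [|v|] once [|v| + Re z <= sym_norm (v + z)] for all scalars [z], that is,
    once [|v + r| >= |v| + r] for all real [r]. *)
Theorem exists_extremal_state v : pos v -> v != 0 ->
  exists2 F, extremal_state F & `|v| <= F v.
Proof.
move=> pv v0; have s0 : sone != 0 :> A.
  by apply: contra v0 => /eqP e; rewrite -[v]smul1 e smul0l.
pose D : set A := [set z *: sone | z in [set: C]].
pose chi x : C := xget 0 [set z | x = z *: sone].
have chiE z : chi (z *: sone) = z.
  rewrite /chi; case: xgetP => [z' _ /= /eqP|/(_ z) []//].
  by rewrite -subr_eq0 -scalerBl scaler_eq0 (negbTE s0) orbF subr_eq0 => /eqP.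
have pc : partial_character D chi.
  split.
  - by split; [exists 1; rewrite // scale1r | rewrite -[sone]scale1r chiE].
  - move=> c _ _ [z _ <-] [w _ <-]; rewrite scalerA -scalerDl !chiE; split=> //.
    by exists (c * z + w).
  - move=> _ _ [z _ <-] [w _ <-]; rewrite smulZl smulZr smul1 scalerA !chiE.
    by split=> //; exists (z * w).
  - move=> _ [z _ <-]; rewrite starZ star_one !chiE; split=> //.
    by exists z^*.
  move=> _ [z _ <-]; rewrite starZ star_one => /eqP.
  rewrite -subr_eq0 -scalerBl scaler_eq0 (negbTE s0) orbF subr_eq0 => /eqP zr.
  by rewrite chiE normrZ norm_one // mulr1 real_ler_norm //; apply/CrealP.
have pe := character_extremal pc.
have [D' [f' [pe' DD' ff' D'v f'v]]] := extend_extremal sym_normD sym_normZ v pe.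
have [f [lf fp fD fext]] := extremal_hahn_banach sym_normD sym_normZ pe'.
have D1 : D sone by exists 1; rewrite // scale1r.
have f1 : f sone = 1.
  by rewrite fD ?ff' //; [rewrite -[sone]scale1r chiE | apply: DD'].
have SF := complexify_state lf fp f1.
exists (complexify f); first exact: complexify_extremal.
have fr : complexify f v = (f v)%:C%C.
  by apply/ReC/ger0_real; apply: state_pos.
rewrite fr normRe lecR fD //; apply: f'v => _ [z _ <-]; rewrite chiE.
rewrite lerBrDr -lecR rmorphD /= -normRe sym_normE.
have -> : 2^-1 *: (v + z *: sone + star (v + z *: sone)) =
    v + (complex.Re z)%:C%C *: sone.
  rewrite starD starZ star_one (pos_star pv) ReJ_add.
  rewrite -[(z^*)%C]/(z^* ) (_ : _ + _ = 2 *: v + (z + z^* ) *: sone); last by lmod.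
  by rewrite scalerDr !scalerA mulVf ?pnatr_eq0 // scale1r [_ / 2]mulrC.
set r : C := _%:C%C; have rr : r \is Num.real by apply/complex_realP; exists (complex.Re z).
have hs : star (v + r *: sone) = v + r *: sone.
  by rewrite starD star_scale ?star_one // (pos_star pv).
(* From [v + r <= T] follows [v <= T - r], so [|v| <= T - r] by [pos_le_norm]; a negative [T - r]
   would force [v = 0]. *)
have := pos_bound hs (lexx _); set T := `|_ + _|.
rewrite (_ : _ - _ = (T - r) *: sone - v); last by lmod.
have Tr : T - r \is Num.real by apply: rpredB => //; exact: normr_real.
have [tn|tp] := real_ltP Tr (rpred0 _) => ptq.
  by rewrite (pos_not_scalar_neg tn pv ptq) eqxx in v0.
by rewrite -lerBrDr; apply: pos_le_norm.
Qed.

End States.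

(** * Hilbert spaces and the GNS representation *)

Section ComplexLimits.
Context (R : realType).
Local Notation C := R[i].

Lemma normc_i : `|'i%C : C| = 1.
Proof. by rewrite normc_def /= expr0n expr1n add0r sqrtr1. Qed.

Lemma normc_ge_Im (z : C) : `|complex.Im z|%:C%C <= `|z|.
Proof.
rewrite -normrN -ReiNIm (le_trans (normc_ge_Re _)) // normrM.
by rewrite normc_i mulr1.
Qed.

Lemma normc_le_ReIm (z : C) :
  `|z| <= `|complex.Re z|%:C%C + `|complex.Im z|%:C%C.
Proof.
rewrite {1}[z]complexE (le_trans (ler_normD _ _)) // normrM.
rewrite normc_i mul1r.
by rewrite !normc_def /= !expr0n !addr0 !sqrtr_sqr.
Qed.

(** The intervals of radius [2 M / 2^n] around [u n] are nested, and the supremum of their left ends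
    lies in all of them. *)
Lemma real_fast_limit (u : nat -> R) (M : R) : 0 <= M ->
  (forall n, `|u n.+1 - u n| <= M * 2^-1 ^+ n) ->
  exists l, forall n, `|u n - l| <= M * 2 * 2^-1 ^+ n.
Proof.
move=> M0 uM; pose a n := u n - M * 2 * 2^-1 ^+ n.
pose b n := u n + M * 2 * 2^-1 ^+ n.
have p0 n : 0 <= 2^-1 ^+ n :> R by rewrite exprn_ge0 // invr_ge0.
have aS n : a n <= a n.+1.
  by have := uM n; rewrite /a exprS ler_norml => /andP[h _]; lra.
have bS n : b n.+1 <= b n.
  by have := uM n; rewrite /b exprS ler_norml => /andP[_ h]; lra.
have ab n m : a n <= b m.
  have ab' k : a k <= b k.
    by rewrite /a /b; have := mulr_ge0 (mulr_ge0 M0 (ler0n _ 2)) (p0 k); lra.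
  have [nm|/ltnW mn] := leqP n m.
    by apply: le_trans (ab' m); apply: (homo_leq (@lexx _ _) le_trans aS).
  apply: le_trans (ab' n) _.
  by apply: (homo_leq (r := fun x y => y <= x)) mn => // x y z yx xz; exact: le_trans xz yx.
have hs : has_sup (range a).
  by split; [exists (a 0%N), 0%N | exists (b 0%N) => _ [n _ <-]].
exists (sup (range a)) => n.
have h1 : a n <= sup (range a) by apply: sup_upper_bound => //; exists n.
have h2 : sup (range a) <= b n.
  by apply: sup_le_ub; [case: hs | move=> _ [m _ <-]].
by move: h1 h2; rewrite ler_norml /a /b => h1 h2; apply/andP; split; lra.
Qed.

Lemma complex_fast_limit (u : nat -> C) (M : C) : 0 <= M ->
  (forall n, `|u n.+1 - u n| <= M * 2^-1 ^+ n) ->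
  exists l, forall n, `|u n - l| <= M * 4 * 2^-1 ^+ n.
Proof.
move=> M0; have ME : M = (complex.Re M)%:C%C by apply/ReC/ger0_real.
move: (complex.Re M) ME => m ME; rewrite ME lecR in M0 * => uM.
have pE n : 2^-1 ^+ n = (2^-1 ^+ n)%:C%C :> C.
  by rewrite rmorphXn /= fmorphV rmorph_nat.
have [||l Hl] := @real_fast_limit (fun n => complex.Re (u n)) m => // [n|].
  rewrite -lecR rmorphM /= -pE (le_trans _ (uM n)) // (le_trans _ (normc_ge_Re _)) //.
  by case: (u n.+1) (u n) => ? ? [].
have [||k Hk] := @real_fast_limit (fun n => complex.Im (u n)) m => // [n|].
  rewrite -lecR rmorphM /= -pE (le_trans _ (uM n)) // (le_trans _ (normc_ge_Im _)) //.
  by case: (u n.+1) (u n) => ? ? [].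
exists (Complex l k) => n; rewrite (le_trans (normc_le_ReIm _)) //.
rewrite pE -(rmorph_nat (real_complex R) 4) -!rmorphM /= -rmorphD lecR /=.
have -> : m * 4 * 2^-1 ^+ n = m * 2 * 2^-1 ^+ n + m * 2 * 2^-1 ^+ n by ring.
apply: lerD; [move: (Hl n) | move: (Hk n)]; by case: (u n).
Qed.

Lemma ge0_approx (z : C) :
  (forall e : C, 0 < e -> exists2 w, 0 <= w & `|z - w| <= e) -> 0 <= z.
Proof.
move=> Hz; have Hr (e : R) : 0 < e -> - e <= complex.Re z /\ `|complex.Im z| <= e.
  move=> e0; have [|w w0 zw] := Hz e%:C%C; first by rewrite ltcR.
  have := le_trans (normc_ge_Re _) zw; have := le_trans (normc_ge_Im _) zw.
  move: w0; rewrite !lecR lecE => /andP[/eqP wi wr].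
  case: z w wi wr {Hz zw} => a b [c d] /= -> c0; rewrite oppr0 addr0 => -> .
  by rewrite ler_norml => /andP[h _]; split=> //; lra.
rewrite lecE /=; apply/andP; split.
  rewrite -normr_le0; apply/ler_addgt0Pl => e /Hr[_]; by rewrite addr0.
by apply/ler_addgt0Pl => e /Hr[h _]; lra.
Qed.

End ComplexLimits.

Section SemiInnerProduct.
Context (R : realType) (V : lmodType R[i]).
Implicit Types (x y z a b v : V).
Local Notation C := R[i].

(** Degenerate forms are allowed, since the form that a state defines on [A] may have null
    vectors. *)
Record semidot := SemiDot {
  sform :> V -> V -> C;
  semidot_linear : forall (c : C) x y z,
    sform (c *: x + y) z = c * sform x z + sform y z;
  semidot_conj : forall x y, sform x y = (sform y x)^*;
  semidot_ge0 : forall x, 0 <= sform x x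
}.

Context (s : semidot).

Lemma semidotDl x y z : s (x + y) z = s x z + s y z.
Proof. by rewrite -{1}[x]scale1r semidot_linear mul1r. Qed.

Lemma semidot0l z : s 0 z = 0.
Proof. by apply: (addrI (s 0 z)); rewrite -semidotDl !addr0. Qed.

Lemma semidotZl (c : C) x z : s (c *: x) z = c * s x z.
Proof. by rewrite -[c *: x]addr0 semidot_linear semidot0l addr0. Qed.

Lemma semidotNl x z : s (- x) z = - s x z.
Proof. by rewrite -scaleN1r semidotZl mulN1r. Qed.

Lemma semidotBl x y z : s (x - y) z = s x z - s y z.
Proof. by rewrite semidotDl semidotNl. Qed.

Lemma semidotDr x y z : s x (y + z) = s x y + s x z.
Proof. by rewrite semidot_conj semidotDl rmorphD /= -!semidot_conj. Qed.

Lemma semidotZr (c : C) x z : s x (c *: z) = c^* * s x z.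
Proof. by rewrite semidot_conj semidotZl rmorphM /= -semidot_conj. Qed.

Lemma semidotNr x z : s x (- z) = - s x z.
Proof. by rewrite semidot_conj semidotNl rmorphN /= -semidot_conj. Qed.

Lemma semidotBr x y z : s x (y - z) = s x y - s x z.
Proof. by rewrite semidotDr semidotNr. Qed.

Lemma semidot0r z : s z 0 = 0.
Proof. by rewrite semidot_conj semidot0l rmorph0. Qed.

Definition seminorm x : C := sqrtC (s x x).

Lemma seminorm_ge0 x : 0 <= seminorm x.
Proof. by rewrite sqrtC_ge0 semidot_ge0. Qed.

Lemma sqr_seminorm x : seminorm x ^+ 2 = s x x.
Proof. exact: sqrtCK. Qed.

(** Expand the form at [x - t <x, y> y] for [t >= 0]. The choice [t = 1 / <y, y>] concludes; if
    [<y, y> = 0], letting [t] grow forces [<x, y> = 0]. *)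
Lemma cauchy_schwarz_sqr x y : `|s x y| ^+ 2 <= s x x * s y y.
Proof.
have key t : 0 <= t -> 2 * t * `|s x y| ^+ 2 <= s x x + t ^+ 2 * `|s x y| ^+ 2 * s y y.
  move=> t0; have := semidot_ge0 s (x - (t * s x y) *: y).
  rewrite semidotBl !semidotBr !semidotZl !semidotZr rmorphM /= (CrealP (ger0_real t0)).
  rewrite (semidot_conj s y x) normCK => h.
  by rewrite -subr_ge0; apply: le_trans h _; rewrite le_eqVlt; apply/orP; left; apply/eqP; ring.
have [y0|y0] := eqVneq (s y y) 0.
  rewrite y0 mulr0; apply: contraT => nz.
  have p0 : 0 < `|s x y| ^+ 2.
    by rewrite lt_def exprn_ge0 // andbT; apply: contra nz => /eqP ->.
  have [n Hn] := complex_arch (semidot_ge0 s x) p0.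
  have := key n%:R (ler0n _ _); rewrite y0 mulr0 addr0 => h.
  have := le_lt_trans h Hn; rewrite ltr_pM2r // -subr_gt0.
  rewrite (_ : n%:R - _ = - n%:R); last by ring.
  by rewrite oppr_gt0 ltrn0.
have p0 : 0 < s y y by rewrite lt_def y0 semidot_ge0.
have := key (s y y)^-1; rewrite invr_ge0 semidot_ge0 => /(_ isT).
rewrite [_ ^+ 2 * _ * _]mulrAC expr2 -(mulrA _ _ (s y y)) mulVf // mulr1.
rewrite [2 * _]mulr_natl mulr2n mulrDl lerD2r mulrC.
by rewrite ler_pdivrMr.
Qed.

Lemma cauchy_schwarz x y : `|s x y| <= seminorm x * seminorm y.
Proof.
rewrite -(ler_pXn2r (n := 2)) ?nnegrE ?mulr_ge0 ?seminorm_ge0 //.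
by rewrite exprMn !sqr_seminorm cauchy_schwarz_sqr.
Qed.

Lemma seminormD x y : seminorm (x + y) <= seminorm x + seminorm y.
Proof.
rewrite -(ler_pXn2r (n := 2)) ?nnegrE ?addr_ge0 ?seminorm_ge0 //.
rewrite sqrrD !sqr_seminorm semidotDl !semidotDr !addrA lerD2r -!addrA lerD2l.
rewrite (semidot_conj s y x) -mulr2n -[leRHS]mulr_natl.
have -> : s x y + (s x y)^* = 2 * (complex.Re (s x y))%:C%C.
  by rewrite ReJ_add mulrC divfK ?pnatr_eq0.
rewrite ler_pM2l // (le_trans _ (cauchy_schwarz _ _)) //.
by rewrite (le_trans _ (normc_ge_Re _)) // lecR ler_norm.
Qed.

Lemma seminormZ (c : C) x : seminorm (c *: x) = `|c| * seminorm x.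
Proof.
rewrite /seminorm semidotZl semidotZr mulrA -normCK rootCMl ?exprn_ge0 //.
by rewrite exprCK.
Qed.

End SemiInnerProduct.

(* The completion is realised by the functionals that are limits, in the dual
   norm, of the functionals s a: this avoids quotients and Cauchy sequences. *)
Section Completion.
Context (R : realType) (V : lmodType R[i]) (s : semidot V).
Implicit Types (x y z a b u v : V) (phi psi : V -> R[i]).
Local Notation C := R[i].
Local Notation sn := (seminorm s).

Definition dual_approx phi v (d : C) := forall b, `|phi b - s v b| <= d * sn b.

Definition dual_bound phi (M : C) := 0 <= M /\ forall b, `|phi b| <= M * sn b.

Definition completion_set : set (V -> C) :=
  [set phi | forall d : C, 0 < d -> exists v, dual_approx phi v d].

Definition completion_pred : {pred V -> C} := mem completion_set.

Lemma approx_emb v d : 0 <= d -> dual_approx (s v) v d.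
Proof. by move=> d0 b; rewrite subrr normr0 mulr_ge0 ?seminorm_ge0. Qed.

Lemma approxD c phi psi u v d e : dual_approx phi u d -> dual_approx psi v e ->
  dual_approx (c *: phi + psi) (c *: u + v) (`|c| * d + e).
Proof.
move=> pu qv b; rewrite semidot_linear -[(_ + _) b]/(c * phi b + psi b).
rewrite (_ : _ - _ = c * (phi b - s u b) + (psi b - s v b)); last by ring.
rewrite (le_trans (ler_normD _ _)) // mulrDl lerD // normrM -mulrA.
by rewrite ler_wpM2l.
Qed.

Lemma approx_dist phi u v d e : 0 <= d -> 0 <= e ->
  dual_approx phi u d -> dual_approx phi v e -> sn (u - v) <= d + e.
Proof.
move=> d0 e0 pu pv; have H b : `|s (u - v) b| <= (d + e) * sn b.
  rewrite semidotBl (_ : _ - _ = (phi b - s v b) - (phi b - s u b)); last by ring.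
  by rewrite (le_trans (ler_normB _ _)) // addrC mulrDl lerD.
have := H (u - v); rewrite ger0_norm ?semidot_ge0 // -sqr_seminorm expr2.
have [->|n0] := eqVneq (sn (u - v)) 0; first by rewrite addr_ge0.
by rewrite ler_pM2r // lt_def n0 seminorm_ge0.
Qed.

Lemma completion_submod : submod_closed completion_pred.
Proof.
split=> [|c phi psi]; rewrite !inE.
  move=> d d0; exists 0 => b; rewrite semidot0l subrr normr0.
  by rewrite mulr_ge0 ?seminorm_ge0 // ltW.
move=> Hphi Hpsi d d0; have c1 : 0 < `|c| + 1 by rewrite ltr_wpDl.
pose e := d / (`|c| + 1); have e0 : 0 < e by rewrite divr_gt0.
have [u pu] := Hphi _ e0; have [v pv] := Hpsi _ e0.
exists (c *: u + v) => b; rewrite (le_trans (approxD c pu pv b)) //.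
rewrite ler_wpM2r ?seminorm_ge0 // -{2}(mul1r e) -mulrDl /e.
by rewrite mulrC divfK // gt_eqF.
Qed.

Definition completion : Type := set_type completion_set.
HB.instance Definition _ := SubChoice.copy completion (set_type completion_set).
HB.instance Definition _ := @GRing.SubChoice_isSubLmodule.Build R[i] (V -> C)
  completion_pred completion completion_submod.

Implicit Types (f g h : completion).

Definition cfun f : V -> C := val f.

Lemma completionP f (d : C) : 0 < d -> exists v, dual_approx (cfun f) v d.
Proof. by move: d; exact: (set_mem (valP f)). Qed.

Definition to_completion phi (H : completion_set phi) : completion :=
  SigSub (mem_set H).

Lemma emb_subproof v : completion_set (s v).
Proof. by move=> d d0; exists v; apply: approx_emb; exact: ltW. Qed.

Definition emb v : completion := to_completion (emb_subproof v).

Lemma completion_ext f g : (forall b, cfun f b = cfun g b) -> f = g.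
Proof. by move=> fg; apply: val_inj; apply/funext. Qed.

Lemma emb_linear (c : C) x y : emb (c *: x + y) = c *: emb x + emb y.
Proof. by apply: completion_ext => b; rewrite /cfun /= semidot_linear. Qed.

Lemma dual_bound_ex f : exists M, dual_bound (cfun f) M.
Proof.
have [v fv] := completionP f ltr01; exists (1 + sn v).
split=> [|b]; first by rewrite addr_ge0 ?seminorm_ge0.
rewrite -[cfun f b](subrK (s v b)) (le_trans (ler_normD _ _)) // mulrDl.
by rewrite lerD // cauchy_schwarz.
Qed.

Lemma eq_approx (z w : C) : (forall e : C, 0 < e -> `|z - w| <= e) -> z = w.
Proof.
move=> H; apply/eqP; rewrite -subr_eq0 -normr_le0; apply/ler_addgt0Pr => e e0.
by rewrite add0r H.
Qed.

Lemma eq_approxM (M z w : C) : 0 <= M ->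
  (forall e : C, 0 < e -> `|z - w| <= M * e) -> z = w.
Proof.
move=> M0 H; apply: eq_approx => e e0; have M1 : 0 < M + 1 by rewrite ltr_wpDl.
have := H (e / (M + 1)); rewrite divr_gt0 // => /(_ isT)/le_trans; apply.
by rewrite mulrCA ler_piMr ?(ltW e0) // ler_pdivrMr // mul1r lerDl.
Qed.

Lemma cfunB f x y : cfun f (x - y) = cfun f x - cfun f y.
Proof.
apply: (@eq_approxM (sn (x - y) + sn x + sn y)) => [|d d0].
  by rewrite !addr_ge0 ?seminorm_ge0.
have [v fv] := completionP f d0.
have -> : cfun f (x - y) - (cfun f x - cfun f y) =
   (cfun f (x - y) - s v (x - y)) - (cfun f x - s v x) + (cfun f y - s v y).
  by rewrite semidotBr; ring.
rewrite mulrC !mulrDr (le_trans (ler_normD _ _)) // lerD //.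
by rewrite (le_trans (ler_normB _ _)) // lerD.
Qed.

(** The inner product is the limit of [f] along vectors whose functionals approximate [g]. The
    explicit rate characterises the limit and makes it independent of the sequence. *)
Lemma cdot_ex f g : exists z : C, forall M v d, dual_bound (cfun f) M -> 0 <= d ->
  dual_approx (cfun g) v d -> `|cfun f v - z| <= M * d.
Proof.
have p0 n : 0 < 2^-1 ^+ n :> C by rewrite exprn_gt0 // invr_gt0.
have /choice[v Hv] : forall n, exists v, dual_approx (cfun g) v (2^-1 ^+ n).
  by move=> n; exact: completionP.
have D M u d : dual_bound (cfun f) M -> 0 <= d -> dual_approx (cfun g) u d ->
    forall n, `|cfun f u - cfun f (v n)| <= M * (d + 2^-1 ^+ n).
  move=> [M0 fM] d0 gu n; rewrite -cfunB (le_trans (fM _)) // ler_wpM2l //.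
  by apply: approx_dist gu (Hv n) => //; exact: ltW.
have [M0 fM0] := dual_bound_ex f.
have [||z Hz] := @complex_fast_limit R (fun n => cfun f (v n)) (M0 * 2).
- by rewrite mulr_ge0 //; case: fM0.
- move=> n; rewrite (le_trans (D _ _ _ fM0 (ltW (p0 n.+1)) (Hv _) n)) //.
  rewrite -mulrA ler_wpM2l //; first by case: fM0.
  have -> : 2 * 2^-1 ^+ n = 2^-1 ^+ n + 2^-1 ^+ n :> C by ring.
  rewrite lerD2r exprS ler_piMl ?(ltW (p0 n)) //.
  by rewrite invf_le1 ?ler1n.
exists z => M u d fM d0 gu; apply/ler_addgt0Pr => e e0.
have K0 : 0 <= M + M0 * 2 * 4.
  by case: fM => ? _; case: fM0 => ? _; rewrite addr_ge0 // !mulr_ge0.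
have [N HN] := exp_half_small K0 e0.
rewrite (_ : _ - z = (cfun f u - cfun f (v N)) + (cfun f (v N) - z)); last by ring.
rewrite (le_trans (ler_normD _ _)) // (le_trans (lerD (D _ _ _ fM d0 gu N) (Hz N))) //.
by rewrite mulrDr -addrA lerD2l -mulrDl ltW // HN.
Qed.

Definition cdot f g : C := projT1 (cid (cdot_ex f g)).

Lemma cdotP f g M v d : dual_bound (cfun f) M -> 0 <= d ->
  dual_approx (cfun g) v d -> `|cfun f v - cdot f g| <= M * d.
Proof. by rewrite /cdot; case: cid => z /= Hz; exact: Hz. Qed.

Lemma cdot_emb f v : cdot f (emb v) = cfun f v.
Proof.
have [M fM] := dual_bound_ex f; apply/esym/eqP; rewrite -subr_eq0 -normr_le0.
rewrite -(mulr0 M); apply: cdotP => //; exact: approx_emb.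
Qed.

Lemma cdot_linear (c : C) f g h : cdot (c *: f + g) h = c * cdot f h + cdot g h.
Proof.
have [M fM] := dual_bound_ex f; have [N gN] := dual_bound_ex g.
have fgMN : dual_bound (cfun (c *: f + g)) (`|c| * M + N).
  case: fM gN => M0 fM [N0 gN]; split=> [|b]; first by rewrite addr_ge0 // mulr_ge0.
  rewrite (le_trans (ler_normD _ _)) // mulrDl lerD // normrM -mulrA.
  by rewrite ler_wpM2l.
apply: (@eq_approxM (`|c| * M + N + (`|c| * M + N))) => [|d d0].
  by case: fgMN => ? _; rewrite addr_ge0.
have [v hv] := completionP h d0; have d0' := ltW d0.
have := cdotP fgMN d0' hv; have := cdotP fM d0' hv; have := cdotP gN d0' hv.
have -> : cfun (c *: f + g) v = c * cfun f v + cfun g v by [].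
move: (cfun f v) (cfun g v) (cdot f h) (cdot g h) (cdot (c *: f + g) h) => p q z w y h1 h2 h3.
rewrite (_ : y - _ = - (c * p + q - y) + (c * (p - z) + (q - w))); last by ring.
rewrite (le_trans (ler_normD _ _)) // normrN mulrDl lerD //.
rewrite (le_trans (ler_normD _ _)) // mulrDl lerD // normrM -mulrA.
by rewrite ler_wpM2l.
Qed.

Lemma approx_seminorm f M v d : dual_bound (cfun f) M -> 0 <= d ->
  dual_approx (cfun f) v d -> sn v <= M + d.
Proof.
move=> [M0 fM] d0 fv; have : `|s v v| <= (M + d) * sn v.
  rewrite -[s v v](subrK (cfun f v)) (le_trans (ler_normD _ _)) // addrC.
  by rewrite mulrDl lerD // distrC.
rewrite ger0_norm ?semidot_ge0 // -sqr_seminorm expr2.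
have [->|n0] := eqVneq (sn v) 0; first by rewrite addr_ge0.
by rewrite ler_pM2r // lt_def n0 seminorm_ge0.
Qed.

Lemma cdot_approx f g M N u v d : dual_bound (cfun f) M -> dual_bound (cfun g) N ->
  0 <= d -> dual_approx (cfun f) u d -> dual_approx (cfun g) v d ->
  `|cdot f g - s u v| <= (M + N + d) * d.
Proof.
move=> fM gN d0 fu gv.
rewrite (_ : _ - _ = - (cfun f v - cdot f g) + (cfun f v - s u v)); last by ring.
rewrite (le_trans (ler_normD _ _)) // normrN -addrA mulrDl lerD //.
  exact: cdotP.
rewrite (le_trans (fu v)) // mulrC ler_wpM2r //.
exact: approx_seminorm gv.
Qed.

Lemma cdot_conj f g : cdot f g = (cdot g f)^*.
Proof.
have [M fM] := dual_bound_ex f; have [N gN] := dual_bound_ex g.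
have M0 := fM.1; have N0 := gN.1.
apply: (@eq_approxM ((M + N + 1) + (N + M + 1))) => [|e e0].
  by rewrite !addr_ge0.
pose d := e / (1 + e); have e1 : 0 < 1 + e by rewrite ltr_pwDl // ltW.
have d0 : 0 < d by rewrite divr_gt0.
have d1 : d <= 1 by rewrite ler_pdivrMr // mul1r lerDr.
have de : d <= e by rewrite ler_pdivrMr // ler_peMr ?lerDl // ltW.
have [u fu] := completionP f d0; have [v gv] := completionP g d0.
have h1 := cdot_approx fM gN (ltW d0) fu gv.
have h2 := cdot_approx gN fM (ltW d0) gv fu.
rewrite (_ : _ - _ = (cdot f g - s u v) - (cdot g f - s v u)^* ); last first.
  by rewrite rmorphB /= -semidot_conj; ring.
rewrite (le_trans (ler_normB _ _)) // norm_conjC mulrDl lerD //.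
  rewrite (le_trans h1) // ler_pM ?lerD2l // ?(ltW d0) //.
  by rewrite !addr_ge0 ?(ltW d0).
rewrite (le_trans h2) // ler_pM ?lerD2l // ?(ltW d0) //.
by rewrite !addr_ge0 ?(ltW d0).
Qed.

Lemma cdot_ge0 f : 0 <= cdot f f.
Proof.
have [M fM] := dual_bound_ex f; have M0 := fM.1.
apply: ge0_approx => e e0; have K0 : 0 < M + M + 1 by rewrite ltr_wpDl // addr_ge0.
pose d := e / (M + M + 1 + e).
have e1 : 0 < M + M + 1 + e by rewrite addr_gt0.
have d0 : 0 < d by rewrite divr_gt0.
have d1 : d <= 1 by rewrite ler_pdivrMr // mul1r lerDr ltW.
have [u fu] := completionP f d0; exists (s u u); first exact: semidot_ge0.
rewrite (le_trans (cdot_approx fM fM (ltW d0) fu fu)) //.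
rewrite (le_trans (_ : _ <= (M + M + 1) * d)) //.
  by rewrite ler_wpM2r ?(ltW d0) // lerD2l.
by rewrite /d mulrCA ler_piMr ?(ltW e0) // ler_pdivrMr // mul1r lerDl ltW.
Qed.

Definition completion_semidot : semidot completion :=
  SemiDot cdot_linear cdot_conj cdot_ge0.

Definition completion_norm f : C := seminorm completion_semidot f.
Local Notation cnorm := completion_norm.

Lemma completion_norm_emb v : cnorm (emb v) = sn v.
Proof. by rewrite /cnorm /seminorm /= cdot_emb. Qed.

Lemma cfun_le_norm f b : `|cfun f b| <= cnorm f * sn b.
Proof.
rewrite -cdot_emb -completion_norm_emb.
exact: (cauchy_schwarz completion_semidot f (emb b)).
Qed.

(** Together with [cfun_le_norm] this identifies the Hilbert norm with the dual norm, so that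
    pointwise bounds on functionals become norm bounds. *)
Lemma completion_norm_le f M : dual_bound (cfun f) M -> cnorm f <= M.
Proof.
move=> fM; have M0 := fM.1.
rewrite -(ler_pXn2r (n := 2)) ?nnegrE ?seminorm_ge0 // sqr_seminorm /=.
apply/ler_addgt0Pr => e e0; have K0 : 0 < M + M + 1 by rewrite ltr_wpDl // addr_ge0.
pose d := e / (M + M + 1); have d0 : 0 < d by rewrite divr_gt0.
have [v fv] := completionP f d0.
have h1 := cdotP fM (ltW d0) fv; have h2 := fM.2 v.
have h3 := approx_seminorm fM (ltW d0) fv.
rewrite -[cdot f f]ger0_norm ?cdot_ge0 //.
rewrite -[cdot f f](subrK (cfun f v)) (le_trans (ler_normD _ _)) // distrC.
rewrite (le_trans (lerD h1 (le_trans h2 (ler_wpM2l M0 h3)))) //.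
rewrite mulrDr addrCA -expr2 lerD2l -mulrDl /d mulrCA ler_piMr ?(ltW e0) //.
by rewrite ler_pdivrMr // mul1r lerDl.
Qed.

Lemma completion_norm0_eq0 f : cnorm f = 0 -> f = 0.
Proof.
move=> f0; apply: completion_ext => b; have := cfun_le_norm f b.
by rewrite f0 mul0r normr_le0 => /eqP ->.
Qed.

HB.instance Definition _ := @Lmodule_isNormed.Build R[i] completion cnorm
  (seminormD completion_semidot) (seminormZ completion_semidot) completion_norm0_eq0.

Lemma norm_emb v : `|emb v| = sn v.
Proof. exact: completion_norm_emb. Qed.

Lemma emb_dense f (e : C) : 0 < e -> exists v, `|f - emb v| < e.
Proof.
move=> e0; have [|v fv] := completionP f (_ : 0 < e / 2); first by rewrite divr_gt0.
exists v; rewrite (@le_lt_trans _ _ (e / 2)) //; last first.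
  by rewrite ltr_pdivrMr // ltr_pMr // ltr1n.
apply: completion_norm_le; split=> //.
by rewrite divr_ge0 // ltW.
Qed.

Lemma completion_complete (F : set_system completion) :
  ProperFilter F -> cauchy F -> cvg F.
Proof.
apply: fast_complete => u Hu.
have ub n b : `|cfun (u n.+1) b - cfun (u n) b| <= sn b * 2^-1 ^+ n.
  rewrite mulrC (le_trans (cfun_le_norm (u n.+1 - u n) b)) //.
  by rewrite ler_wpM2r ?seminorm_ge0 // Hu.
(* The pointwise limits come with a rate proportional to [sn b], which is what places the limit
   functional in the completion. *)
have /choice[phi Hphi] b := complex_fast_limit (seminorm_ge0 s b) (ub ^~ b).
have Hphi' n b : `|cfun (u n) b - phi b| <= 4 * 2^-1 ^+ n * sn b.
  by rewrite (le_trans (Hphi b n)) // [leRHS]mulrC mulrA.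
have p0 n : 0 <= 4 * 2^-1 ^+ n :> C by rewrite mulr_ge0 // exprn_ge0 // invr_ge0.
have Cphi : completion_set phi.
  move=> d d0; have d2 : 0 < d / 2 by rewrite divr_gt0.
  have [N HN] := exp_half_small (ler0n C 4) d2.
  have [v uv] := completionP (u N) d2; exists v => b.
  rewrite (_ : _ - _ = (cfun (u N) b - s v b) - (cfun (u N) b - phi b)); last by ring.
  rewrite (le_trans (ler_normB _ _)) // [d]splitr mulrDl lerD //.
  by rewrite (le_trans (Hphi' N b)) // ler_wpM2r ?seminorm_ge0 // ltW // HN.
exists (to_completion Cphi) => e e0.
have [N HN] := exp_half_small (ler0n C 4) e0.
exists N => n Nn; apply: le_lt_trans (HN n Nn).
by apply: completion_norm_le; split; [exact: p0 | exact: Hphi'].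
Qed.
HB.instance Definition _ := Uniform_isComplete.Build completion completion_complete.

Lemma cdot_bilinear : bilinear_for ( *%R : C -> C -> C) (Num.conj \; *%R) cdot.
Proof.
split=> [g c f h|f c g h] /=; first exact: cdot_linear.
by rewrite cdot_conj cdot_linear rmorphD rmorphM /= -!cdot_conj.
Qed.
HB.instance Definition _ := @bilinear_isBilinear.Build C completion completion C
  *%R (Num.conj \; *%R) cdot cdot_bilinear.

Lemma cdot_hermitian f g : cdot f g = (-1) ^+ false * (cdot g f)^*.
Proof. by rewrite expr0 mul1r -cdot_conj. Qed.
HB.instance Definition _ := @isHermitianSesquilinear.Build C completion false
  Num.conj cdot cdot_hermitian.

Lemma cdot_gt0 f : f != 0 -> 0 < cdot f f.
Proof.
move=> f0; rewrite lt_def cdot_ge0 andbT; apply: contra f0 => /eqP ff.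
by apply/eqP/completion_norm0_eq0; rewrite /cnorm /seminorm /= ff sqrtC0.
Qed.
HB.instance Definition _ := @isDotProduct.Build C completion cdot cdot_gt0.

Lemma completion_norm_dot f : `|f| ^+ 2 = cdot f f.
Proof. exact: (sqr_seminorm completion_semidot f). Qed.
HB.instance Definition _ := @CompleteNormedModule_isHilbert.Build R completion
  (cdot : {dot completion for Num.conj}) completion_norm_dot.
End Completion.

(** * Orthogonal projection *)

Section HilbertSpaces.
Context (R : realType) (H : hilbertType R).
Implicit Types (u v w x y : H) (W : set H).
Local Notation C := R[i].

Lemma dotp_linear (c : C) x y z :
  dotp (c *: x + y) z = c * dotp x z + dotp y z :> C.
Proof. by rewrite linearPl. Qed.

Lemma dotp_conj x y : dotp x y = (dotp y x)^* :> C.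
Proof. by rewrite hermC expr0 mul1r. Qed.

Lemma dotp_ge0 x : 0 <= dotp x x :> C.
Proof. by rewrite -norm_dotp exprn_ge0. Qed.

Definition hdot : semidot H := SemiDot dotp_linear dotp_conj dotp_ge0.

Lemma hnormE x : seminorm hdot x = `|x|.
Proof. by rewrite /seminorm /= -norm_dotp exprCK. Qed.

Lemma hdotxx x : hdot x x = `|x| ^+ 2.
Proof. by rewrite /= norm_dotp. Qed.

Lemma hdotxx_eq0 x : (hdot x x == 0) = (x == 0).
Proof. by rewrite hdotxx sqrf_eq0 normr_eq0. Qed.

Lemma hdot_le x y : `|hdot x y| <= `|x| * `|y|.
Proof. by rewrite -!hnormE cauchy_schwarz. Qed.

Definition linear_subspace W := W 0 /\ forall (c : C) x y, W x -> W y -> W (c *: x + y).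

Lemma subspaceZ W (c : C) x : linear_subspace W -> W x -> W (c *: x).
Proof. by move=> [W0 lW] Wx; rewrite -[_ *: _]addr0; apply: lW. Qed.

Lemma subspaceD W x y : linear_subspace W -> W x -> W y -> W (x + y).
Proof. by move=> [_ lW] Wx Wy; rewrite -[x]scale1r; apply: lW. Qed.

Lemma subspaceB W x y : linear_subspace W -> W x -> W y -> W (x - y).
Proof. by move=> [_ lW] Wx Wy; rewrite addrC -scaleN1r; apply: lW. Qed.

Lemma parallelogram x y :
  `|x + y| ^+ 2 + `|x - y| ^+ 2 = 2 * (`|x| ^+ 2 + `|y| ^+ 2).
Proof.
rewrite -!hdotxx semidotBl !semidotBr semidotDl !semidotDr; ring.
Qed.

(** Perturbing along [t <g, y> y] with [t > 0] gives [2 |<g, y>|^2 <= t |<g, y>|^2 |y|^2]; let [t]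
    tend to 0. *)
Lemma minimal_orthogonal g y : (forall c : C, `|g| ^+ 2 <= `|g - c *: y| ^+ 2) ->
  hdot g y = 0.
Proof.
move=> gmin; apply/eqP; apply: contraT => z0; set z := hdot g y in z0.
have key (t : C) : 0 < t -> 2 * `|z| ^+ 2 <= t * (`|z| ^+ 2 * `|y| ^+ 2).
  move=> t0; have := gmin (t * z); rewrite -!hdotxx semidotBl !semidotBr.
  rewrite !semidotZl !semidotZr rmorphM /= (CrealP (gtr0_real t0)).
  rewrite -[dotp g y]/(hdot g y) -[dotp y g]/(hdot y g) (semidot_conj hdot y) -/z => h.
  rewrite -(ler_pM2l t0) -subr_ge0.
  move: h; rewrite -subr_ge0 => h; apply: le_trans h _.
  by rewrite normCK le_eqVlt; apply/orP; left; apply/eqP; ring.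
have z2 : 0 < `|z| ^+ 2 by rewrite exprn_gt0 // normr_gt0.
have : 2 * `|z| ^+ 2 <= 0.
  apply/ler_addgt0Pr => e e0; rewrite add0r.
  have K0 : 0 < `|z| ^+ 2 * `|y| ^+ 2 + 1 by rewrite ltr_wpDl // mulr_ge0 // exprn_ge0.
  have := key (e / (`|z| ^+ 2 * `|y| ^+ 2 + 1)); rewrite divr_gt0 // => /(_ isT)/le_trans; apply.
  by rewrite mulrAC -mulrA ler_piMr ?(ltW e0) // ler_pdivrMr // mul1r lerDl.
by rewrite lt_geF // mulr_gt0.
Qed.

Theorem orthogonal_projection W x : closed W -> linear_subspace W ->
  exists2 w, W w & forall y, W y -> hdot (x - w) y = 0.
Proof.
move=> cW sW; have W0 := sW.1.
pose E := [set complex.Re (`|x - w| ^+ 2) | w in W].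
have qE w : (complex.Re (`|x - w| ^+ 2))%:C%C = `|x - w| ^+ 2.
  by apply/esym/ReC; rewrite ger0_real // exprn_ge0.
have hE : has_inf E.
  split; first by exists (complex.Re (`|x - 0| ^+ 2)), 0.
  by exists 0 => _ [w _ <-]; rewrite -lecR qE exprn_ge0.
pose d : C := (inf E)%:C%C.
have dle w : W w -> d <= `|x - w| ^+ 2.
  by move=> Ww; rewrite -qE lecR; apply: ge_inf; [case: hE | exists w].
have p0 n : 0 < 2^-1 ^+ n :> C by rewrite exprn_gt0 // invr_gt0.
(* With this error the parallelogram law bounds [|u (n+1) - u n|^2] by four times [(2^-n)^2 / 4], so
   the minimising sequence has increments at most [2^-n]. *)
have /choice[u Hu] : forall n, exists w, W w /\
    `|x - w| ^+ 2 <= d + (2^-1 ^+ n) ^+ 2 / 4.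
  move=> n; have e0 : 0 < (2^-1 ^+ n) ^+ 2 / 4 :> C.
    by rewrite divr_gt0 // exprn_gt0.
  have eE := ReC (gtr0_real e0); have e0' := e0; rewrite eE ltcR in e0'.
  have [_ [w Ww <-] Hw] := inf_adherent e0' hE; exists w; split=> //.
  by rewrite eE /d -rmorphD /= -qE lecR ltW.
have uS n : `|u n.+1 - u n| <= 1 * 2^-1 ^+ n.
  rewrite mul1r -(ler_pXn2r (n := 2)) ?nnegrE ?(ltW (p0 n)) //.
  have := parallelogram (x - u n) (x - u n.+1).
  rewrite (_ : x - u n - _ = u n.+1 - u n); last by lmod.
  pose m := 2^-1 *: (u n + u n.+1).
  rewrite (_ : x - u n + _ = 2 *: (x - m)); last first.
    by rewrite scalerBr /m scalerA divff ?pnatr_eq0 // scale1r; lmod.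
  rewrite normrZ exprMn normr_nat => e.
  have Wm : W m by apply: subspaceZ => //; apply: subspaceD => //; exact: (Hu _).1.
  have h1 := dle _ Wm; have h2 := (Hu n).2; have h3 := (Hu n.+1).2.
  have -> : `|u n.+1 - u n| ^+ 2 = 2 * (`|x - u n| ^+ 2 + `|x - u n.+1| ^+ 2) -
     2 ^+ 2 * `|x - m| ^+ 2 by rewrite -e; ring.
  have h4 : `|x - u n.+1| ^+ 2 <= d + (2^-1 ^+ n) ^+ 2 / 4.
    rewrite (le_trans h3) // lerD2l ler_pM2r ?invr_gt0 // lerXn2r ?nnegrE ?(ltW (p0 _)) //.
    by rewrite exprS ler_piMl ?(ltW (p0 n)) // invf_le1 ?ler1n.
  have h5 := lerD h2 h4.
  have h6 : 2 * (`|x - u n| ^+ 2 + `|x - u n.+1| ^+ 2) <=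
      2 * (d + (2^-1 ^+ n) ^+ 2 / 4 + (d + (2^-1 ^+ n) ^+ 2 / 4)).
    by rewrite ler_pM2l.
  have h7 : 2 ^+ 2 * d <= 2 ^+ 2 * `|x - m| ^+ 2 by rewrite ler_pM2l.
  apply: le_trans (lerB h6 h7) _; rewrite le_eqVlt; apply/orP; left; apply/eqP.
  by field.
have /cvg_ex[w uw] := fast_cvg ler01 uS.
have Ww : W w by apply: (closed_cvg W) uw => //; apply: nearW => n; exact: (Hu n).1.
have dw : `|x - w| ^+ 2 <= d.
  have d0 : 0 <= d.
    rewrite lecR; apply: lb_le_inf; first by case: hE.
    by move=> _ [v _ <-]; rewrite -lecR qE exprn_ge0.
  have sd : `|x - w| <= sqrtC d.
    apply/ler_addgt0Pr => e e0.
    have e2 : 0 < e / 2 by rewrite divr_gt0.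
    have /cvgrPdist_lt/(_ _ e2)[N _ HN] := uw.
    have [N' HN'] := exp_half_small ler01 e2.
    pose n := maxn N N'; have un : `|x - u n| <= sqrtC d + e / 2.
      rewrite -(ler_pXn2r (n := 2)) ?nnegrE ?addr_ge0 ?sqrtC_ge0 ?(ltW e2) //.
      rewrite (le_trans (Hu n).2) // sqrrD sqrtCK -addrA lerD2l ler_wpDl //.
        by rewrite mulrn_wge0 // mulr_ge0 ?sqrtC_ge0 ?(ltW e2).
      rewrite ler_pdivrMr // (@le_trans _ _ ((e / 2) ^+ 2)) //; last first.
        by rewrite ler_peMr ?exprn_ge0 ?(ltW e2) // ler1n.
      rewrite lerXn2r ?nnegrE ?(ltW (p0 n)) ?(ltW e2) //.
      by rewrite -[leLHS]mul1r ltW // HN' // leq_maxr.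
    rewrite (_ : x - w = (x - u n) - (w - u n)); last by lmod.
    rewrite (le_trans (ler_normB _ _)) // [e]splitr addrA lerD //.
    by rewrite ltW // HN //= leq_maxl.
  by rewrite -[d]sqrtCK lerXn2r ?nnegrE ?sqrtC_ge0.
exists w => // y Wy; apply: minimal_orthogonal => c.
rewrite (le_trans dw) // -addrA -opprD; apply: dle.
by apply: subspaceD => //; apply: subspaceZ.
Qed.

End HilbertSpaces.

Section Representations.
Context (R : realType) (A : cstarAlgType R) (H : hilbertType R) (pi : A -> H -> H).
Hypothesis rep : representation pi.
Implicit Types (a b c : A) (v w x y : H).
Local Notation C := R[i].

Lemma repD a x y : pi a (x + y) = pi a x + pi a y.
Proof.
by case: rep => lc _ _ _ _; have := (lc a).1 1 x y; rewrite !scale1r.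
Qed.

Lemma rep_addl a b v : pi (a + b) v = pi a v + pi b v.
Proof. by case: rep => _ l _ _ _; rewrite -{1}[a]scale1r l scale1r. Qed.

Lemma rep0l v : pi 0 v = 0.
Proof. by apply: (addrI (pi 0 v)); rewrite -rep_addl !addr0. Qed.

Lemma repZl (c : C) a v : pi (c *: a) v = c *: pi a v.
Proof. by case: rep => _ l _ _ _; rewrite -[c *: a]addr0 l rep0l addr0. Qed.

Lemma repBl a b v : pi (a - b) v = pi a v - pi b v.
Proof. by rewrite rep_addl -scaleN1r repZl scaleN1r. Qed.

Lemma rep1 v : pi sone v = v. Proof. by case: rep. Qed.

Lemma repM a b v : pi (a ** b) v = pi a (pi b v). Proof. by case: rep. Qed.

Lemma rep_star a v w : hdot H (pi a v) w = hdot H v (pi (star a) w).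
Proof. by case: rep => _ _ _ _; apply. Qed.

(** Write [|a|^2 - star a ** a] as the square of a self-adjoint [c]; the inequality is
    [<pi c v, pi c v> >= 0]. *)
Lemma rep_norm a v : `|pi a v| <= `|a| * `|v|.
Proof.
rewrite -(ler_pXn2r (n := 2)) ?nnegrE ?mulr_ge0 // exprMn -!hdotxx.
have /pos_sqrt[c [cs _ cc _]] : pos (`|a| ^+ 2 *: sone - star a ** a).
  by apply: pos_bound; rewrite ?starM ?starK // cstar_identity.
have := semidot_ge0 (hdot H) (pi c v); rewrite rep_star cs -repM cc.
have nr : (`|a| ^+ 2)^* = `|a| ^+ 2 by apply/CrealP; rewrite rpredX // normr_real.
by rewrite repBl repZl rep1 repM semidotBr semidotZr nr -rep_star subr_ge0.
Qed.

Lemma vector_state v (t : C) : 0 <= t -> t * hdot H v v = 1 ->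
  state (fun a => t * hdot H (pi a v) v).
Proof.
move=> t0 t1; split=> [c a b||a].
- by rewrite rep_addl repZl semidotDl semidotZl; ring.
- by rewrite rep1.
by rewrite repM rep_star starK mulr_ge0 // semidot_ge0.
Qed.

Lemma rep_kernel_closed : closed [set a | forall v, pi a v = 0].
Proof.
rewrite (_ : mkset _ = \bigcap_(v in [set: H]) [set a | pi a v = 0]); last first.
  by apply/seteqP; split=> a Ha v; [move=> _; exact: Ha | exact: Ha].
apply: closed_bigI => v _; apply: (closed_kernel (M := `|v|)) => // [a b|a].
  exact: repBl.
by rewrite mulrC rep_norm.
Qed.

Program Definition rep_kernel : closed_ideal A :=
  @ClosedIdeal R A [set a | forall v, pi a v = 0] _ _ _ _ _.
Next Obligation. by move=> v; exact: rep0l. Qed.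
Next Obligation. by move=> c x y Hx Hy v; rewrite rep_addl repZl Hx Hy scaler0 addr0. Qed.
Next Obligation.
move=> a x Hx v; rewrite repM Hx; case: rep => lc _ _ _ _.
by have := (lc a).1 1 0 0; rewrite !scale1r addr0 => /eqP; rewrite -subr_eq subrr eq_sym => /eqP.
Qed.
Next Obligation. by move=> a x Hx v; rewrite repM Hx. Qed.
Next Obligation. exact: rep_kernel_closed. Qed.

End Representations.

(** * The GNS representation of a state *)

Section GNS.
Context (R : realType) (A : cstarAlgType R) (F : A -> R[i]) (SF : state F).
Implicit Types (a b c : A).
Local Notation C := R[i].

Lemma gns_linear (c : C) x y z : F (star z ** (c *: x + y)) =
  c * F (star z ** x) + F (star z ** y).
Proof. by rewrite smulDr smulZr stateD // stateZ. Qed.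

Lemma gns_conj x y : F (star y ** x) = (F (star x ** y))^*.
Proof. by rewrite -state_star // starM starK. Qed.

Definition gns_form : semidot A := SemiDot gns_linear gns_conj (state_ge0 SF).

Definition gns : hilbertType R := completion gns_form.

Lemma gns_seminormM a b :
  seminorm gns_form (a ** b) <= `|a| * seminorm gns_form b.
Proof.
rewrite -(ler_pXn2r (n := 2)) ?nnegrE ?mulr_ge0 ?seminorm_ge0 // exprMn.
rewrite !sqr_seminorm /=.
have /pos_sqrt[c [cs _ cc _]] : pos (`|a| ^+ 2 *: sone - star a ** a).
  by apply: pos_bound; rewrite ?starM ?starK // cstar_identity.
have := state_ge0 SF (c ** b).
have -> : star (c ** b) ** (c ** b) =
    `|a| ^+ 2 *: (star b ** b) - star (a ** b) ** (a ** b).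
  rewrite !starM cs -!smulA (smulA c c) cc.
  by rewrite smulBl smulBr !smulZl !smulZr smul1 !smulA.
by rewrite stateB // stateZ // subr_ge0.
Qed.

(** Vectors of the completion are functionals, so the action is dictated by
    [<a x, b> = <x, star a ** b>]: precompose with multiplication by [star a]. *)
Lemma gns_rep_subproof a (f : gns) :
  completion_set gns_form (fun b => cfun f (star a ** b)).
Proof.
move=> d d0; have a1 : 0 < `|a| + 1 by rewrite ltr_wpDl.
have [|v fv] := @completionP R A gns_form f (d / (`|a| + 1)).
  by rewrite divr_gt0.
exists (a ** v) => b.
have -> : gns_form (a ** v) b = gns_form v (star a ** b).
  by rewrite /= starM starK smulA.
rewrite (le_trans (fv _)) // (le_trans (ler_wpM2l _ (gns_seminormM _ _))) //.
  by rewrite divr_ge0 // ltW.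
rewrite norm_star mulrA ler_wpM2r ?seminorm_ge0 //.
by rewrite mulrAC -mulrA ler_piMr ?(ltW d0) // ler_pdivrMr // mul1r lerDl.
Qed.

Definition gns_rep a (f : gns) : gns := to_completion (gns_rep_subproof a f).

Lemma cfun_gns_rep a (f : gns) b : cfun (gns_rep a f) b = cfun f (star a ** b).
Proof. by []. Qed.

Lemma gns_rep_emb a b : gns_rep a (emb gns_form b) = emb gns_form (a ** b).
Proof.
apply: completion_ext => c.
change (F (star (star a ** c) ** b) = F (star c ** (a ** b))).
by rewrite starM starK smulA.
Qed.

Lemma gns_rep_le a (f : gns) : `|gns_rep a f| <= `|a| * `|f|.
Proof.
apply: completion_norm_le; split; first by rewrite mulr_ge0.
move=> b; rewrite cfun_gns_rep (le_trans (cfun_le_norm _ _)) //.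
rewrite -[completion_norm f]/(`|f|) [`|a| * _]mulrC -mulrA ler_wpM2l //.
by rewrite (le_trans (gns_seminormM _ _)) // norm_star.
Qed.

Lemma lipschitz_continuous (V W : normedModType C) (f : V -> W) (M : C) :
  0 <= M -> (forall x y, `|f x - f y| <= M * `|x - y|) -> continuous f.
Proof.
move=> M0 fM x; apply/cvgrPdist_lt => e e0.
have M1 : 0 < M + 1 by rewrite ltr_wpDl.
apply/nbhs_ballP; exists (e / (M + 1)); first by rewrite /= divr_gt0.
move=> y; rewrite -ball_normE /= => xy.
rewrite (le_lt_trans (fM x y)) // (@le_lt_trans _ _ ((M + 1) * `|x - y|)) //.
  by rewrite ler_wpM2r // lerDl.
by rewrite -ltr_pdivlMl // mulrC.
Qed.

Lemma gns_rep_linear a : linear (gns_rep a).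
Proof. by move=> c f g; apply: completion_ext => b. Qed.

Lemma gns_repB a f g : gns_rep a (f - g) = gns_rep a f - gns_rep a g.
Proof.
by rewrite -[in RHS]scaleN1r [RHS]addrC -gns_rep_linear scaleN1r addrC.
Qed.

Lemma dotp_emb (f : gns) b : hdot gns f (emb gns_form b) = cfun f b.
Proof. exact: cdot_emb. Qed.

Lemma gns_ext (f g : gns) :
  (forall b, hdot gns f (emb gns_form b) = hdot gns g (emb gns_form b)) -> f = g.
Proof. by move=> fg; apply: completion_ext => b; rewrite -!dotp_emb. Qed.

Lemma gns_representation : representation gns_rep.
Proof.
have lin a := gns_rep_linear a.
split.
- move=> a; split=> //; apply: (lipschitz_continuous (M := `|a|)) => // x y.
  by rewrite -gns_repB; exact: gns_rep_le.
- move=> c a b f; apply: completion_ext => d.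
  rewrite [RHS](_ : _ = c * cfun f (star a ** d) + cfun f (star b ** d)) //.
  rewrite cfun_gns_rep starD starZ smulDl smulZl -!dotp_emb.
  by rewrite emb_linear semidotDr semidotZr conjCK.
- by move=> f; apply: completion_ext => d; rewrite cfun_gns_rep star_one smul1.
- by move=> a b f; apply: completion_ext => d; rewrite !cfun_gns_rep starM smulA.
move=> a f g; apply: (@eq_approxM R (`|a| * `|f| + `|a| * `|f|)) => [|e e0].
  by rewrite addr_ge0 // mulr_ge0.
(* The adjoint relation is immediate against an embedded vector; density and the norm bounds extend
   it to all [g]. *)
have [b gb] := emb_dense g e0.
have E : hdot gns (gns_rep a f) (emb gns_form b) =
    hdot gns f (gns_rep (star a) (emb gns_form b)).
  by rewrite gns_rep_emb !dotp_emb.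
rewrite -[dotp _ _]/(hdot gns (gns_rep a f) g).
rewrite -[dotp f _]/(hdot gns f (gns_rep (star a) g)).
have -> : hdot gns (gns_rep a f) g - hdot gns f (gns_rep (star a) g) =
    hdot gns (gns_rep a f) (g - emb gns_form b) -
    hdot gns f (gns_rep (star a) (g - emb gns_form b)).
  rewrite gns_repB.
  by rewrite !semidotBr E; ring.
rewrite (le_trans (ler_normB _ _)) // mulrDl lerD //.
  rewrite (le_trans (hdot_le _ _)) // ler_pM // ?gns_rep_le //; exact: ltW.
rewrite (le_trans (hdot_le _ _)) // mulrAC [leRHS]mulrC ler_wpM2l //.
by rewrite (le_trans (gns_rep_le _ _)) // norm_star ler_wpM2l // ltW.
Qed.

Definition gns_vector : gns := emb gns_form sone.

Lemma gns_rep_vector a : gns_rep a gns_vector = emb gns_form a.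
Proof. by rewrite gns_rep_emb smulr1. Qed.

Lemma gns_vectorE a : hdot gns (gns_rep a gns_vector) gns_vector = F a.
Proof. by rewrite gns_rep_vector dotp_emb /cfun /= star_one smul1. Qed.

Lemma gns_vector_norm : hdot gns gns_vector gns_vector = 1.
Proof.
by rewrite -[X in hdot gns X](rep1 gns_representation) gns_vectorE state1.
Qed.

Lemma gns_vector_neq0 : gns_vector != 0.
Proof. by rewrite -hdotxx_eq0 gns_vector_norm oner_eq0. Qed.

Lemma gns_kernel a : (forall v, gns_rep a v = 0) -> F a = 0.
Proof. by move=> H; rewrite -gns_vectorE H semidot0l. Qed.

End GNS.

Section PureStates.
Context (R : realType) (A : cstarAlgType R) (F : A -> R[i]).
Hypothesis EF : extremal_state F.
Local Notation C := R[i].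

(* The projections eta and zeta of the cyclic vector on an invariant subspace
   and on its orthocomplement write F as a convex combination of two vector
   states; extremality makes eta a multiple of the cyclic vector. *)
Theorem extremal_irreducible (SF : state F) : irreducible (gns_rep (SF := SF)).
Proof.
split; first by exists (gns_vector SF); exact: gns_vector_neq0.
move=> W cW W0 lW iW; set pi := gns_rep (SF := SF) in iW *.
have rep : representation pi := gns_representation SF.
set xi := gns_vector SF; pose dt := hdot (gns SF).
have sW : linear_subspace W by split.
have [eta We ort] := orthogonal_projection xi cW sW.
set zeta := xi - eta in ort; have xiE : xi = eta + zeta by rewrite addrC subrK.
move: zeta ort xiE => zeta ort xiE.
have ort' y : W y -> dt y zeta = 0.
  by move=> Wy; rewrite /dt semidot_conj ort // rmorph0.
have e1 a : dt (pi a eta) zeta = 0 by apply/ort'/iW.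
have e2 a : dt (pi a zeta) eta = 0.
  by rewrite /dt rep_star // ort //; apply: iW.
have FE a : F a = dt (pi a eta) eta + dt (pi a zeta) zeta.
  rewrite -(gns_vectorE SF) -/pi -/xi -/dt xiE repD // /dt semidotDl !semidotDr.
  by rewrite -/dt e1 e2 addr0 add0r.
have nE : dt eta eta + dt zeta zeta = 1.
  by rewrite -(state1 SF) FE !rep1.
(* The two degenerate cases use cyclicity: if [eta = 0] the cyclic vector is orthogonal to [W], so
   [W] is zero; if [zeta = 0] it lies in [W], so [W] is everything. *)
have [eta0|etan0] := eqVneq eta 0.
  left; apply/seteqP; split=> [w Ww /=|_ ->] //; apply: gns_ext => b.
  rewrite semidot0l -(gns_rep_vector SF) -/pi -/xi -{1}[b]starK -rep_star //.
  by rewrite xiE eta0 add0r ort' //; apply: iW.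
have [zeta0|zetan0] := eqVneq zeta 0.
  right; apply/seteqP; split=> // w _.
  have Wxi : W xi by rewrite xiE zeta0 addr0.
  move/closed_normP: cW; apply => e e0; have [b wb] := emb_dense w e0.
  exists (emb (gns_form SF) b) => //.
  by rewrite -(gns_rep_vector SF); apply: iW.
have te0 : 0 < dt eta eta by rewrite lt_def hdotxx_eq0 etan0 semidot_ge0.
have tz0 : 0 < dt zeta zeta by rewrite lt_def hdotxx_eq0 zetan0 semidot_ge0.
have tE := ReC (gtr0_real te0); set t := complex.Re _ in tE.
have tzE : dt zeta zeta = (1 - t)%:C%C.
  by apply: (addrI (dt eta eta)); rewrite nE tE rmorphB rmorph1 /= addrC subrK.
have t01 : 0 < t < 1.
  by apply/andP; split; [rewrite -ltcR -tE | rewrite -subr_gt0 -ltcR -tzE].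
have S1 := vector_state rep (_ : 0 <= (dt eta eta)^-1) (mulVf (lt0r_neq0 te0)).
have S2 := vector_state rep (_ : 0 <= (dt zeta zeta)^-1) (mulVf (lt0r_neq0 tz0)).
rewrite invr_ge0 (ltW te0) in S1; rewrite invr_ge0 (ltW tz0) in S2.
have [_ /(_ _ _ t (S1 isT) (S2 isT) t01)] := EF.
have H1 a : F a = t%:C%C * ((dt eta eta)^-1 * dt (pi a eta) eta) +
    (1 - t)%:C%C * ((dt zeta zeta)^-1 * dt (pi a zeta) zeta).
  by rewrite -tE -tzE !mulrA !divff ?gt_eqF // !mul1r.
move=> /(_ H1) GF; have GE a : dt (pi a eta) eta = dt eta eta * F a.
  have /= <- := congr1 (fun g => g a) GF.
  by rewrite mulrA divff ?gt_eqF // mul1r.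
(* Both [eta] and [<eta, eta> xi] have the same inner products with the vectors [pi b xi], which are
   dense. *)
have k0 : eta - dt eta eta *: xi = 0.
  apply: gns_ext => b; rewrite semidot0l semidot_conj.
  rewrite -(gns_rep_vector SF) -/pi -/xi -/dt.
  suff -> : dt (pi b xi) (eta - dt eta eta *: xi) = 0 by rewrite rmorph0.
  rewrite /dt semidotBr semidotZr -/dt /dt gns_vectorE -/dt.
  rewrite xiE repD // /dt semidotDl -/dt e2 addr0 GE tE.
  by rewrite (CrealP (ger0_real _)) ?subrr // -tE ltW.
have etaE := subr0_eq k0.
(* Now [eta] and [zeta] are both multiples of [xi] with coefficients [t] and [1 - t]; their
   orthogonality contradicts [0 < t < 1]. *)
have zetaE : zeta = (1 - dt eta eta) *: xi.
  by rewrite scalerBl scale1r -etaE xiE addrC addKr.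
have : dt eta zeta = 0 by exact: ort'.
rewrite zetaE; move: etaE tE te0; move: (dt eta eta) => q etaE tE te0.
rewrite etaE /dt semidotZl semidotZr gns_vector_norm -/dt.
rewrite !mulr1 => /eqP; rewrite mulf_eq0 gt_eqF //= conjC_eq0.
by rewrite tE subr_eq0 -(rmorph1 (real_complex R)) (inj_eq (@complexI R)) gt_eqF //; case/andP: t01.
Qed.

End PureStates.

(** * Finite-dimensional representations *)

Section FiniteDimension.
Context (K : fieldType).

Lemma dim_le_dependent (V : lmodType K) n (v : 'I_n.+1 -> V) : dim_le V n ->
  exists2 c : 'I_n.+1 -> K, exists i, c i != 0 & \sum_i c i *: v i = 0.
Proof.
move=> [e He]; have /choice[m Hm] i := He (v i).
pose M : 'M[K]_(n.+1, n) := \matrix_(i, j) m i j.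
have : kermx M != 0.
  rewrite kermx_eq0 /row_free; apply/negP => /eqP rM.
  by have := rank_leq_col M; rewrite rM ltnn.
move=> /rowV0Pn[u /sub_kermxP uM u0]; exists (u 0).
  exact/rV0Pn.
transitivity (\sum_j (\sum_i u 0 i * m i j) *: e j).
  under eq_bigr => i _ do rewrite Hm scaler_sumr.
  rewrite exchange_big /=; apply: eq_bigr => j _; rewrite scaler_suml.
  by apply: eq_bigr => i _; rewrite scalerA.
apply: big1 => j _; suff -> : \sum_i u 0 i * m i j = (u *m M) 0 j.
  by rewrite uM mxE scale0r.
by rewrite mxE; apply: eq_bigr => i _; rewrite mxE.
Qed.

(** A subspace of [W] of largest dimension inside the image of [T] must be the whole image;
    preimages of its basis span [V]. *)
Lemma linear_injective_finite_dim (V : lmodType K) (W : vectType K) (T : V -> W) :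
  linear T -> injective T -> finite_dim V.
Proof.
move=> lT iT; pose S w := exists v, T v = w.
pose P n := `[< exists2 U : {vspace W}, (forall w, w \in U -> S w) & \dim U = n >].
have exP : exists n, P n.
  exists 0; apply/asboolP; exists 0%VS; last exact: dimv0.
  move=> w; rewrite memv0 => /eqP ->; exists (0 - 0).
  by rewrite -scaleN1r addrC lT scaleN1r addNr.
have ubP n : P n -> (n <= \dim (fullv : {vspace W}))%N.
  by move=> /asboolP[U _ <-]; apply/dimvS/subvf.
case: (ex_maxnP exP ubP) => n /asboolP[U US Un] Umax.
have SU w : S w -> w \in U.
  move=> [v vw]; have : P (\dim (U + <[w]>)).
    apply/asboolP; exists (U + <[w]>)%VS => // _ /memv_addP[x Ux [_ /vlineP[k ->] ->]].
    have [u <-] := US _ Ux; exists (k *: v + u).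
    by rewrite lT vw addrC.
  move=> /Umax; rewrite -Un => le; have /eqP -> : (U == U + <[w]>)%VS.
    by rewrite eqEdim addvSl.
  by rewrite (subvP (addvSr U <[w]>)) // memv_line.
have /choice[e He] : forall i : 'I_(\dim U), exists v, T v = (vbasis U)`_i.
  by move=> i; apply: US; apply: vbasis_mem; rewrite mem_nth // size_tuple.
exists (\dim U), e => v; exists (fun i => coord (vbasis U) i (T v)).
have T0 : T 0 = 0 by have := lT (-1) 0 0; rewrite scaler0 addr0 scaleN1r addNr.
have Tsum (r : seq 'I_(\dim U)) (c : 'I_(\dim U) -> K) :
    T (\sum_(i <- r) c i *: e i) = \sum_(i <- r) c i *: T (e i).
  by elim: r => [|i r IH]; rewrite ?big_nil // !big_cons lT IH.
apply: iT; rewrite Tsum {1}(coord_vbasis (SU (T v) _)); last by exists v.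
by apply: eq_bigr => i _; rewrite He.
Qed.

End FiniteDimension.

Section FiniteDimensionalHilbert.
Context (R : realType) (H : hilbertType R).
Implicit Types (x y v w : H) (W : set H).
Local Notation C := R[i].

(** Let [g] be the component of [v] orthogonal to [W]. If [g] is nonzero, [W + C v] is the preimage
    of [W] under removal of the component along [g], a Lipschitz map. *)
Lemma closed_addline W v : closed W -> linear_subspace W ->
  closed [set x | exists c : C, W (x - c *: v)] /\
  linear_subspace [set x | exists c : C, W (x - c *: v)].
Proof.
move=> cW sW; split; last first.
  split; first by exists 0; rewrite scale0r subrr; case: sW.
  move=> k x y [c Wx] [d Wy]; exists (k * c + d).
  rewrite (_ : _ - _ = k *: (x - c *: v) + (y - d *: v)); last by lmod.
  by case: sW => _; apply.
have [w0 Ww0 ort] := orthogonal_projection v cW sW; set g := v - w0 in ort.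
have [g0|g0] := eqVneq g 0.
  have Wv : W v by rewrite (subr0_eq g0).
  rewrite (_ : mkset _ = W) //; apply/seteqP; split=> x /=.
    move=> [c Wx]; rewrite -[x](subrK (c *: v)); apply: subspaceD => //.
    exact: subspaceZ.
  by move=> Wx; exists 0; rewrite scale0r subr0.
have gg0 : hdot H g g != 0 by rewrite hdotxx_eq0.
pose p x := x - (hdot H x g / hdot H g g) *: g.
have pW x : W (p x) -> exists c : C, W (x - c *: v).
  move=> Wp; exists (hdot H x g / hdot H g g).
  set k := _ / _ in Wp *; rewrite (_ : _ - _ = (x - k *: g) - k *: w0); last first.
    by rewrite /g; lmod.
  by apply: subspaceB => //; apply: subspaceZ.
have Wp x (c : C) : W (x - c *: v) -> W (p x).
  move=> Wx; rewrite (_ : p x = (x - c *: v) + c *: w0).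
    by apply: subspaceD => //; apply: subspaceZ.
  have xE : x = ((x - c *: v) + c *: w0) + c *: g by rewrite /g; lmod.
  have o : hdot H ((x - c *: v) + c *: w0) g = 0.
    rewrite semidot_conj ort ?rmorph0 //.
    by apply: subspaceD => //; apply: subspaceZ.
  rewrite /p {2}xE semidotDl o add0r semidotZl mulfK //.
  by rewrite {1}xE addrK.
apply/closed_normP => x Hx; apply: pW; move/closed_normP: cW; apply => e e0.
have [y [c /Wp Wy] xy] := Hx (e / 2) (divr_gt0 e0 (ltr0n _ 2)).
exists (p y) => //.
have -> : p x - p y = (x - y) - (hdot H (x - y) g / hdot H g g) *: g.
  have e3 (u1 u2 u3 : H) (c1 c2 : C) :
      u1 - c1 *: u3 - (u2 - c2 *: u3) = u1 - u2 - (c1 - c2) *: u3 by lmod.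
  by rewrite /p e3 -mulrBl -semidotBl.
rewrite (le_lt_trans (ler_normB _ _)) // [e]splitr ltr_leD // ?(ltW xy) //.
rewrite normrZ normrM normfV hdotxx [`|_ ^+ 2|]ger0_norm ?exprn_ge0 //.
apply: le_trans (ltW xy); have ng0 : 0 < `|g| by rewrite normr_gt0.
rewrite mulrAC ler_pdivrMr ?exprn_gt0 // expr2 mulrA ler_wpM2r //.
exact: hdot_le.
Qed.

Definition span_set n (e : 'I_n -> H) : set H :=
  [set x | exists c : 'I_n -> C, x = \sum_i c i *: e i].

Lemma span_set_closed n (e : 'I_n -> H) :
  closed (span_set e) /\ linear_subspace (span_set e).
Proof.
elim: n e => [|n IH] e.
  have -> : span_set e = [set 0].
    apply/seteqP; split=> x /=; first by case=> c ->; rewrite big_ord0.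
    by move=> ->; exists (fun=> 0); rewrite big_ord0.
  split; last by split=> // c x y -> ->; rewrite scaler0 addr0.
  apply/closed_normP => x Hx /=; apply/eqP; rewrite -normr_le0.
  apply/ler_addgt0Pr => d /Hx[y /= ->]; rewrite subr0 add0r; exact: ltW.
have [cW sW] := IH (fun i => e (widen_ord (leqnSn n) i)).
have := closed_addline (e ord_max) cW sW.
set S1 := mkset _; suff -> : S1 = span_set e by [].
apply/seteqP; split=> x /=.
  move=> [c [d dE]]; exists (fun i => if unlift ord_max i is Some j then d j else c).
  rewrite big_ord_recr /= unlift_none -[LHS](subrK (c *: e ord_max)) dE.
  congr (_ + _); apply: eq_bigr => i _.
  have -> : widen_ord (leqnSn n) i = lift ord_max i by apply/ord_inj; rewrite lift_max.
  by rewrite liftK.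
move=> [c ->]; exists (c ord_max), (fun i => c (widen_ord (leqnSn n) i)).
by rewrite big_ord_recr addrK.
Qed.

End FiniteDimensionalHilbert.

Section FiniteDimensionalRepresentations.
Context (R : realType) (A : cstarAlgType R).
Local Notation C := R[i].

Lemma rep_linear_sum (H : hilbertType R) (pi : A -> H -> H) n (e : 'I_n -> H) c a :
  representation pi -> pi a (\sum_i c i *: e i) = \sum_i c i *: pi a (e i).
Proof.
move=> [lc _ _ _ _]; have lin := (lc a).1.
have p0 : pi a 0 = 0.
  by have := lin (-1) 0 0; rewrite scaler0 addr0 scaleN1r addNr.
elim: (index_enum _) => [|i r IH]; first by rewrite !big_nil.
by rewrite !big_cons lin IH.
Qed.

(** The coefficients [<pi a (e i), e j>] embed the quotient into matrices. As [e] is merely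
    spanning, they need not be the matrix of [pi a], but if they vanish then each [pi a (e i)] is
    orthogonal to itself. *)
Lemma finite_dim_kernel (H : hilbertType R) (pi : A -> H -> H)
  (rep : representation pi) : finite_dim H -> finite_dim (quot (rep_kernel rep)).
Proof.
move=> [n [e He]]; pose I := rep_kernel rep.
pose T' a : 'M[C]_n := \matrix_(i, j) hdot H (pi a (e i)) (e j).
have T'D (c : C) a b : T' (c *: a + b) = c *: T' a + T' b.
  apply/matrixP => i j; rewrite !mxE rep_addl // repZl //.
  by rewrite semidotDl semidotZl.
have T'0 a : T' a = 0 <-> ideal_set I a.
  split=> [Ta v|Ia]; last by apply/matrixP => i j; rewrite !mxE Ia semidot0l.
  have pe i : pi a (e i) = 0.
    apply/eqP; rewrite -hdotxx_eq0; have [c {2}->] := He (pi a (e i)).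
    elim: (index_enum _) => [|j r IH]; first by rewrite big_nil semidot0r.
    rewrite big_cons semidotDr (eqP IH) addr0 semidotZr.
    by have /matrixP/(_ i j) := Ta; rewrite !mxE => ->; rewrite mulr0.
  have [c ->] := He v; rewrite rep_linear_sum //.
  by apply: big1 => i _; rewrite pe scaler0.
have T'B a b : T' (a - b) = T' a - T' b.
  by rewrite addrC -scaleN1r T'D scaleN1r addrC.
pose T (x : quot I) := T' (repr x).
have TE a : T (qproj I a) = T' a.
  by apply/subr0_eq; rewrite -T'B; apply/T'0/ideal_repr.
apply: (@linear_injective_finite_dim _ _ _ T) => [c|].
  elim/Defs.quotP=> a; elim/Defs.quotP=> b.
  by rewrite -qprojZ -qprojD !TE T'D.
elim/Defs.quotP=> a; elim/Defs.quotP=> b; rewrite !TE => ab.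
by apply/qprojP/T'0; rewrite T'B ab subrr.
Qed.

Definition fd_kernel (H : hilbertType R) (pi : A -> H -> H)
  (rep : representation pi) (fd : finite_dim H) : fd_ideal A :=
  FdIdeal (finite_dim_kernel rep fd).

(** The embedded copy of [A] is finitely spanned, hence closed, and it is dense. *)
Lemma gns_finite_dim (F : A -> C) (SF : state F) : finite_dim A ->
  finite_dim (gns SF).
Proof.
move=> [n [e He]]; exists n, (fun i => emb (gns_form SF) (e i)) => x.
have [/closed_normP cS _] := span_set_closed (fun i => emb (gns_form SF) (e i)).
apply: cS => d d0; have [v xv] := emb_dense x d0; exists (emb (gns_form SF) v) => //.
have [c ->] := He v; exists c.
have e0 : emb (gns_form SF) 0 = 0.
  by have := emb_linear (gns_form SF) (-1) 0 0; rewrite scaler0 addr0 scaleN1r addNr.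
elim: (index_enum _) => [|i r IH]; first by rewrite !big_nil.
by rewrite !big_cons emb_linear IH.
Qed.

Lemma state_separates (a : A) : a != 0 ->
  exists2 F, extremal_state F & 0 < F (star a ** a).
Proof.
move=> a0; have v0 : star a ** a != 0.
  by apply: contra a0 => /eqP/star_mul_eq0 ->.
have [F EF vF] := exists_extremal_state (pos_starM a) v0.
by exists F => //; apply: lt_le_trans vF; rewrite normr_gt0.
Qed.

End FiniteDimensionalRepresentations.

(** * Injectivity of the completion maps *)

Section ProfiniteInjectivity.
Context (R : realType) (A : cstarAlgType R).
Local Notation C := R[i].

Lemma quot_representation (I : closed_ideal A) (H : hilbertType R)
    (pi : quot I -> H -> H) : representation pi ->
  representation (fun a => pi (qproj I a)).
Proof.
move=> rep; have [lc lin p1 pM padj] := rep; split=> //.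
- by move=> c a b v; rewrite qprojD qprojZ lin.
- by move=> a b v; rewrite -pM; congr (pi _ _); rewrite [RHS]quot_mulE.
by move=> a v w; rewrite padj; congr (dotp _ (pi _ _)); rewrite [LHS]quot_starE.
Qed.

Lemma eta_uP (a b : A) : eta_u a = eta_u b <->
  forall I : fd_ideal A, qproj I a = qproj I b.
Proof.
split=> [ab I|ab].
  by have /(congr1 (fun x => val x I)) := ab.
by apply: val_inj; apply: functional_extensionality_dep.
Qed.

Lemma eta_b_inj : injective (@eta_b R A) <-> injective (@eta_u R A).
Proof.
split=> inj a b ab; apply: inj; first by apply: val_inj.
by have /(congr1 val) := ab.
Qed.

Lemma eta_u_rfd : injective (@eta_u R A) <-> residually_finite_dimensional A.
Proof.
split=> [inj|[T [H [pi [Hpi sep]]]] a b /eta_uP ab]; last first.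
  apply: sep => t; have [rep fd] := Hpi t; apply/funext => v.
  have /qprojP/(_ v) := ab (fd_kernel rep fd).
  by rewrite repBl // => /subr0_eq.
(* The separating family consists of the GNS representations of all states of all finite-dimensional
   quotients, pulled back to [A]. *)
pose T := {I : fd_ideal A & {F : quot I -> C | state F}}.
pose H (t : T) := gns (proj2_sig (projT2 t)).
exists T, H, (fun (t : T) (a : A) (v : H t) =>
  gns_rep (SF := proj2_sig (projT2 t)) (qproj (projT1 t) a) v).
split=> [t|a b ab].
  split; first exact/quot_representation/gns_representation.
  by apply: gns_finite_dim; exact: fd_ideal_finite.
apply/inj/eta_uP => I; apply/eqP; rewrite -subr_eq0; apply: contraT => x0.
have [F [SF _] Fx] := state_separates x0.
pose t : T := existT _ I (exist _ F SF).
have /(congr1 (fun g => g (gns_vector SF))) := ab t.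
rewrite /t /= !gns_rep_vector => e.
have : F (star (qproj I a - qproj I b) ** (qproj I a - qproj I b)) = 0.
  rewrite -[LHS](sqr_seminorm (gns_form SF)) -norm_emb.
  have -> : emb (gns_form SF) (qproj I a - qproj I b) = 0.
    by rewrite addrC -scaleN1r emb_linear e scaleN1r addNr.
  by rewrite normr0 expr0n.
by move=> F0; rewrite F0 ltxx in Fx.
Qed.

Lemma subhomogeneous_eta_inj : subhomogeneous A -> injective (@eta_u R A).
Proof.
move=> [n [_ sub]] a b /eta_uP ab; apply/eqP; rewrite -subr_eq0.
apply: contraT => x0; have [F EF Fx] := state_separates x0; have SF := EF.1.
have fd : finite_dim (gns SF).
  exists n; apply: sub; [exact: gns_representation | exact: extremal_irreducible].
have /qprojP xker := ab (fd_kernel (gns_representation SF) fd).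
rewrite -(gns_vectorE SF) (repM (gns_representation SF)) xker in Fx.
rewrite -(rep0l (gns_representation SF) (gns_vector SF)) in Fx.
rewrite -(repM (gns_representation SF)) smul0r in Fx.
by rewrite (rep0l (gns_representation SF)) semidot0l ltxx in Fx.
Qed.

End ProfiniteInjectivity.

(** * Ideals of algebras of continuous functions *)

Section ContinuousFunctions.
Context (R : realType) (X : topologicalType).
Local Notation C := R[i].
Implicit Types (f g h : contfun R X) (x y : X) (K : set (contfun R X)).

Definition ceval f x : C := (val f : X -> C) x.

Lemma contfun_ext f g : (forall x, ceval f x = ceval g x) -> f = g.
Proof. by move=> fg; apply: val_inj; apply: functional_extensionality_dep. Qed.

Definition mk_contfun (g : X -> C) (cg : continuous (g : X -> C^o)) : contfun R X :=
  @subalg_in R _ (contfun_subalgebra R X) (g : {ptws X -> C^o}) cg.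

Lemma ceval_mk (g : X -> C) (cg : continuous (g : X -> C^o)) x :
  ceval (mk_contfun cg) x = g x. Proof. by []. Qed.

Lemma ceval_linear (c : C) f g x : ceval (c *: f + g) x = c * ceval f x + ceval g x.
Proof. by []. Qed.

Lemma cevalD f g x : ceval (f + g) x = ceval f x + ceval g x.
Proof. by []. Qed.

Lemma cevalZ (c : C) f x : ceval (c *: f) x = c * ceval f x.
Proof. by []. Qed.

Lemma cevalB f g x : ceval (f - g) x = ceval f x - ceval g x.
Proof. by []. Qed.

Lemma cevalM f g x : ceval (f ** g) x = ceval f x * ceval g x.
Proof. by []. Qed.

Lemma ceval1 x : ceval sone x = 1. Proof. by []. Qed.

Lemma ceval0 x : ceval 0 x = 0. Proof. by []. Qed.

Lemma ceval_star f x : ceval (star f) x = (ceval f x)^*.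
Proof. by []. Qed.

Definition cevalE := (ceval_linear, cevalB, cevalD, cevalZ, cevalM, ceval1,
  ceval0, ceval_star).

Lemma ceval_sum (J : Type) (r : seq J) (c : J -> C) (F : J -> contfun R X) x :
  ceval (\sum_(i <- r) c i *: F i) x = \sum_(i <- r) c i * ceval (F i) x.
Proof.
by elim: r => [|i r IH]; rewrite ?big_nil // !big_cons cevalD cevalZ IH.
Qed.

Lemma ceval_continuous f : continuous (ceval f : X -> C^o).
Proof. exact: (@subalgP R _ (contfun_subalgebra R X) f). Qed.

Lemma contfun_mulC f g : f ** g = g ** f.
Proof. by apply: contfun_ext => x; rewrite !cevalE mulrC. Qed.

Definition cpow f n := iter n (smul f) sone.

Lemma ceval_pow f n x : ceval (cpow f n) x = ceval f x ^+ n.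
Proof. by elim: n => [|n IH] //=; rewrite cevalM IH exprS. Qed.

Definition cpoly (p : {poly C}) f := \sum_(i < size p) p`_i *: cpow f i.

Lemma ceval_poly p f x : ceval (cpoly p f) x = p.[ceval f x].
Proof.
rewrite ceval_sum horner_coef; apply: eq_bigr => i _; by rewrite ceval_pow.
Qed.

Definition cideal K := [/\ K 0,
  forall (c : C) f g, K f -> K g -> K (c *: f + g) & forall h f, K f -> K (h ** f)].

Lemma continuous_neq0_open (g : X -> C) : continuous (g : X -> C^o) ->
  open [set x | g x != 0].
Proof.
move=> cg; rewrite openE => x /= gx; have ng : 0 < `|g x| by rewrite normr_gt0.
have /cvgrPdist_lt/(_ _ ng) := cg x; apply: filterS => y xy.
by apply: contraTneq xy => ->; rewrite subr0 ltxx.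
Qed.

(** Without a common zero, compactness provides finitely many [f] in [K] such that the sum of the
    [|f|^2] vanishes nowhere; it lies in [K] and is invertible. *)
Lemma cideal_common_zero K : compact [set: X] -> cideal K -> ~ K sone ->
  exists x, forall f, K f -> ceval f x = 0.
Proof.
move=> cX [K0 lK mK] K1; apply: contra_notP K1 => nz.
(* If [X] is empty then [1 = 0], which is in [K]; otherwise [x0] serves as base point for the
   covering form of compactness. *)
have [[x0 _]|noX] := pselect (exists x : X, True); last first.
  by rewrite (_ : sone = 0) //; apply: contfun_ext => x; case: noX; exists x.
pose pX : ptopologicalType := HB.pack (X : Type) (isPointed.Build (X : Type) x0) (Topological.on X).
have [s sK scov] : exists2 s : seq (contfun R X), (forall f, f \in s -> K f) &
    forall x, exists2 f, f \in s & ceval f x != 0.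
  have : @compact pX [set: X] by exact: cX.
  rewrite compact_cover => /(_ (contfun R X) K (fun f => [set x | ceval f x != 0])).
  case=> [f Kf|x _|D DK Dcov].
  - exact/continuous_neq0_open/ceval_continuous.
  - apply: contra_notP nz => nx; exists x => f Kf; apply/eqP/negPn/negP => fx.
    by apply: nx; exists f.
  exists (finmap.enum_fset D) => [f fD|x]; first by have := DK f fD; rewrite inE.
  by have [f fD fx] := Dcov x Logic.I; exists f.
pose k := \sum_(f <- s) 1 *: (star f ** f).
have kE x : ceval k x = \sum_(f <- s) `|ceval f x| ^+ 2.
  rewrite ceval_sum; apply: eq_bigr => f _.
  by rewrite mul1r !cevalE mulrC -normCK.
have Kk : K k.
  rewrite /k; elim: s sK {scov kE k} => [|f r IH] sK; first by rewrite big_nil.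
  rewrite big_cons; apply: lK; first by apply: mK; apply: sK; exact: mem_head.
  by apply: IH => g gr; apply: sK; rewrite in_cons gr orbT.
have knz x : ceval k x != 0.
  have [f fs fx] := scov x; rewrite kE psumr_neq0 => [|g _]; last exact: exprn_ge0.
  by apply/hasP; exists f => //=; rewrite exprn_gt0 // normr_gt0.
have cinv : continuous ((fun x => (ceval k x)^-1) : X -> C^o).
  move=> x; apply: (@cvgV C^o) => //; exact: ceval_continuous.
suff -> : sone = mk_contfun cinv ** k by exact: mK.
by apply: contfun_ext => x; rewrite !cevalE ceval_mk mulVf.
Qed.

(* Algebraic Nullstellensatz: if h = q(f) with f^m q(f) in K and q(0) != 0, then
   h f is in K, and at a common zero of the ideal (K : f) one has q(f x) = 0. *)
Lemma cideal_nullstellensatz K f : compact [set: X] -> cideal K ->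
  (forall g n, K (cpow g n) -> K g) ->
  (exists2 p : {poly C}, p != 0 & K (cpoly p f)) ->
  (forall x, (forall g, K g -> ceval g x = 0) -> ceval f x = 0) -> K f.
Proof.
move=> cX iK rad [p p0 Kp] f0; have [K0 lK mK] := iK.
have [m [q q0 pE]] := multiplicity_XsubC p 0.
rewrite p0 /= in q0; rewrite subr0 in pE.
pose h := cpoly q f.
have Khf : K (h ** f).
  (* The power [m + 1] of [q(f) f] contains the factor [f^m q(f) = p(f)]. *)
  apply: (rad _ m.+1); suff -> : cpow (h ** f) m.+1 =
      (cpow h m ** f) ** cpoly p f by exact: mK.
  apply: contfun_ext => x; rewrite ceval_pow !cevalE !ceval_pow !ceval_poly pE.
  by rewrite hornerM hornerXn exprMn !exprS; ring.
have iK' : cideal [set g | K (g ** f)].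
  split=> /=; first by rewrite smul0l.
    by move=> c g1 g2 K1 K2; rewrite smulDl smulZl; apply: lK.
  by move=> g1 g2 K2; rewrite -smulA; apply: mK.
have [K1|K1] := pselect (K f); first by [].
have [|x Hx] := cideal_common_zero cX iK'; first by rewrite /= smul1.
exfalso; have fx : ceval f x = 0.
  by apply: f0 => g Kg; apply: Hx => /=; rewrite contfun_mulC; apply: mK.
have := Hx h Khf; rewrite ceval_poly fx => qx.
by move: q0; rewrite /root qx eqxx.
Qed.

Section Separation.
Hypotheses (cX : compact [set: X]) (hX : hausdorff_space X).

Lemma contfun_separates x y : x != y -> exists2 f, ceval f x = 1 & ceval f y = 0.
Proof.
move=> xy; have nX : normal_space X by apply: compact_normal.
have clx : closed [set x] by apply: accessible_closed_set1; apply: hausdorff_accessible.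
have cly : closed [set y] by apply: accessible_closed_set1; apply: hausdorff_accessible.
have sep : uniform_separator [set y] [set x].
  move/normal_separatorP: nX; apply => //.
  by apply/disjoints_subset => z ->; apply/eqP; rewrite eq_sym.
pose u := @Urysohn X R [set y] [set x].
have cu : continuous ((fun z => (u z)%:C%C) : X -> C^o).
  move=> z; apply/cvgrPdist_lt => e e0; have eE := ReC (gtr0_real e0).
  have e0' : 0 < complex.Re e by rewrite -ltcR -eE.
  have /cvgrPdist_lt/(_ _ e0') := @Urysohn_continuous X R [set y] [set x] z.
  apply: filterS => t; rewrite -rmorphB /= eE -ltcR normc_def /= expr0n addr0.
  by rewrite sqrtr_sqr.
exists (mk_contfun cu); rewrite ceval_mk.
  by rewrite (@Urysohn_sub1 X R _ _ sep (u x)) //; exists x.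
by rewrite (@Urysohn_sub0 X R _ _ sep (u y)) //; exists y.
Qed.

Lemma contfun_delta x (s : seq X) : x \notin s -> exists2 f, ceval f x = 1 &
  forall y, y \in s -> ceval f y = 0.
Proof.
elim: s => [|y s IH]; first by exists sone.
rewrite inE negb_or => /andP[xy /IH[f fx fs]].
have [g gx gy] := contfun_separates xy; exists (g ** f).
  by rewrite !cevalE gx fx mulr1.
move=> z; rewrite inE !cevalE => /predU1P[->|/fs ->]; last by rewrite mulr0.
by rewrite gy mul0r.
Qed.

Lemma contfun_deltas (s : seq X) : exists d : X -> contfun R X,
  forall x, ceval (d x) x = 1 /\ forall y, y \in s -> y != x -> ceval (d x) y = 0.
Proof.
have H x : exists f, ceval f x = 1 /\
    forall y, y \in s -> y != x -> ceval f y = 0.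
  have [|f f1 f2] := @contfun_delta x [seq y <- s | y != x].
    by rewrite mem_filter eqxx.
  by exists f; split=> // y ys yx; apply: f2; rewrite mem_filter yx.
by have [d Hd] := choice H; exists d.
Qed.

Lemma contfun_interpolation (g : X -> C) (s : seq X) :
  exists f, forall x, x \in s -> ceval f x = g x.
Proof.
elim: s => [|x s [f Hf]]; first by exists 0.
have [xs|xs] := boolP (x \in s).
  by exists f => y; rewrite inE => /predU1P[->|]; exact: Hf.
have [d dx ds] := contfun_delta xs; exists ((g x - ceval f x) *: d + f) => y.
rewrite inE cevalE => /predU1P[->|ys]; first by rewrite dx mulr1 subrK.
by rewrite ds // mulr0 add0r Hf.
Qed.

End Separation.
End ContinuousFunctions.

(** * Extension to arbitrary functions *)

Lemma continuous_sum (T : topologicalType) (K : numFieldType) (V : normedModType K)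
  (I : Type) (r : seq I) (F : I -> T -> V) :
  (forall i, continuous (F i)) -> continuous (fun t => \sum_(i <- r) F i t).
Proof.
move=> cF t; elim: r => [|i r IH].
  under eq_fun => ? do rewrite big_nil.
  exact: cvg_cst.
under eq_fun => ? do rewrite big_cons.
by apply: cvgD; [exact: cF|exact: IH].
Qed.

Lemma prod_continuous (T : topologicalType) (I : Type) (K : I -> topologicalType)
  (f : T -> prod_topology K) :
  (forall i, continuous (fun t => f t i)) -> continuous f.
Proof.
move=> cf t; apply/cvg_sup => i.
exact: (@continuous_comp_initial _ _ _ (fun g : (forall j, K j) => g i) f (cf i)).
Qed.

Section CommutativeSubalgebra.
Context (R : realType) (A : cstarAlgType R) (B : star_subalgebra A).
Context (X : topologicalType) (gamma : contfun R X -> subalg B).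
Hypotheses (cX : compact [set: X]) (hX : hausdorff_space X).
Hypothesis iso : star_iso gamma.
Local Notation C := R[i].
Implicit Types (f g h : contfun R X) (x y : X) (I J : fd_ideal A).

Definition realize f : A := val (gamma f).

Lemma realize_linear (c : C) f g : realize (c *: f + g) = c *: realize f + realize g.
Proof. by case: iso => [[l _ _ _] _]; rewrite /realize l. Qed.

Lemma realize1 : realize sone = sone.
Proof. by case: iso => [[_ o _ _] _]; rewrite /realize o. Qed.

Lemma realizeM f g : realize (f ** g) = realize f ** realize g.
Proof. by case: iso => [[_ _ m _] _]; rewrite /realize m. Qed.

Lemma realize_star f : realize (star f) = star (realize f).
Proof. by case: iso => [[_ _ _ s] _]; rewrite /realize s. Qed.

Lemma realize_surj a : subalg_set B a -> exists f, realize f = a.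
Proof.
move=> Ba; case: iso => _ [gi _ gK]; exists (gi (subalg_in Ba)).
by rewrite /realize gK.
Qed.

Lemma realize_mem f : subalg_set B (realize f).
Proof. exact: subalgP. Qed.

Lemma realize_inj f g : realize f = realize g -> f = g.
Proof. by case: iso => _ /bij_inj inj /val_inj/inj. Qed.

Definition theta I f : quot I := qproj I (realize f).

Lemma theta_linear I (c : C) f g : theta I (c *: f + g) = c *: theta I f + theta I g.
Proof. by rewrite /theta realize_linear qprojD qprojZ. Qed.

Lemma theta0 I : theta I 0 = 0.
Proof.
have := theta_linear I (-1) 0 0; rewrite scaler0 addr0 scaleN1r addNr.
exact.
Qed.

Lemma thetaB I f g : theta I (f - g) = theta I f - theta I g.
Proof. by rewrite addrC -scaleN1r theta_linear scaleN1r addrC. Qed.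

Lemma theta1 I : theta I sone = sone.
Proof. by rewrite /theta realize1. Qed.

Lemma thetaM I f g : theta I (f ** g) = theta I f ** theta I g.
Proof. by rewrite /theta realizeM [RHS]quot_mulE. Qed.

Lemma theta_star I f : theta I (star f) = star (theta I f).
Proof. by rewrite /theta realize_star [RHS]quot_starE. Qed.

Lemma theta_sum I (K : Type) (r : seq K) (c : K -> C) (F : K -> contfun R X) :
  theta I (\sum_(i <- r) c i *: F i) = \sum_(i <- r) c i *: theta I (F i).
Proof.
elim: r => [|i r IH]; first by rewrite !big_nil theta0.
by rewrite !big_cons theta_linear IH.
Qed.

Definition hull I : set X := [set x | forall f, theta I f = 0 -> ceval f x = 0].

(** If [A/I] is spanned by [n] elements, then [n + 1] points of the hull are impossible: functions
    that are 1 at one of them and 0 at the others would be dependent in [A/I], and evaluating the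
    relation at a point kills its coefficient there. *)
Lemma hull_finite I : exists2 s : seq X, uniq s & forall x, x \in s <-> hull I x.
Proof.
have [n Hn] := fd_ideal_finite I.
pose P m := `[< exists s : seq X, [/\ uniq s, forall x, x \in s -> hull I x & size s = m] >].
have exP : exists m, P m by exists 0%N; apply/asboolP; exists [::].
have ubP m : P m -> (m <= n)%N.
  move=> /asboolP[s [us sh <-]]; rewrite leqNgt; apply/negP => ns.
  have x0 : X by case: s ns {us sh} => [|x].
  have [d Hd] := contfun_deltas R cX hX s.
  pose p (i : 'I_n.+1) := nth x0 s i.
  have ps i : p i \in s by rewrite mem_nth // (leq_trans (ltn_ord i)).
  have pinj i j : p i = p j -> i = j.
    move=> /eqP; rewrite nth_uniq ?(leq_trans (ltn_ord _)) // => /eqP.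
    exact: ord_inj.
  have [c [j cj] c0] := dim_le_dependent (fun i => theta I (d (p i))) Hn.
  rewrite -theta_sum in c0; have := sh _ (ps j) _ c0.
  rewrite ceval_sum (bigD1 j) //= (Hd (p j)).1 mulr1 big1 ?addr0 => [/eqP|i ij].
    by rewrite (negbTE cj).
  by rewrite (Hd (p i)).2 ?mulr0 //; apply: contra ij => /eqP/pinj ->.
case: (ex_maxnP exP ubP) => m /asboolP[s [us sh sm]] mmax.
exists s => // x; split; first exact: sh.
move=> hx; apply: contraT => xs.
have /mmax : P (size (x :: s)).
  apply/asboolP; exists (x :: s); split=> //; first by rewrite /= xs.
  by move=> y; rewrite inE => /predU1P[-> //|]; exact: sh.
by rewrite /= -sm ltnn.
Qed.

Lemma cideal_theta I : cideal [set f | theta I f = 0].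
Proof.
split=> /=; first exact: theta0.
  by move=> c f g f0 g0; rewrite theta_linear f0 g0 scaler0 addr0.
by move=> h f f0; rewrite thetaM f0 smul0r.
Qed.

(** The C*-identity removes powers of two from the self-adjoint [v = star f ** f], and then gives
    [f] from [v]. *)
Lemma theta_radical I f n : theta I (cpow f n) = 0 -> theta I f = 0.
Proof.
move=> fn0; pose v := star f ** f.
have vs : star v = v by rewrite starM starK.
have [_ _ mK] := cideal_theta I; rewrite /= in mK.
have sq k : theta I (cpow v (2 ^ k)) = 0 -> theta I v = 0.
  elim: k => [|k IH]; first by rewrite expn0 /= smulr1.
  move=> H; apply: IH; apply: star_mul_eq0; rewrite -theta_star -thetaM.
  rewrite -H; congr (theta I _); apply: contfun_ext => x.
  rewrite cevalM ceval_star !ceval_pow rmorphXn /= -ceval_star vs.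
  by rewrite -exprD addnn -mul2n -expnS.
have v0 : theta I v = 0.
  (* As [n <= 2^n], the power [v^(2^n)] is a multiple of [f^n]. *)
  apply: (sq n); rewrite (_ : cpow v _ =
      (cpow f (2 ^ n - n) ** cpow (star f) (2 ^ n)) ** cpow f n); first exact: mK.
  apply: contfun_ext => x; rewrite !cevalE !ceval_pow !cevalE exprMn mulrC.
  rewrite [in RHS]mulrAC -exprD subnK //; exact/ltnW/ltn_expl.
by apply: star_mul_eq0; rewrite -theta_star -thetaM.
Qed.

Lemma theta_null I f : (forall x, hull I x -> ceval f x = 0) -> theta I f = 0.
Proof.
move=> f0; apply: (cideal_nullstellensatz cX (cideal_theta I)) => //.
  exact: theta_radical.
have [n Hn] := fd_ideal_finite I.
(* A linear relation in [A/I] among [1, f, ..., f^n] is the nonzero polynomial that the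
   Nullstellensatz asks for. *)
have [c [j cj] c0] := dim_le_dependent (fun i : 'I_n.+1 => theta I (cpow f i)) Hn.
exists (\poly_(i < n.+1) c (inord i)).
  apply/eqP => /polyP/(_ j); rewrite coef_poly ltn_ord inord_val coef0 => /eqP.
  by rewrite (negbTE cj).
rewrite /= -c0 -theta_sum; congr (theta I _); apply: contfun_ext => x.
rewrite ceval_poly horner_poly ceval_sum; apply: eq_bigr => i _.
by rewrite inord_val ceval_pow.
Qed.

Lemma interpolate I (g : X -> C) :
  exists f, forall x, hull I x -> ceval f x = g x.
Proof.
have [s us sh] := hull_finite I; have [f Hf] := contfun_interpolation cX hX g s.
by exists f => x /sh; exact: Hf.
Qed.

Definition phiI I (g : X -> C) : quot I := theta I (projT1 (cid (interpolate I g))).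

(** Two interpolants of [g] differ by a function that vanishes on the hull, which [theta_null] sends
    to 0. *)
Lemma phiIE I (g : X -> C) f : (forall x, hull I x -> ceval f x = g x) ->
  phiI I g = theta I f.
Proof.
move=> fg; rewrite /phiI; case: cid => f' /= f'g; apply/subr0_eq.
by rewrite -thetaB; apply: theta_null => x hx; rewrite cevalB fg // f'g // subrr.
Qed.

Lemma phiI_ex I (g : X -> C) :
  exists2 f, (forall x, hull I x -> ceval f x = g x) & phiI I g = theta I f.
Proof. by have [f fg] := interpolate I g; exists f => //; exact: phiIE. Qed.

Lemma phiI_linear I (c : C) (g h : X -> C) :
  phiI I (fun x => c * g x + h x) = c *: phiI I g + phiI I h.
Proof.
have [f fg ->] := phiI_ex I g; have [k kh ->] := phiI_ex I h.
rewrite -theta_linear; apply: phiIE => x hx.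
by rewrite !cevalE fg // kh.
Qed.

Lemma phiI1 I : phiI I (fun=> 1) = sone.
Proof. by rewrite -theta1; apply: phiIE => x _. Qed.

Lemma phiIM I (g h : X -> C) : phiI I (fun x => g x * h x) = phiI I g ** phiI I h.
Proof.
have [f fg ->] := phiI_ex I g; have [k kh ->] := phiI_ex I h.
by rewrite -thetaM; apply: phiIE => x hx; rewrite !cevalE fg // kh.
Qed.

Lemma phiI_star I (g : X -> C) : phiI I (fun x => (g x)^*) = star (phiI I g).
Proof.
have [f fg ->] := phiI_ex I g.
by rewrite -theta_star; apply: phiIE => x hx; rewrite !cevalE fg.
Qed.

Lemma phiI_ceval I f : phiI I (ceval f) = theta I f.
Proof. exact: phiIE. Qed.

(** For [I] inside [J] the hull of [J] is contained in that of [I], so an interpolant for [I] also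
    serves for [J]. *)
Lemma phiI_compatible (g : X -> C) : compatible_family (fun I => phiI I g).
Proof.
move=> I J IJ /=; have [f fg ->] := phiI_ex I g.
have tIJ k : theta I k = 0 -> theta J k = 0.
  by rewrite /theta -!qproj0 => /qprojP kI; apply/qprojP/IJ.
rewrite quot_transE //; apply/esym/phiIE => x hx; apply: fg => k /tIJ; exact: hx.
Qed.

Definition phi_u (g : {ptws X -> C^o}) : Pu A :=
  @subalg_in R _ (compatible_subalgebra A) _ (phiI_compatible g).

Lemma phi_u_hom : star_hom phi_u.
Proof.
by split=> [c g h||g h|g]; apply: val_inj; apply: functional_extensionality_dep => I;
  [exact: phiI_linear | exact: phiI1 | exact: phiIM | exact: phiI_star].
Qed.

Lemma phi_u_extends f : phi_u (val f) = eta_u (val (gamma f)).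
Proof.
by apply: val_inj; apply: functional_extensionality_dep => I; exact: phiI_ceval.
Qed.

(** Shows that [phiI I] depends on finitely many values of [g], and linearly; hence its continuity
    for pointwise convergence. *)
Lemma phiI_sum I : exists s : seq X, exists e : X -> quot I,
  forall g : X -> C, phiI I g = \sum_(x <- s) g x *: e x.
Proof.
have [s us sh] := hull_finite I; exists s.
have [d Hd] := contfun_deltas R cX hX s.
exists (fun x => theta I (d x)) => g; rewrite -theta_sum; apply: phiIE => x /sh xs.
rewrite ceval_sum (big_rem x) //= (Hd x).1 mulr1 big_seq big1 ?addr0 // => y ys.
rewrite (Hd y).2 ?mulr0 //; move: ys; rewrite mem_rem_uniq // inE.
by case/andP => yx _; rewrite eq_sym.
Qed.

Lemma phiI_continuous I : continuous (fun g : {ptws X -> C^o} => phiI I g : quot I).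
Proof.
have [s [e Hs]] := phiI_sum I.
have -> : (fun g : {ptws X -> C^o} => phiI I g : quot I) =
    (fun g : {ptws X -> C^o} => \sum_(x <- s) (g x : C^o) *: e x).
  by apply/funext => g; exact: Hs.
apply: (@continuous_sum {ptws X -> C^o} _ (quot I) X s
  (fun x (g : {ptws X -> C^o}) => (g x : C^o) *: e x)) => x.
have lc : continuous (fun z : C^o => z *: e x : quot I).
  apply: (@lipschitz_continuous R C^o (quot I) _ `|e x|) => // y z.
  by rewrite -scalerBl normrZ mulrC.
move=> g; have pc := @proj_continuous X (fun=> C^o) x g.
exact: (continuous_comp pc (lc (g x))).
Qed.

Lemma phi_u_continuous : continuous phi_u.
Proof.
apply: (@continuous_comp_initial (Pu A) {ptws X -> C^o} _ (fun x : Pu A => val x)).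
apply: (@prod_continuous {ptws X -> C^o} _ (fun I : fd_ideal A => quot I)
  (fun (g : {ptws X -> C^o}) I => phiI I (g : X -> C))); exact: phiI_continuous.
Qed.

(** This is what sends bounded functions to bounded families; an interpolant may be much larger than
    [g], so its norm gives no such bound. *)
Lemma phiI_norm I (g : X -> C) (M : C) : 0 <= M -> (forall x, `|g x| <= M) ->
  `|phiI I g| <= M.
Proof.
move=> M0 gM.
(* M^2 - |g|^2 = |h|^2 pointwise makes M^2 - phiI(g)^* phiI(g) positive. *)
pose h x : C := sqrtC (M ^+ 2 - `|g x| ^+ 2).
have d0 x : 0 <= M ^+ 2 - `|g x| ^+ 2.
  by rewrite subr_ge0 lerXn2r ?nnegrE.
have E : M ^+ 2 *: sone - star (phiI I g) ** phiI I g =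
    star (phiI I h) ** phiI I h.
  rewrite -!phiI_star -!phiIM -phiI1 -scaleN1r addrC.
  have -> : (fun x => (h x)^* * h x) = (fun x => -1 * ((g x)^* * g x) + (M ^+ 2 * 1 + 0)).
    apply/funext => x; rewrite mulrC -normCK ger0_norm ?sqrtC_ge0 // sqrtCK.
    by rewrite [_ * g x]mulrC -normCK; ring.
  rewrite (phiI_linear I (-1)); congr (_ + _).
  have -> : (fun x => M ^+ 2 * 1 + 0) = (fun x : X => M ^+ 2 * 1 + (0 * 1 + 0)).
    by apply/funext => x; ring.
  have p0 : phiI I (fun=> 0) = 0 by rewrite -(theta0 I); apply: phiIE.
  rewrite (phiI_linear I (M ^+ 2)) (_ : (fun x => 0 * 1 + 0) = fun=> 0) ?p0 ?addr0 //.
  by apply/funext => x; ring.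
have : `|star (phiI I g) ** phiI I g| <= M ^+ 2.
  apply: pos_le_norm; rewrite ?exprn_ge0 //; first exact: pos_starM.
  by rewrite E; exact: pos_starM.
by rewrite cstar_identity ler_pXn2r ?nnegrE.
Qed.

End CommutativeSubalgebra.

(** * Normality *)

Section ProfiniteOrder.
Context (R : realType) (A : cstarAlgType R).
Local Notation C := R[i].

(** For [e = c - d], the elements [c e^2] and [d e^2] are positive with sum [(c^2 - d^2) e = 0], so
    both vanish; then [e^3 = 0], and [e = 0]. *)
Lemma comm_sqrt_unique (E : cstarAlgType R) (c d : E) :
  pos c -> pos d -> c ** d = d ** c -> c ** c = d ** d -> c = d.
Proof.
move=> pc pd cd sq; pose e := c - d.
have [cs ds] := (pos_star pc, pos_star pd).
have es : star e = e by rewrite starB cs ds.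
have ec : c ** e = e ** c by rewrite smulBr smulBl cd.
have ed : d ** e = e ** d by rewrite smulBr smulBl cd.
have pec : pos (c ** (e ** e)).
  by apply: posM => //; [exact: pos_sq|rewrite smulA ec -smulA ec smulA].
have ped : pos (d ** (e ** e)).
  by apply: posM => //; [exact: pos_sq|rewrite smulA ed -smulA ed smulA].
have s0 : c ** (e ** e) + d ** (e ** e) = 0.
  rewrite -smulDl smulA (_ : (c + d) ** e = 0) ?smul0l //.
  by rewrite smulDl !smulBr sq cd addrA subrK subrr.
have c0 : c ** (e ** e) = 0.
  apply: pos_anti => //; rewrite (_ : - _ = d ** (e ** e)) //; apply/eqP.
  by rewrite eq_sym -addr_eq0 addrC s0.
have d0 : d ** (e ** e) = 0 by move: s0; rewrite c0 add0r.
have e3 : e ** (e ** e) = 0 by rewrite {1}/e smulBl c0 d0 subrr.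
have e2 : e ** e = 0.
  by apply: star_mul_eq0; rewrite starM es -smulA e3 smul0r.
by apply/subr0_eq/star_mul_eq0; rewrite es.
Qed.

(** Each root commutes with its square, hence with the root [r] that [pos_sqrt] builds from that
    square; both are equal to [r] by the commuting case. *)
Lemma pos_sqrt_unique (E : cstarAlgType R) (c d : E) :
  pos c -> pos d -> c ** c = d ** d -> c = d.
Proof.
move=> pc pd cd; have [r [rs pr rr Hr]] := pos_sqrt (pos_sq (pos_star pc)).
have uniq y : pos y -> y ** y = c ** c -> y = r.
  move=> py yc; apply: comm_sqrt_unique; rewrite ?rr //.
  apply: (Hr [set z | y ** z = z ** y]); first exact: square_closed_comm.
  by rewrite /= -yc smulA.
by rewrite (uniq c) // (uniq d).
Qed.

Section Transition.
Context (I J : fd_ideal A) (IJ : ideal_set I `<=` ideal_set J).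

Lemma quot_transM (x y : quot I) :
  quot_trans J (x ** y) = quot_trans J x ** quot_trans J y.
Proof.
elim/Defs.quotP: x => a; elim/Defs.quotP: y => b.
rewrite [X in quot_trans _ X](quot_mulE I) !quot_transE //.
by rewrite [RHS](quot_mulE J).
Qed.

Lemma quot_trans_star (x : quot I) : quot_trans J (star x) = star (quot_trans J x).
Proof.
elim/Defs.quotP: x => a.
rewrite [X in quot_trans _ X](quot_starE I) !quot_transE //.
by rewrite [RHS](quot_starE J).
Qed.

Lemma quot_trans_pos (x : quot I) : pos x -> pos (quot_trans J x).
Proof.
move=> /pos_sqrt[c [cs _ <- _]]; rewrite quot_transM; apply: pos_sq.
by rewrite -quot_trans_star cs.
Qed.

End Transition.

Definition component (I : fd_ideal A) (x : Pb A) : quot I := val (val x) I.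

Lemma componentB I x y : component I (x - y) = component I x - component I y.
Proof.
have e : val (x - y) = val x - val y :> Pu A by exact: raddfB.
by rewrite /component e raddfB.
Qed.

Lemma componentM I x y : component I (x ** y) = component I x ** component I y.
Proof. by []. Qed.

Lemma component_star I x : component I (star x) = star (component I x).
Proof. by []. Qed.

Lemma component_ext x y : (forall I, component I x = component I y) -> x = y.
Proof.
by move=> xy; apply/val_inj/val_inj; exact: functional_extensionality_dep.
Qed.

Lemma component_trans x (I J : fd_ideal A) : ideal_set I `<=` ideal_set J ->
  quot_trans J (component I x) = component J x.
Proof. exact: (subalgP (val x)). Qed.

Lemma component_bounded x : exists M : C, forall I, `|component I x| <= M.
Proof. exact: (subalgP x). Qed.

(* The square roots of the components form a family compatible with the
   transition maps, because positive square roots are unique. *)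
Lemma Pb_star_leP x y :
  star_le x y <-> forall I, pos (component I y - component I x).
Proof.
split=> [[z yx] I|H].
  by rewrite -componentB yx componentM component_star; exact: pos_starM.
have H' I : pos (component I (y - x)) by rewrite componentB.
rewrite /star_le; move: (y - x) H' => w {}H.
pose z I := projT1 (cid (pos_sqrt (H I))).
have zP I : [/\ star (z I) = z I, pos (z I) & z I ** z I = component I w].
  by rewrite /z; case: cid => c [].
move: z zP => z zP.
have zc : compatible_family z.
  move=> I J IJ; have [zs pz zz] := zP I; have [zs' pz' zz'] := zP J.
  apply: pos_sqrt_unique => //; first exact: quot_trans_pos.
  by rewrite -quot_transM // zz zz' component_trans.
pose zu : Pu A := @subalg_in R _ (compatible_subalgebra A) _ zc.
have zb : bounded_family (val zu).
  have [M HM] := component_bounded w; exists (sqrtC M) => I.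
  have [zs pz zz] := zP I.
  have zM : `|z I| ^+ 2 <= M by rewrite -cstar_identity zs zz; exact: HM.
  have M0 : 0 <= M by apply: le_trans zM; rewrite exprn_ge0.
  by rewrite -(@ler_pXn2r _ 2) ?nnegrE ?sqrtC_ge0 // sqrtCK.
pose zz : Pb A := @subalg_in R _ (bounded_compatible_subalgebra A) _ zb.
exists zz; apply: component_ext => I; rewrite componentM component_star.
by have [zs _ <-] := zP I; rewrite -[component I zz]/(z I) zs.
Qed.

End ProfiniteOrder.

Section BoundedFunctions.
Context (R : realType) (X : eqType).
Local Notation C := R[i].
Implicit Types g h : linfty R X.

Definition beval g : X -> C := val g.

Lemma linfty_star_leP g h : star_le g h <-> forall x, 0 <= beval h x - beval g x.
Proof.
split=> [[z hg] x|H].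
  have -> : beval h x - beval g x = (beval z x)^* * beval z x.
    by have := congr1 (fun t : linfty R X => beval t x) hg.
  by rewrite mulrC mul_conjC_ge0.
pose z x : R[i]^o := sqrtC (beval h x - beval g x).
have zr x : (z x)^* = z x by apply/CrealP; rewrite ger0_real // sqrtC_ge0.
have zb : bounded_family (z : prod_topology (fun _ : X => R[i]^o)).
  have [M HM] := subalgP (h - g); exists (sqrtC M) => x.
  have zM : `|z x| ^+ 2 <= M by rewrite -normrX sqrtCK; exact: HM.
  have M0 : 0 <= M by apply: le_trans zM; rewrite exprn_ge0.
  by rewrite -(@ler_pXn2r _ 2) ?nnegrE ?sqrtC_ge0 // sqrtCK.
exists (@subalg_in R _ (bounded_subalgebra (fun _ : X => R[i]^o)) _ zb).
apply/val_inj; apply: functional_extensionality_dep => x.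
by rewrite -[LHS](sqrtCK (beval h x - beval g x)) -/(z x) expr2 -[X in X * _]zr.
Qed.

(** Otherwise lowering [s] by [e] at the single point [x] would leave an upper bound: suprema of
    bounded functions are pointwise. *)
Lemma linfty_sup_approx (S : set (linfty R X)) s x (e : C) :
  is_star_sup S s -> 0 < e -> exists2 g, S g & beval s x - beval g x < e.
Proof.
move=> [ub lub] e0; apply: contrapT => H.
pose d y : R[i]^o := if y == x then e else 0.
have db : bounded_family (d : prod_topology (fun _ : X => R[i]^o)).
  exists e => y; rewrite /d; case: ifP => _; first by rewrite gtr0_norm.
  by rewrite normr0 ltW.
pose D : linfty R X := @subalg_in R _ (bounded_subalgebra (fun _ : X => R[i]^o)) _ db.
have /linfty_star_leP/(_ x) : star_le s (s - D).
  apply: lub => g Sg; apply/linfty_star_leP => y.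
  have /linfty_star_leP/(_ y) sg := ub g Sg.
  rewrite [beval (s - D) y](_ : _ = beval s y - d y) // addrAC subr_ge0.
  rewrite /d; case: eqP => [->|_] //.
  have /linfty_star_leP/(_ x) gx := ub g Sg.
  rewrite real_leNgt ?(gtr0_real e0) ?(ger0_real gx) //.
  by apply/negP => lt; apply: H; exists g.
rewrite [beval (s - D) x](_ : _ = beval s x - d x) // /d eqxx addrAC subrr add0r.
by rewrite oppr_ge0 => /(lt_le_trans e0); rewrite ltxx.
Qed.

Lemma linfty_directed_approx (S : set (linfty R X)) s (r : seq X) (e : C) :
  S !=set0 ->
  (forall x y, S x -> S y -> exists z, [/\ S z, star_le x z & star_le y z]) ->
  is_star_sup S s -> 0 < e ->
  exists2 g, S g & forall x, x \in r -> 0 <= e - (beval s x - beval g x).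
Proof.
move=> [g0 Sg0] dir sup e0; elim: r => [|x r [g Sg Hg]]; first by exists g0.
have [h Sh Hh] := linfty_sup_approx x sup e0.
have [k [Sk /linfty_star_leP gk /linfty_star_leP hk]] := dir g h Sg Sh.
have le (l : linfty R X) y : 0 <= beval k y - beval l y ->
    0 <= e - (beval s y - beval l y) -> 0 <= e - (beval s y - beval k y).
  move=> kl sl; rewrite (_ : e - _ = (beval k y - beval l y) + (e - (beval s y - beval l y))).
    exact: addr_ge0.
  by ring.
exists k => // y; rewrite inE => /predU1P[->|yr].
  by apply: (le h) => //; rewrite subr_ge0 ltW.
by apply: (le g) => //; exact: Hg.
Qed.

End BoundedFunctions.

Lemma star_hom_le (R : realType) (M N : starAlgType R) (F : M -> N) (x y : M) :
  star_hom F -> star_le x y -> star_le (F x) (F y).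
Proof.
move=> [l _ m s] [z yx]; exists (F z).
by rewrite -s -m -yx addrC -scaleN1r -l scaleN1r addrC.
Qed.

(** * Injectivity and normality of the extended maps *)

Section Discretization.
Context (R : realType) (A : cstarAlgType R) (B : star_subalgebra A).
Context (X : topologicalType) (gamma : contfun R X -> subalg B).
Hypotheses (cX : compact [set: X]) (hX : hausdorff_space X).
Hypothesis iso : star_iso gamma.
Local Notation C := R[i].
Local Notation realize := (realize gamma).
Local Notation hull := (hull gamma).
Local Notation phiI := (phiI cX hX iso).
Implicit Types (f : contfun R X) (x : X) (I : fd_ideal A).

(** Evaluation is transported along [gamma]; the values chosen outside [B] are irrelevant to a
    partial character. *)
Lemma evaluation_character x : closed (subalg_set B) ->
  exists2 chi : A -> C, partial_character (subalg_set B) chi &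
    forall f, chi (realize f) = ceval f x.
Proof.
move=> cB; pose chi a := ceval (xget 0 [set f | realize f = a]) x.
have chiE f : chi (realize f) = ceval f x.
  rewrite /chi; congr (ceval _ x); apply: (realize_inj iso).
  by apply: (@xgetPex _ 0 [set g | realize g = realize f]); exists f.
exists chi => //; split.
- split; first exact: subalg_one.
  by rewrite -(realize1 iso) chiE.
- move=> c a b Ba Bb; split; first exact: subalg_lin.
  have [f fa] := realize_surj iso Ba; have [g gb] := realize_surj iso Bb.
  by rewrite -fa -gb -(realize_linear iso) !chiE ceval_linear.
- move=> a b Ba Bb; split; first exact: subalg_mul.
  have [f fa] := realize_surj iso Ba; have [g gb] := realize_surj iso Bb.
  by rewrite -fa -gb -(realizeM iso) !chiE cevalM.
- move=> a Ba; split; first exact: subalg_star.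
  have [f fa] := realize_surj iso Ba.
  by rewrite -fa -(realize_star iso) !chiE ceval_star.
(* For the bound by the norm: [|a| - a] has a self-adjoint root in [B], that is a real function [k],
   so [|a| - f x = k(x)^2 >= 0]. *)
move=> a Ba sa; have [c [cs _ cc Hc]] := pos_sqrt (pos_bound sa (lexx `|a|)).
have Bc : subalg_set B c.
  have sq := square_closed_subalg cB; apply: Hc => //.
  apply: square_closedB => //; apply: square_closedZ => //.
  exact: subalg_one.
have [f fa] := realize_surj iso Ba; have [k kc] := realize_surj iso Bc.
have ks : star k = k by apply: (realize_inj iso); rewrite (realize_star iso) kc.
have kr x' : (ceval k x')^* = ceval k x' by rewrite -ceval_star ks.
have kf : k ** k = `|a| *: sone - f.
  have r0 : realize 0 = 0.
    have := realize_linear iso (-1) 0 0.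
    by rewrite scaler0 addr0 scaleN1r addNr.
  apply: (realize_inj iso); rewrite (realizeM iso) kc cc.
  have -> : `|a| *: sone - f = (-1) *: f + (`|a| *: sone + 0).
    by rewrite addr0 scaleN1r addrC.
  by rewrite 2!(realize_linear iso) r0 (realize1 iso) fa addr0 scaleN1r addrC.
rewrite -{1}fa chiE -subr_ge0.
have -> : `|a| - ceval f x = ceval (k ** k) x by rewrite kf !cevalE mulr1.
by rewrite cevalM -{2}kr mul_conjC_ge0.
Qed.

Lemma hull_cover x : closed (subalg_set B) -> subhomogeneous A ->
  exists I : fd_ideal A, hull I x.
Proof.
move=> cB [n [_ sub]]; have [chi pc chiE] := evaluation_character x cB.
have [F EF FE] := character_extremal_state pc; have SF := EF.1.
have fd : finite_dim (gns SF).
  exists n; apply: sub; [exact: gns_representation | exact: extremal_irreducible].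
exists (fd_kernel (gns_representation SF) fd) => f.
rewrite /theta -(qproj0 (fd_kernel (gns_representation SF) fd)) => /qprojP.
rewrite subr0 => /(gns_kernel (SF := SF)).
by rewrite FE ?chiE //; exact: realize_mem.
Qed.

Lemma phiI_separates (g h : X -> C) x I : hull I x -> phiI I g = phiI I h ->
  g x = h x.
Proof.
move=> hx; have [f fg ->] := phiI_ex cX hX iso I g.
have [k kh ->] := phiI_ex cX hX iso I h => fk.
apply/eqP; rewrite -subr_eq0 -fg // -kh // -cevalB; apply/eqP/hx.
by rewrite (thetaB iso) fk subrr.
Qed.

Lemma phiI_ext I (g h : X -> C) : (forall x, hull I x -> g x = h x) ->
  phiI I g = phiI I h.
Proof.
move=> gh; have [f fh ->] := phiI_ex cX hX iso I h.
by apply: phiIE => x hx; rewrite fh // gh.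
Qed.

Lemma phi_u_inj : closed (subalg_set B) -> subhomogeneous A ->
  injective (phi_u cX hX iso).
Proof.
move=> cB sub g h gh; apply/funext => x; have [I hx] := hull_cover x cB sub.
apply: (phiI_separates hx).
by have /(congr1 (fun t => val t I)) := gh.
Qed.

Lemma phi_b_bounded (g : linfty R X) :
  bounded_family (val (phi_u cX hX iso (beval g))).
Proof.
have [M HM] := subalgP g; exists `|M| => I.
apply: phiI_norm => // x.
have Mx : `|beval g x| <= M := HM x.
by rewrite (ger0_norm (le_trans (normr_ge0 _) Mx)).
Qed.

Definition phi_b (g : linfty R X) : Pb A :=
  @subalg_in R _ (bounded_compatible_subalgebra A) _ (phi_b_bounded g).

Lemma phi_b_hom : star_hom phi_b.
Proof.
have [l o m s] := phi_u_hom cX hX iso.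
split=> [c g h||g h|g]; apply: val_inj.
- exact: l.
- exact: o.
- exact: m.
- exact: s.
Qed.

Lemma phi_b_inj : closed (subalg_set B) -> subhomogeneous A -> injective phi_b.
Proof.
move=> cB sub g h gh; apply/val_inj/(phi_u_inj cB sub).
by have /(congr1 val) := gh.
Qed.

Lemma phi_b_extends f : phi_b (contfun_linfty cX f) = eta_b (val (gamma f)).
Proof. by apply: val_inj; exact: phi_u_extends. Qed.

Lemma phiI_pos I (g : X -> C) : (forall x, hull I x -> 0 <= g x) -> pos (phiI I g).
Proof.
(* Off the hull [g] is arbitrary; [|g|] has a pointwise root everywhere and agrees with [g] on the
   hull, where alone values matter. *)
move=> g0; pose h x : C := sqrtC `|g x|.
rewrite (@phiI_ext _ _ (fun x => (h x)^* * h x)).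
  by rewrite phiIM phiI_star; exact: pos_starM.
move=> x hx; rewrite /h (CrealP _) ?ger0_real ?sqrtC_ge0 //.
by rewrite -expr2 sqrtCK ger0_norm // g0.
Qed.

(** That [phi_b s] is an upper bound is monotonicity. That it is the least one is checked in each
    [A/I]: directedness gives one [g] in [S] close to [s] on the finite hull, and closedness of the
    positive cone removes the error. *)
Lemma phi_b_normal : normal_map phi_b.
Proof.
move=> S s S0 _ dir sup; split=> [_ [g Sg <-]|u ub].
  by apply: star_hom_le phi_b_hom _; exact: sup.1.
apply/Pb_star_leP => I; apply: (closed_normP _).1; first exact: pos_closed.
move=> e e0; have [r _ rh] := hull_finite cX hX iso I.
have e2 : 0 < e / 2 by rewrite divr_gt0.
have [g Sg sg] := linfty_directed_approx r S0 dir sup e2.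
(* The shifted difference is the sum of [u - phi g] and [phi (e/2 - s + g)] in [A/I]; the second
   term is positive because [g] is within [e/2] of [s] on the hull. *)
exists (component I u - component I (phi_b s) + (e / 2) *: sone).
  have -> : component I u - component I (phi_b s) + (e / 2) *: sone =
     (component I u - component I (phi_b g)) +
     phiI I (fun x => e / 2 * 1 + (-1 * beval s x + beval g x)).
    by rewrite 2!(phiI_linear cX hX iso) phiI1; lmod.
  apply: posD; first by have /Pb_star_leP := ub _ (ex_intro2 _ _ g Sg erefl).
  apply: phiI_pos => x /rh xr; move: (sg x); rewrite mulr1 mulN1r.
  by rewrite [- _ + _]addrC -(opprB (beval s x)); apply.
rewrite opprD addrA subrr add0r normrN normrZ gtr0_norm //.
apply: le_lt_trans (_ : _ <= e / 2 * 1) _; first by rewrite ler_pM2l // norm_one_le1.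
by rewrite mulr1 gtr_pMr // invf_lt1 // ltr1n.
Qed.
End Discretization.

Section Eta.
Context (R : realType) (A : cstarAlgType R).

Lemma eta_u_hom : star_hom (@eta_u R A).
Proof.
split=> [c a b||a b|a]; apply: val_inj; apply: functional_extensionality_dep => I.
- by rewrite [LHS]qprojD qprojZ.
- by [].
- by rewrite -[LHS]quot_mulE.
- by rewrite -[LHS]quot_starE.
Qed.

Lemma eta_b_hom : star_hom (@eta_b R A).
Proof.
have [l o m s] := eta_u_hom.
split=> [c a b||a b|a]; apply: val_inj.
- exact: l.
- exact: o.
- exact: m.
- exact: s.
Qed.

End Eta.

Theorem theorem3p5 (R : realType) (A : cstarAlgType R) :
  [/\ injective (@eta_b R A) <-> residually_finite_dimensional A,
      injective (@eta_u R A) <-> residually_finite_dimensional A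
    & subhomogeneous A ->
      faithful_wstar_discretization (@eta_b R A) /\
      faithful_procstar_discretization (@eta_u R A)].
Proof.
split=> [||sub].
- by apply: iff_trans (eta_u_rfd A); exact: eta_b_inj.
- exact: eta_u_rfd.
have inj := subhomogeneous_eta_inj sub.
split; split=> [||B X].
- exact: eta_b_hom.
- exact/eta_b_inj.
- move=> cX gamma hX [cB _] iso; exists (phi_b cX hX iso); split.
  + exact: phi_b_hom.
  + exact: phi_b_normal.
  + exact: phi_b_inj.
  + exact: phi_b_extends.
- exact: eta_u_hom.
- exact: inj.
- move=> gamma cX hX [cB _] iso; exists (phi_u cX hX iso); split.
  + exact: phi_u_hom.
  + exact: phi_u_continuous.
  + exact: phi_u_inj.
  + exact: phi_u_extends.
Qed.
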